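(* For $\lambda\in\mathbb{C}\setminus\{0,1\}$ and $\mu\in\mathbb{C}$ let \[ q_{\lambda,\mu} = -\frac{dz^2}{4\pi^2} \biggl( \frac{1}{z^2} + \frac{1}{(z-1)^2} + \frac{1}{(z-\lambda)^2} + \frac{\mu -2z}{z(z-1)(z-\lambda)} \biggr) \] on $\mathbb{P}^1=\mathbb{C}\cup\{\infty\}$; it has double poles at $0,1,\lambda,\infty$, each of residue $1$. Suppose $q=q_{\lambda,\mu}$ is a Strebel differential. Then $q$ has either two double zeroes or four simple zeroes. Moreover, $q_{\lambda,\mu}$ is a Strebel differential with two double zeroes if and only if $\lambda\in\mathbb{R}\setminus\{0,1\}$ and \[ \mu=\mu(\lambda)=\begin{cases} 2\lambda+2, & \lambda<0,\\ 2-2\lambda, & 0<\lambda<1,\\ 2\lambda-2, & \lambda>1.\end{cases} \] In this case, for every $\lambda\in\mathbb{R}\setminus\{0,1\}$ the metric ribbon graph of $q_{\lambda,\mu(\lambda)}$ coincides with that of $q_{\lambda_0,\mu(\lambda_0)}$ for some $\lambda_0\in[\tfrac12,1)$, and the metric ribbon graph of $q_{\lambda_0,\mu(\lambda_0)}$ consists of two vertices (the two double zeroes) joined by four edges, whose lengths, in the cyclic order around one vertex, are $\tfrac12+s,\ \tfrac12-s,\ \tfrac12+s,\ \tfrac12-s$, where $s=\frac{\arcsin(2\lambda_0-1)}{\pi}$.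
   Context: A meromorphic quadratic differential $q$ on a compact Riemann surface $X$ is locally $f(z)\,dz^2$; away from its zeros and poles it defines the flat metric $|f(z)|\,|dz|^2$ (the $q$-metric). A horizontal trajectory is a maximal curve $\gamma$ with $f(\gamma(t))\gamma'(t)^2>0$. A double pole $p$ of $q$ has residue $a>0$ if in a local coordinate $z$ with $z(p)=0$, $q=\bigl(-\frac{a^2}{4\pi^2 z^2}+O(z^{-1})\bigr)dz^2$ (equivalently, closed trajectories around $p$ have $q$-length $a$). Given marked points $p_1,\dots,p_n$, a Strebel differential is a meromorphic quadratic differential, holomorphic outside $\{p_i\}$, with a double pole at each $p_i$ of residue $a_i>0$, such that the union of non-closed horizontal trajectories has measure zero and every closed horizontal trajectory is a circle around some $p_i$. The critical graph of a Strebel differential has as vertices the zeroes of $q$ and as edges the critical horizontal trajectories (those ending at zeroes); with edge lengths measured in the $q$-metric and the cyclic ordering of edges at each vertex induced by the orientation of the surface, it is the metric ribbon graph of $q$. *)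

(* Defs.v *)
From Stdlib Require Import Reals List.
From Coquelicot Require Import Coquelicot.

Open Scope R_scope.

Definition cis (th : R) : C := (cos th, sin th).

Fixpoint Cpown (z : C) (n : nat) : C :=
  match n with O => RtoC 1 | S k => Cmult z (Cpown z k) end.

Definition qf (lam mu : C) (z : C) : C :=
  ((- / (4 * PI ^ 2))%R : C) *
  (/ (z * z) + / ((z - 1) * (z - 1)) + / ((z - lam) * (z - lam))
   + (mu - 2 * z) / (z * (z - 1) * (z - lam)))%C.

(* the finite marked points 0, 1, lambda (infinity is always marked) *)
Definition qpoles (lam : C) : list C := (RtoC 0 :: RtoC 1 :: lam :: nil).

Definition mu_of (l : R) : R :=
  if Rlt_dec l 0 then 2 * l + 2
  else if Rlt_dec l 1 then 2 - 2 * l else 2 * l - 2.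

(* ---------- Generic notions for q = f(z) dz^2 on P^1 = C u {oo}, with the
   finite marked points ps and the point oo always marked ---------- *)

Definition holo_at (g : C -> C) (z : C) : Prop :=
  @ex_derive C_AbsRing C_NormedModule g z.

Definition is_zero (f : C -> C) (ps : list C) (z : C) : Prop :=
  ~ In z ps /\ f z = RtoC 0.

Definition zero_order (f : C -> C) (z0 : C) (k : nat) : Prop :=
  f z0 = RtoC 0 /\
  exists (r : R) (g : C -> C), 0 < r /\ g z0 <> RtoC 0 /\
    forall z, Cmod (z - z0) < r -> holo_at g z /\ f z = (Cpown (z - z0) k * g z)%C.

Definition two_double_zeros (f : C -> C) (ps : list C) : Prop :=
  exists z1 z2 : C, z1 <> z2 /\
    (forall z, is_zero f ps z <-> (z = z1 \/ z = z2)) /\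
    zero_order f z1 2 /\ zero_order f z2 2.

Definition four_simple_zeros (f : C -> C) (ps : list C) : Prop :=
  exists z1 z2 z3 z4 : C,
    z1 <> z2 /\ z1 <> z3 /\ z1 <> z4 /\ z2 <> z3 /\ z2 <> z4 /\ z3 <> z4 /\
    (forall z, is_zero f ps z <-> (z = z1 \/ z = z2 \/ z = z3 \/ z = z4)) /\
    zero_order f z1 1 /\ zero_order f z2 1 /\ zero_order f z3 1 /\ zero_order f z4 1.

Definition dpole_res (f : C -> C) (p : C) (a : R) : Prop :=
  exists r M : R, 0 < r /\ forall z, 0 < Cmod (z - p) < r ->
    Cmod (f z + RtoC (a ^ 2 / (4 * PI ^ 2)) / ((z - p) * (z - p)))%C
      <= M / Cmod (z - p).

(* double pole at oo with residue a, in the coordinate w = 1/z, in which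
   q = f(1/w) w^(-4) dw^2 *)
Definition dpole_res_inf (f : C -> C) (a : R) : Prop :=
  exists r M : R, 0 < r /\ forall w, 0 < Cmod w < r ->
    Cmod (f (/ w) / Cpown w 4 + RtoC (a ^ 2 / (4 * PI ^ 2)) / (w * w))%C
      <= M / Cmod w.

Definition in_int (a b : Rbar) (t : R) : Prop := Rbar_lt a t /\ Rbar_lt t b.

Definition img (g : R -> C) (a b : Rbar) (z : C) : Prop :=
  exists t, in_int a b t /\ g t = z.

Definition same_set (A B : C -> Prop) : Prop := forall z, A z <-> B z.

Definition horiz (f : C -> C) (ps : list C) (g : R -> C) (a b : Rbar) : Prop :=
  Rbar_lt a b /\ forall t, in_int a b t ->
    ~ In (g t) ps /\
    exists d : C, is_derive g t d /\
      Im (f (g t) * d * d)%C = 0 /\ 0 < Re (f (g t) * d * d)%C.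

Definition unit_horiz (f : C -> C) (ps : list C) (g : R -> C) (a b : Rbar) : Prop :=
  horiz f ps g a b /\ forall t, in_int a b t ->
    exists d : C, is_derive g t d /\ Cmod (f (g t)) * (Cmod d) ^ 2 = 1.

Definition is_traj (f : C -> C) (ps : list C) (S : C -> Prop) : Prop :=
  (exists g a b, horiz f ps g a b /\ same_set (img g a b) S) /\
  forall g a b, horiz f ps g a b -> (exists t, in_int a b t /\ S (g t)) ->
    forall t, in_int a b t -> S (g t).

Definition closed_traj (f : C -> C) (ps : list C) (S : C -> Prop) : Prop :=
  is_traj f ps S /\
  exists (g : R -> C) (T : R), 0 < T /\ horiz f ps g m_infty p_infty /\
    (forall t, g (t + T) = g t) /\ same_set (img g m_infty p_infty) S.

Definition null2 (A : C -> Prop) : Prop :=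
  forall eps, 0 < eps -> exists x1 x2 y1 y2 : nat -> R,
    (forall n, x1 n <= x2 n /\ y1 n <= y2 n) /\
    (forall z, A z -> exists n, x1 n <= Re z <= x2 n /\ y1 n <= Im z <= y2 n) /\
    forall N, sum_f_R0 (fun n => (x2 n - x1 n) * (y2 n - y1 n)) N <= eps.

Definition pconn (U : C -> Prop) (x y : C) : Prop :=
  exists g : R -> C, (forall t, continuous g t) /\ g 0 = x /\ g 1 = y /\
    forall t, 0 <= t <= 1 -> U (g t).

(* points of P^1 = option C, None = oo; same connected component of
   P^1 minus the bounded set S *)
Definition same_comp (S : C -> Prop) (p p' : option C) : Prop :=
  let U := fun z => ~ S z in
  match p, p' with
  | Some x, Some y => pconn U x y
  | Some x, None | None, Some x =>
      forall M, exists w, M < Cmod w /\ pconn U x w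
  | None, None => True
  end.

Definition marked (ps : list C) : list (option C) := map Some ps ++ (None :: nil).

Definition circle_around (ps : list C) (S : C -> Prop) : Prop :=
  exists p, In p (marked ps) /\
    forall p', In p' (marked ps) -> p' <> p -> ~ same_comp S p p'.

Definition is_strebel (f : C -> C) (ps : list C) : Prop :=
  NoDup ps /\
  (forall z, ~ In z ps -> holo_at f z) /\
  (forall p, In p ps -> exists a, 0 < a /\ dpole_res f p a) /\
  (exists a, 0 < a /\ dpole_res_inf f a) /\
  null2 (fun z => exists S, is_traj f ps S /\ ~ closed_traj f ps S /\ S z) /\
  (forall S, closed_traj f ps S -> circle_around ps S).

(* half-edge at the zero z with limiting direction u (a unit complex number):
   the trajectory S, parametrized by q-arclength on (a,b), tends to z as t -> a+
   with (g t - z)/|g t - z| -> u. *)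
Definition hedge_of (f : C -> C) (ps : list C) (z u : C) (S : C -> Prop) : Prop :=
  is_traj f ps S /\ is_zero f ps z /\
  exists (g : R -> C) (a : R) (b : Rbar), unit_horiz f ps g a b /\
    same_set (img g a b) S /\
    filterlim g (at_right a) (locally z) /\
    filterlim (fun t => (g t - z) / RtoC (Cmod (g t - z)))%C (at_right a) (locally u).

Definition hedge (f : C -> C) (ps : list C) (h : C * C) : Prop :=
  exists S, hedge_of f ps (fst h) (snd h) S.

Definition edge_len (f : C -> C) (ps : list C) (S : C -> Prop) (l : R) : Prop :=
  exists (g : R -> C) (a b : R), unit_horiz f ps g a b /\
    same_set (img g a b) S /\ b - a = l.

Definition hlen (f : C -> C) (ps : list C) (h : C * C) (l : R) : Prop :=
  exists S, hedge_of f ps (fst h) (snd h) S /\ edge_len f ps S l.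

Definition opp (f : C -> C) (ps : list C) (h h' : C * C) : Prop :=
  h <> h' /\ exists S, hedge_of f ps (fst h) (snd h) S /\ hedge_of f ps (fst h') (snd h') S.

Definition next (f : C -> C) (ps : list C) (h h' : C * C) : Prop :=
  hedge f ps h /\ hedge f ps h' /\ fst h' = fst h /\
  exists th, 0 < th <= 2 * PI /\ snd h' = (snd h * cis th)%C /\
    forall w th1, hedge f ps (fst h, w) -> 0 < th1 < th -> w <> (snd h * cis th1)%C.

Definition ribbon_iso (f1 : C -> C) (ps1 : list C) (f2 : C -> C) (ps2 : list C) : Prop :=
  exists Phi : C * C -> C * C,
    (forall h, hedge f1 ps1 h -> hedge f2 ps2 (Phi h)) /\
    (forall h h', hedge f1 ps1 h -> hedge f1 ps1 h' -> Phi h = Phi h' -> h = h') /\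
    (forall k, hedge f2 ps2 k -> exists h, hedge f1 ps1 h /\ Phi h = k) /\
    (forall h h', hedge f1 ps1 h -> hedge f1 ps1 h' ->
       (opp f1 ps1 h h' <-> opp f2 ps2 (Phi h) (Phi h')) /\
       (next f1 ps1 h h' <-> next f2 ps2 (Phi h) (Phi h'))) /\
    (forall h l, hedge f1 ps1 h -> (hlen f1 ps1 h l <-> hlen f2 ps2 (Phi h) l)).

Definition two_vertex_four_edges (f : C -> C) (ps : list C) (l1 l2 l3 l4 : R) : Prop :=
  exists z1 z2 : C, z1 <> z2 /\ (forall z, is_zero f ps z <-> (z = z1 \/ z = z2)) /\
  exists u1 u2 u3 u4 w1 w2 w3 w4 : C,
    (forall h, hedge f ps h <->
       (h = (z1, u1) \/ h = (z1, u2) \/ h = (z1, u3) \/ h = (z1, u4) \/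
        h = (z2, w1) \/ h = (z2, w2) \/ h = (z2, w3) \/ h = (z2, w4))) /\
    w1 <> w2 /\ w1 <> w3 /\ w1 <> w4 /\ w2 <> w3 /\ w2 <> w4 /\ w3 <> w4 /\
    opp f ps (z1, u1) (z2, w1) /\ opp f ps (z1, u2) (z2, w2) /\
    opp f ps (z1, u3) (z2, w3) /\ opp f ps (z1, u4) (z2, w4) /\
    (exists th2 th3 th4 : R, 0 < th2 < th3 /\ th3 < th4 < 2 * PI /\
       u2 = (u1 * cis th2)%C /\ u3 = (u1 * cis th3)%C /\ u4 = (u1 * cis th4)%C) /\
    hlen f ps (z1, u1) l1 /\ hlen f ps (z1, u2) l2 /\
    hlen f ps (z1, u3) l3 /\ hlen f ps (z1, u4) l4.

(* Main.v *)
(** Write N for the numerator of q.  With nu = mu - 2 (1 + lam) one has N = (z^2 - lam)^2 + nu z (z - 1) (z - lam), which has four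
    simple zeros unless nu is 0, -4 or -4 lam.  In these three cases N is a square and q = -(d log F)^2 / (4 PI^2), where
    F = (z - b) (z - c) / (z - p) and (p, b, c) is a permutation of (0, 1, lam), so that |F| is constant along horizontal curves.

    If B^2 = b - p and D^2 = c - p, the critical values of F are -(B - D)^2 and -(B + D)^2.  When their moduli differ, a level curve
    |F| = r with r in between is a single closed trajectory having two marked points on either side: q is not Strebel.  Equality
    of the moduli says that (b - p) / (c - p) is negative, i.e. lam is real and p is the middle one of 0, 1, lam.

    Conversely, if b < p < c, the critical level |F| = c - b is the union of two orthogonal circles centred at b and c and meeting
    at the two zeros; every other level consists of closed trajectories.  Along an arc the q-length is the
    variation of arg F divided by 2 PI.  A real affine map carries (p, b, c) to (l0, 0, 1), possibly reversing the
    order of b and c, which gives l0 >= 1/2. *)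

Require Import Defs.
From Stdlib Require Import Reals List Lra Lia Psatz Ranalysis5 Nsatz.
From Coquelicot Require Import Coquelicot.

(** * Complex numbers and curves in the plane *)

(** A trajectory is a maximal set: every horizontal curve that meets it must stay in it. This is
    never deduced from uniqueness for differential equations. Each trajectory is described as the
    part of a level of [|F|] on which certain continuous real functions have prescribed signs. As
    [|F|] is constant along horizontal curves and these functions vanish at no regular point of the
    level, the signs cannot change along a horizontal curve. The parametrizations are explicit too.
    The equation [F z = r cis th] is quadratic in [z], and a smooth root of its discriminant
    [(w - v1) (w - v2)] along the circle [|w| = r] changes sign, in one turn, once for each critical
    value [v1], [v2] inside the circle. One value inside gives a single curve that closes after two
    turns; none or both give two curves, each closing after one turn. That a closed trajectory
    separates marked points is likewise shown without the Jordan curve theorem, by the intermediate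
    value theorem for a function that vanishes only on the trajectory. *)

Lemma C_ext (z w : C) : Re z = Re w -> Im z = Im w -> z = w.
Proof. destruct z, w; simpl; intros; subst; reflexivity. Qed.

Lemma C_eq_zero_iff (z : C) : z = RtoC 0 <-> Re z = 0 /\ Im z = 0.
Proof.
  split; [intros ->; split; reflexivity | intros [h1 h2]; apply C_ext; assumption].
Qed.

Lemma Cminus_eq_zero (z w : C) : (z - w)%C = RtoC 0 -> z = w.
Proof. intros h. replace z with ((z - w) + w)%C by ring. rewrite h. ring. Qed.

Lemma Cminus_neq_zero (z w : C) : z <> w -> (z - w)%C <> RtoC 0.
Proof. intros h k; apply h, Cminus_eq_zero, k. Qed.

Lemma Cmult_integral (z w : C) : (z * w)%C = RtoC 0 -> z = RtoC 0 \/ w = RtoC 0.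
Proof.
  intros h. destruct (Req_dec (Cmod z) 0) as [hz | hz].
  - left; apply Cmod_eq_0, hz.
  - right; apply Cmod_eq_0. apply Rmult_eq_reg_l with (Cmod z); [| exact hz].
    rewrite <- Cmod_mult, h, Cmod_0; ring.
Qed.

Lemma Csqr_eq (z w : C) : (z * z)%C = (w * w)%C -> z = w \/ z = (- w)%C.
Proof.
  intros h. destruct (Cmult_integral (z - w) (z + w)) as [k | k].
  - replace ((z - w) * (z + w))%C with (z * z - w * w)%C by ring. rewrite h; ring.
  - left; apply Cminus_eq_zero, k.
  - right; apply Cminus_eq_zero. rewrite <- k; ring.
Qed.

Lemma Ceq_dec (z w : C) : {z = w} + {z <> w}.
Proof.
  destruct z as [a b], w as [c d].
  destruct (Req_EM_T a c) as [-> | h]; [destruct (Req_EM_T b d) as [-> | h] |].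
  - left; reflexivity.
  - right; intros k; injection k; auto.
  - right; intros k; injection k; auto.
Qed.

Lemma Cmod_sqr (z : C) : Cmod z ^ 2 = Re z ^ 2 + Im z ^ 2.
Proof. apply Cmod2_alt. Qed.

Lemma Csqrt_ex (z : C) : exists s : C, (s * s)%C = z.
Proof.
  destruct z as [x y]. set (m := Cmod (x, y)).
  assert (hm : m ^ 2 = x ^ 2 + y ^ 2) by (apply (Cmod_sqr (x, y))).
  assert (m0 : 0 <= m) by apply Cmod_ge_0.
  assert (h1 : 0 <= (m + x) / 2) by nra. assert (h2 : 0 <= (m - x) / 2) by nra.
  pose proof (sqrt_sqrt _ h1) as q1. pose proof (sqrt_sqrt _ h2) as q2.
  assert (q3 : sqrt ((m + x) / 2) * sqrt ((m - x) / 2) = Rabs y / 2).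
  { rewrite <- sqrt_mult by assumption.
    replace ((m + x) / 2 * ((m - x) / 2)) with ((y / 2)²) by (unfold Rsqr; nra).
    rewrite sqrt_Rsqr_abs. unfold Rdiv at 1. rewrite Rabs_mult, (Rabs_pos_eq (/ 2)) by lra. reflexivity. }
  destruct (Rle_dec 0 y) as [hy | hy].
  - exists (sqrt ((m + x) / 2), sqrt ((m - x) / 2)). rewrite Rabs_pos_eq in q3 by lra.
    apply C_ext; simpl; nra.
  - exists (sqrt ((m + x) / 2), - sqrt ((m - x) / 2)). rewrite Rabs_left in q3 by lra.
    apply C_ext; simpl; nra.
Qed.

Lemma cis_plus (a b : R) : cis (a + b) = (cis a * cis b)%C.
Proof.
  apply C_ext; simpl; [apply cos_plus | rewrite sin_plus; ring].
Qed.

Lemma cis_opp_conj (a : R) : cis (- a) = Cconj (cis a).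
Proof. apply C_ext; simpl; [apply cos_neg | apply sin_neg]. Qed.

Lemma Cmod_cis (a : R) : Cmod (cis a) = 1.
Proof.
  pose proof (sin2_cos2 a) as h; unfold Rsqr in h.
  pose proof (Cmod_sqr (cis a)) as k. simpl in k. pose proof (Cmod_ge_0 (cis a)). nra.
Qed.

Lemma cis_neq_0 (a : R) : cis a <> RtoC 0.
Proof. intros h. pose proof (Cmod_cis a) as k. rewrite h, Cmod_0 in k. lra. Qed.

Lemma cis_2PI (a : R) : cis (a + 2 * PI) = cis a.
Proof. unfold cis. rewrite cos_plus, sin_plus, cos_2PI, sin_2PI. f_equal; ring. Qed.

Lemma cis_PI (a : R) : cis (a + PI) = (- cis a)%C.
Proof. unfold cis, Copp; simpl. rewrite neg_cos, neg_sin. reflexivity. Qed.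

Lemma cis_half_PI (a : R) : cis (a + PI / 2) = (Ci * cis a)%C.
Proof. rewrite cis_plus. unfold cis at 2. rewrite cos_PI2, sin_PI2. unfold Ci. ring. Qed.

Lemma polar (z : C) : exists th, - PI <= th <= PI /\ z = (RtoC (Cmod z) * cis th)%C.
Proof.
  destruct (Ceq_dec z (RtoC 0)) as [-> | hz].
  { exists 0. pose proof PI_RGT_0. split; [lra |]. rewrite Cmod_0. ring. }
  assert (m0 : 0 < Cmod z) by (apply Cmod_gt_0, hz).
  pose proof (Cmod_sqr z) as hm. set (m := Cmod z) in *.
  set (x := Re z) in *; set (y := Im z) in *.
  assert (hx : -1 <= x / m <= 1).
  { split.
    - apply Rmult_le_reg_r with m; [assumption |]. unfold Rdiv. rewrite Rmult_assoc, Rinv_l by lra. nra.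
    - apply Rmult_le_reg_r with m; [assumption |]. unfold Rdiv. rewrite Rmult_assoc, Rinv_l by lra. nra. }
  pose proof (acos_bound (x / m)) as hb. pose proof (cos_acos _ hx) as hc.
  assert (hs : m * sin (acos (x / m)) = Rabs y).
  { rewrite sin_acos by assumption.
    replace (1 - (x / m)²) with ((Rabs y / m)²).
    - rewrite sqrt_Rsqr; [field; lra |]. apply Rdiv_le_0_compat; [apply Rabs_pos | lra].
    - unfold Rsqr. replace (Rabs y / m * (Rabs y / m)) with ((Rabs y * Rabs y) / (m * m)) by (field; lra).
      replace (Rabs y * Rabs y) with (m * m - x * x); [field; lra |].
      rewrite <- Rabs_mult, Rabs_pos_eq; nra. }
  destruct (Rle_dec 0 y) as [hy | hy].
  - exists (acos (x / m)). split; [lra |]. rewrite Rabs_pos_eq in hs by assumption.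
    apply C_ext; simpl; [rewrite hc; unfold x; field_simplify; [fold x; unfold x; reflexivity | lra] |].
    rewrite Rmult_0_l, Rplus_0_r. symmetry. exact hs.
  - exists (- acos (x / m)). split; [lra |]. rewrite Rabs_left in hs by lra.
    apply C_ext; simpl; rewrite ?cos_neg, ?sin_neg.
    + rewrite hc. unfold x. field; lra.
    + rewrite Rmult_0_l, Rplus_0_r. fold y. lra.
Qed.

(** Curves are differentiated in the real plane, so the rules for products and inverses of
    complex-valued curves reduce to real calculus in the two coordinates. *)
Lemma is_derive_C_iff (g : R -> C) (t : R) (d : C) :
  is_derive g t d <->
  is_derive (fun t => Re (g t)) t (Re d) /\ is_derive (fun t => Im (g t)) t (Im d).
Proof.
  split.
  - intros h. split.
    + apply (filterdiff_comp' g (fst : C -> R) t (fun y => scal y d) fst); [exact h |].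
      apply filterdiff_linear, is_linear_fst.
    + apply (filterdiff_comp' g (snd : C -> R) t (fun y => scal y d) snd); [exact h |].
      apply filterdiff_linear, is_linear_snd.
  - intros [h1 h2].
    apply (is_derive_ext (fun t => plus (scal (Re (g t)) ((1, 0) : C)) (scal (Im (g t)) ((0, 1) : C)))).
    { intros s. apply C_ext; cbv [plus scal]; simpl; cbv [plus scal mult]; simpl; cbv [mult]; simpl; ring. }
    replace d with (plus (scal (Re d) ((1, 0) : C)) (scal (Im d) ((0, 1) : C)) : C).
    2:{ apply C_ext; cbv [plus scal]; simpl; cbv [plus scal mult]; simpl; cbv [mult]; simpl; ring. }
    apply (is_derive_plus (V := prod_NormedModule R_AbsRing R_NormedModule R_NormedModule)).
    + apply (is_derive_scal_l (V := prod_NormedModule R_AbsRing R_NormedModule R_NormedModule)), h1.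
    + apply (is_derive_scal_l (V := prod_NormedModule R_AbsRing R_NormedModule R_NormedModule)), h2.
Qed.

Lemma is_derive_C_const (z : C) (t : R) : is_derive (fun _ : R => z) t (RtoC 0).
Proof. apply is_derive_C_iff; split; (evar_last; [apply is_derive_const | reflexivity]). Qed.

Lemma is_derive_C_plus (f g : R -> C) t (df dg : C) :
  is_derive f t df -> is_derive g t dg -> is_derive (fun t => f t + g t)%C t (df + dg)%C.
Proof.
  rewrite !is_derive_C_iff. intros [h1 h2] [k1 k2].
  split; [apply (is_derive_plus _ _ _ _ _ h1 k1) | apply (is_derive_plus _ _ _ _ _ h2 k2)].
Qed.

Lemma is_derive_C_opp (f : R -> C) t (df : C) :
  is_derive f t df -> is_derive (fun t => - f t)%C t (- df)%C.
Proof.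
  rewrite !is_derive_C_iff. intros [h1 h2].
  split; [apply (is_derive_opp _ _ _ h1) | apply (is_derive_opp _ _ _ h2)].
Qed.

Lemma is_derive_C_minus (f g : R -> C) t (df dg : C) :
  is_derive f t df -> is_derive g t dg -> is_derive (fun t => f t - g t)%C t (df - dg)%C.
Proof. intros h k. apply is_derive_C_plus; [| apply is_derive_C_opp]; assumption. Qed.

Lemma is_derive_C_mult (f g : R -> C) t (df dg : C) :
  is_derive f t df -> is_derive g t dg -> is_derive (fun t => f t * g t)%C t (df * g t + f t * dg)%C.
Proof.
  rewrite !is_derive_C_iff. intros [h1 h2] [k1 k2]. cbv [Re Im] in *. split; simpl.
  - evar_last.
    + apply (is_derive_minus (fun t => fst (f t) * fst (g t)) (fun t => snd (f t) * snd (g t))).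
      * apply (is_derive_mult _ _ _ _ _ h1 k1); intros; apply Rmult_comm.
      * apply (is_derive_mult _ _ _ _ _ h2 k2); intros; apply Rmult_comm.
    + cbv [minus plus opp mult]; simpl. cbv [mult]; simpl. ring.
  - evar_last.
    + apply (is_derive_plus (fun t => fst (f t) * snd (g t)) (fun t => snd (f t) * fst (g t))).
      * apply (is_derive_mult _ _ _ _ _ h1 k2); intros; apply Rmult_comm.
      * apply (is_derive_mult _ _ _ _ _ h2 k1); intros; apply Rmult_comm.
    + cbv [minus plus opp mult]; simpl. cbv [mult]; simpl. ring.
Qed.

Lemma is_derive_C_inv (f : R -> C) t (df : C) :
  is_derive f t df -> f t <> RtoC 0 -> is_derive (fun t => / f t)%C t (- df / (f t * f t))%C.
Proof.
  rewrite !is_derive_C_iff. intros [h1 h2] h0. cbv [Re Im] in *.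
  assert (hn : fst (f t) ^ 2 + snd (f t) ^ 2 <> 0).
  { intros k. apply h0, C_eq_zero_iff. cbv [Re Im]. split; nra. }
  assert (hn' : (f t * f t)%C <> RtoC 0) by (intros k; destruct (Cmult_integral _ _ k); auto).
  (* Up to sign both components of [1 / f] have the shape [u / (u^2 + v^2)], with the two
     coordinates exchanged for the imaginary part. *)
  assert (aux : forall u v : R -> R, forall du dv, is_derive u t du -> is_derive v t dv -> u t ^ 2 + v t ^ 2 <> 0 ->
    is_derive (fun t => u t / (u t ^ 2 + v t ^ 2)) t
      ((du * (u t ^ 2 + v t ^ 2) - u t * (2 * u t * du + 2 * v t * dv)) / (u t ^ 2 + v t ^ 2) ^ 2)).
  { intros u v du dv hu hv hz.
    pose proof (is_derive_unique _ _ _ hu) as e1. pose proof (is_derive_unique _ _ _ hv) as e2.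
    auto_derive.
    - repeat split; trivial; [eexists; exact hu | eexists; exact hu | eexists; exact hv].
    - change (Derive (fun x => u x) t) with (Derive u t). change (Derive (fun x => v x) t) with (Derive v t).
      rewrite e1, e2. field. exact hz. }
  split.
  - evar_last; [apply (aux _ _ _ _ h1 h2 hn) |].
    destruct (f t) as [x y], df as [dx dy]; simpl in *. field.
    repeat split; intros k; apply hn;
      first [lra | assert (q : (x * x + y * y) * (x * x + y * y) = 0) by (rewrite <- k; ring);
                   destruct (Rmult_integral _ _ q); lra].
  - apply (is_derive_ext (fun s => - (snd (f s) / (snd (f s) ^ 2 + fst (f s) ^ 2)))).
    { intros s; simpl. rewrite (Rplus_comm (fst (f s) * _)). unfold Rdiv. ring. }
    evar_last; [apply (is_derive_opp (fun s => snd (f s) / (snd (f s) ^ 2 + fst (f s) ^ 2))); apply (aux _ _ _ _ h2 h1); lra |].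
    cbv [opp]; simpl. destruct (f t) as [x y], df as [dx dy]; simpl in *. field.
    repeat split; intros k; apply hn;
      first [lra | assert (q : (x * x + y * y) * (x * x + y * y) = 0) by (rewrite <- k; ring);
                   destruct (Rmult_integral _ _ q); lra].
Qed.

Lemma is_derive_cis_scal (k t : R) : is_derive (fun t => cis (k * t)) t (RtoC k * Ci * cis (k * t))%C.
Proof.
  apply is_derive_C_iff; split; simpl; auto_derive; trivial; ring.
Qed.

Lemma is_derive_cis (t : R) : is_derive cis t (Ci * cis t)%C.
Proof.
  apply is_derive_C_iff; split; simpl; auto_derive; trivial; ring.
Qed.

Ltac derive_C := repeat match goal with
  | |- is_derive (fun _ => ?k) _ _ => apply (is_derive_C_const k)
  | |- is_derive (fun t => Cplus (@?f t) (@?g t)) _ _ => apply (is_derive_C_plus f g)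
  | |- is_derive (fun t => Cminus (@?f t) (@?g t)) _ _ => apply (is_derive_C_minus f g)
  | |- is_derive (fun t => Cmult (@?f t) (@?g t)) _ _ => apply (is_derive_C_mult f g)
  | |- is_derive (fun t => cis (?k * t)) _ _ => apply (is_derive_cis_scal k)
  | |- is_derive (fun t => cis t) _ _ => apply is_derive_cis
  | |- _ => eassumption
  end.

Lemma is_derive_C_continuous (g : R -> C) t (d : C) : is_derive g t d -> continuous g t.
Proof. intros h. apply (ex_derive_continuous g). exists d; exact h. Qed.

Lemma continuous_Re (g : R -> C) t : continuous g t -> continuous (fun t => Re (g t)) t.
Proof.
  intros h. apply (continuous_comp g (fst : C -> R)); [exact h |]. destruct (g t); apply continuous_fst.
Qed.

(** * Horizontal curves of the square of a logarithmic derivative *)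

Lemma in_int_between a b t1 t2 t :
  Defs.in_int a b t1 -> Defs.in_int a b t2 -> t1 <= t <= t2 -> Defs.in_int a b t.
Proof.
  intros [h1 h2] [k1 k2] [q1 q2]. split.
  - apply Rbar_lt_le_trans with t1; assumption.
  - apply Rbar_le_lt_trans with t2; assumption.
Qed.

Lemma in_int_all (t : R) : Defs.in_int m_infty p_infty t.
Proof. split; exact I. Qed.

Lemma int_constant (u : R -> R) a b :
  (forall t, Defs.in_int a b t -> is_derive u t 0) ->
  forall t1 t2, Defs.in_int a b t1 -> Defs.in_int a b t2 -> u t1 = u t2.
Proof.
  intros h.
  assert (aux : forall t1 t2, t1 <= t2 -> Defs.in_int a b t1 -> Defs.in_int a b t2 -> u t1 = u t2).
  { intros t1 t2 hle i1 i2.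
    destruct (MVT_gen u t1 t2 (fun _ => 0)) as [x [_ hx]].
    - intros x hx. rewrite Rmin_left, Rmax_right in hx by lra.
      apply h, (in_int_between a b t1 t2); auto; lra.
    - intros x hx. rewrite Rmin_left, Rmax_right in hx by lra.
      apply continuity_pt_filterlim, (ex_derive_continuous u). exists 0.
      apply h, (in_int_between a b t1 t2); auto; lra.
    - lra. }
  intros t1 t2 i1 i2. destruct (Rle_dec t1 t2); [| symmetry]; apply aux; auto; lra.
Qed.

Lemma IVT_zero (u : R -> R) x y :
  (forall t, Rmin x y <= t <= Rmax x y -> continuous u t) -> u x < 0 -> 0 < u y ->
  exists t, Rmin x y <= t <= Rmax x y /\ u t = 0.
Proof.
  intros hc h1 h2. destruct (Rtotal_order x y) as [h | [h | h]].
  - rewrite Rmin_left, Rmax_right in * by lra.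
    destruct (IVT_interv u x y) as [z [hz e]]; auto.
    + intros t ht. apply continuity_pt_filterlim, hc, ht.
    + exists z; auto.
  - subst; lra.
  - rewrite Rmin_right, Rmax_left in * by lra.
    destruct (IVT_interv (fun t => - u t) y x) as [z [hz e]]; try lra.
    + intros t ht. apply continuity_pt_filterlim. apply (continuous_opp u), hc, ht.
    + exists z; split; auto; lra.
Qed.

Lemma int_sign (u : R -> R) a b :
  (forall t, Defs.in_int a b t -> continuous u t /\ u t <> 0) ->
  forall t1 t2, Defs.in_int a b t1 -> Defs.in_int a b t2 -> 0 < u t1 -> 0 < u t2.
Proof.
  intros h t1 t2 i1 i2 h1.
  assert (hb : forall t, Rmin t2 t1 <= t <= Rmax t2 t1 -> Defs.in_int a b t).
  { intros t. destruct (Rle_dec t1 t2).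
    - rewrite Rmin_right, Rmax_left by lra. intros; apply (in_int_between a b t1 t2); auto; lra.
    - rewrite Rmin_left, Rmax_right by lra. intros; apply (in_int_between a b t2 t1); auto; lra. }
  destruct (Rtotal_order (u t2) 0) as [k | [k | k]]; auto.
  - destruct (IVT_zero u t2 t1) as [t [ht e]]; auto.
    + intros t ht. apply h, hb, ht.
    + exfalso. apply (proj2 (h t (hb t ht))), e.
  - exfalso. apply (proj2 (h t2 i2)), k.
Qed.

Definition Frat (p b c z : C) : C := ((z - b) * (z - c) / (z - p))%C.

(** This is [F' / F] for [F = Frat p b c], over a common denominator. Its numerator vanishes at the
    critical points of [F], which are the double zeros of [q]. *)
Definition dlogF (p b c z : C) : C :=
  (((z - p) * (z - p) - (b - p) * (c - p)) / ((z - p) * (z - b) * (z - c)))%C.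

(* [f dz^2 = -(d log F)^2 / (4 PI^2)]; at the marked points [f] takes junk values, on which nothing is assumed *)
Definition log_square (f : C -> C) (ps : list C) (p b c : C) : Prop :=
  (forall z, In z ps <-> z = p \/ z = b \/ z = c) /\
  (p <> b /\ p <> c /\ b <> c) /\
  forall z, ~ In z ps -> f z = (RtoC (- / (4 * PI ^ 2)) * (dlogF p b c z * dlogF p b c z))%C.

Lemma Frat_zero p b c z : z <> p -> Frat p b c z = RtoC 0 -> z = b \/ z = c.
Proof.
  intros hp h. destruct (Cmult_integral (z - b) (z - c)) as [k | k].
  - replace ((z - b) * (z - c))%C with (Frat p b c z * (z - p))%C.
    + rewrite h; ring.
    + unfold Frat. field. apply Cminus_neq_zero, hp.
  - left; apply Cminus_eq_zero, k.
  - right; apply Cminus_eq_zero, k.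
Qed.

Lemma is_derive_Frat p b c (g : R -> C) t (d : C) :
  g t <> p -> g t <> b -> g t <> c -> is_derive g t d ->
  is_derive (fun t => Frat p b c (g t)) t (Frat p b c (g t) * (dlogF p b c (g t) * d))%C.
Proof.
  intros np nb nc h. apply Cminus_neq_zero in np, nb, nc.
  unfold Frat, Cdiv.
  assert (hs : forall w : C, is_derive (fun t => g t - w)%C t d).
  { intros w. evar_last; [apply is_derive_C_minus; [exact h | apply is_derive_C_const] |]. ring. }
  evar_last.
  - apply is_derive_C_mult; [apply is_derive_C_mult; apply hs |].
    apply is_derive_C_inv; [apply hs | exact np].
  - unfold dlogF. simpl. field. auto.
Qed.

Lemma is_derive_Cmod_sqr (g : R -> C) t (d : C) :
  is_derive g t d -> is_derive (fun t => Cmod (g t) ^ 2) t (2 * Re (Cconj (g t) * d)%C).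
Proof.
  intros h. apply is_derive_C_iff in h; destruct h as [h1 h2]. cbv [Re Im] in *.
  apply (is_derive_ext (fun t => fst (g t) * fst (g t) + snd (g t) * snd (g t))).
  { intros s. rewrite Cmod_sqr. unfold Re, Im. simpl. ring. }
  evar_last.
  - apply (is_derive_plus (fun t => fst (g t) * fst (g t)) (fun t => snd (g t) * snd (g t))).
    + apply (is_derive_mult _ _ _ _ _ h1 h1); intros; apply Rmult_comm.
    + apply (is_derive_mult _ _ _ _ _ h2 h2); intros; apply Rmult_comm.
  - cbv [plus mult]; simpl. cbv [mult]; simpl. ring.
Qed.

Lemma PI2_pos : 0 < 4 * PI ^ 2.
Proof. pose proof PI_RGT_0. nra. Qed.

(** With [L] the logarithmic derivative of [F] and [d] the velocity, [f d^2 = -(L d)^2 / (4 PI^2)]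
    is positive, so [L d] is purely imaginary; and the derivative of [|F|^2] is
    [2 |F|^2 Re (L d)]. *)
Lemma horiz_Cmod_constant f ps p b c g a e :
  log_square f ps p b c -> horiz f ps g a e ->
  forall t1 t2, Defs.in_int a e t1 -> Defs.in_int a e t2 ->
  Cmod (Frat p b c (g t1)) = Cmod (Frat p b c (g t2)).
Proof.
  intros [hps [hd hf]] [_ hg] t1 t2 i1 i2.
  assert (h : Cmod (Frat p b c (g t1)) ^ 2 = Cmod (Frat p b c (g t2)) ^ 2).
  { apply (int_constant (fun t => Cmod (Frat p b c (g t)) ^ 2) a e); auto. clear t1 t2 i1 i2.
    intros t it. destruct (hg t it) as [np [d [hd1 [him hre]]]].
    rewrite (hf _ np) in him, hre.
    assert (g t <> p /\ g t <> b /\ g t <> c) as [n1 [n2 n3]].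
    { repeat split; intros k; apply np, hps; auto. }
    evar_last; [apply is_derive_Cmod_sqr, is_derive_Frat; eauto |].
    set (L := dlogF p b c (g t)) in *. set (w := Frat p b c (g t)).
    assert (hL : Re (L * d) = 0).
    { replace (RtoC (- / (4 * PI ^ 2)) * (L * L) * d * d)%C
        with (RtoC (- / (4 * PI ^ 2)) * ((L * d) * (L * d)))%C in * by ring.
      destruct (L * d)%C as [x y]. pose proof (Rinv_0_lt_compat _ PI2_pos) as hk.
      set (k := / (4 * PI ^ 2)) in *. simpl in *.
      assert (x * y = 0) by nra. destruct (Rmult_integral x y); auto. subst y. nra. }
    replace (Cconj w * (w * (L * d)))%C with ((Cconj w * w) * (L * d))%C by ring.
    destruct (L * d)%C as [x y], w as [w1 w2]. simpl in *. rewrite hL. ring. }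
  pose proof (Cmod_ge_0 (Frat p b c (g t1))). pose proof (Cmod_ge_0 (Frat p b c (g t2))). nra.
Qed.

(* Differentiating [F (g t) = kap cis (om t)] logarithmically gives [(F'/F) g' = i om], hence [f g'^2 = om^2 / (4 PI^2)]. *)
Lemma level_param_speed f ps p b c (g : R -> C) (t kap om : R) (d : C) :
  log_square f ps p b c -> kap <> 0 -> g t <> p ->
  is_derive g t d -> (locally t (fun s => Frat p b c (g s) = (RtoC kap * cis (om * s))%C)) ->
  ~ In (g t) ps /\ (f (g t) * d * d)%C = RtoC (om ^ 2 / (4 * PI ^ 2)).
Proof.
  intros [hps [hd hf]] hk np hg hl.
  assert (hF : Frat p b c (g t) = (RtoC kap * cis (om * t))%C).
  { apply (locally_singleton _ _ hl). }
  assert (hF0 : Frat p b c (g t) <> RtoC 0).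
  { rewrite hF. intros k. destruct (Cmult_integral _ _ k) as [q | q].
    - apply hk. injection q; auto.
    - apply (cis_neq_0 _ q). }
  assert (hbc : g t <> b /\ g t <> c).
  { split; intros k; apply hF0; unfold Frat; rewrite k; unfold Cdiv; ring. }
  destruct hbc as [nb nc].
  assert (nps : ~ In (g t) ps) by (rewrite hps; tauto).
  split; [exact nps |]. rewrite (hf _ nps).
  pose proof (is_derive_Frat p b c g t d np nb nc hg) as h1.
  assert (h2 : is_derive (fun s => Frat p b c (g s)) t (RtoC kap * (RtoC om * Ci * cis (om * t)))%C).
  { apply (is_derive_ext_loc (fun s => RtoC kap * cis (om * s))%C).
    - apply (filter_imp _ _) with (2 := hl). intros s e. symmetry; exact e.
    - evar_last; [apply is_derive_C_mult; [apply is_derive_C_const | apply is_derive_cis_scal] |]. simpl. ring. }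
  assert (e : (Frat p b c (g t) * (dlogF p b c (g t) * d))%C = (RtoC kap * (RtoC om * Ci * cis (om * t)))%C).
  { apply is_derive_C_iff in h1, h2. destruct h1 as [a1 a2], h2 as [b1 b2].
    apply C_ext; [rewrite <- (is_derive_unique _ _ _ a1); apply (is_derive_unique _ _ _ b1)
                 | rewrite <- (is_derive_unique _ _ _ a2); apply (is_derive_unique _ _ _ b2)]. }
  assert (e2 : (dlogF p b c (g t) * d)%C = (RtoC om * Ci)%C).
  { apply Cminus_eq_zero. destruct (Cmult_integral (Frat p b c (g t)) (dlogF p b c (g t) * d - RtoC om * Ci)) as [k | k]; auto.
    - rewrite hF in e |- *. rewrite <- (Cplus_opp_r (RtoC kap * (RtoC om * Ci * cis (om * t)))%C).
      rewrite <- e at 1. ring.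
    - contradiction. }
  transitivity (RtoC (- / (4 * PI ^ 2)) * ((dlogF p b c (g t) * d) * (dlogF p b c (g t) * d)))%C; [ring |].
  rewrite e2. apply C_ext; simpl; unfold Rdiv; ring.
Qed.

Lemma level_param_horiz f ps p b c (g : R -> C) (a e : Rbar) (kap om : R) :
  log_square f ps p b c -> kap <> 0 -> om <> 0 -> Rbar_lt a e ->
  (forall t, Defs.in_int a e t -> g t <> p /\ ex_derive g t /\ Frat p b c (g t) = (RtoC kap * cis (om * t))%C) ->
  horiz f ps g a e.
Proof.
  intros hq hk ho hae h. split; [exact hae |]. intros t it.
  destruct (h t it) as [np [[d hd] hF]].
  destruct (level_param_speed f ps p b c g t kap om d hq hk np hd) as [n1 n2].
  - destruct it as [i1 i2]. apply (locally_interval _ t a e i1 i2).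
    intros s j1 j2. apply (h s). split; assumption.
  - split; [exact n1 |]. exists d. split; [exact hd |]. rewrite n2. simpl. split; [reflexivity |].
    apply Rdiv_lt_0_compat; [nra | apply PI2_pos].
Qed.

Lemma level_param_unit f ps p b c (g : R -> C) (a e : Rbar) (kap om : R) :
  log_square f ps p b c -> kap <> 0 -> om ^ 2 = 4 * PI ^ 2 -> Rbar_lt a e ->
  (forall t, Defs.in_int a e t -> g t <> p /\ ex_derive g t /\ Frat p b c (g t) = (RtoC kap * cis (om * t))%C) ->
  unit_horiz f ps g a e.
Proof.
  intros hq hk ho hae h. split.
  - apply (level_param_horiz f ps p b c g a e kap om); auto. intros k; pose proof PI2_pos; subst om; nra.
  - intros t it. destruct (h t it) as [np [[d hd] hF]].
    destruct (level_param_speed f ps p b c g t kap om d hq hk np hd) as [n1 n2].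
    + destruct it as [i1 i2]. apply (locally_interval _ t a e i1 i2).
      intros s j1 j2. apply (h s). split; assumption.
    + exists d. split; [exact hd |].
      replace (Cmod (f (g t)) * Cmod d ^ 2) with (Cmod (f (g t) * d * d)%C) by (rewrite !Cmod_mult; ring).
      rewrite n2, ho. pose proof PI2_pos. unfold Rdiv. rewrite Rinv_r by lra.
      rewrite Cmod_R. apply Rabs_R1.
Qed.

(** * Double zeros with unequal critical values *)

Lemma ex_derive_C (g : R -> C) (t : R) :
  ex_derive (fun t => Re (g t)) t -> ex_derive (fun t => Im (g t)) t -> ex_derive g t.
Proof.
  intros [a ha] [b hb]. exists ((a, b) : C). apply is_derive_C_iff. split; assumption.
Qed.

Lemma is_derive_RtoC (u : R -> R) (t du : R) :
  is_derive u t du -> is_derive (fun t => RtoC (u t)) t (RtoC du).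
Proof.
  intros h. apply is_derive_C_iff. split; simpl; [exact h |].
  evar_last; [apply is_derive_const | reflexivity].
Qed.

(** The principal square root on the right half-plane, by the half-angle formulas; in this closed
    form its smoothness is real calculus. *)
Definition psqrt (z : C) : C :=
  let m := sqrt ((sqrt (Re z ^ 2 + Im z ^ 2) + Re z) / 2) in (m, Im z / (2 * m)).

Lemma psqrt_sqr (z : C) : 0 < Re z -> (psqrt z * psqrt z)%C = z.
Proof.
  intros h. destruct z as [x y]. unfold psqrt. cbv [Re Im fst snd] in *.
  assert (h1 : 0 <= x ^ 2 + y ^ 2) by nra.
  pose proof (sqrt_sqrt _ h1) as q1. pose proof (sqrt_pos (x ^ 2 + y ^ 2)) as q0.
  set (n := sqrt (x ^ 2 + y ^ 2)) in *.
  assert (h2 : 0 < (n + x) / 2) by lra.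
  pose proof (sqrt_sqrt _ (Rlt_le _ _ h2)) as q2. pose proof (sqrt_lt_R0 _ h2) as q3.
  set (m := sqrt ((n + x) / 2)) in *.
  apply C_ext; simpl.
  - assert (e : (y / (2 * m)) * (y / (2 * m)) = (n - x) / 2).
    { apply Rmult_eq_reg_r with (4 * (m * m)); [| nra].
      transitivity (y * y); [field; lra |]. rewrite q2. nra. }
    rewrite e, q2. field.
  - field. lra.
Qed.

Lemma ex_derive_psqrt (u : R -> C) (t : R) :
  ex_derive u t -> 0 < Re (u t) -> ex_derive (fun t => psqrt (u t)) t.
Proof.
  intros [d hd] h0. apply is_derive_C_iff in hd. destruct hd as [h1 h2].
  assert (aux : forall x y : R -> R, ex_derive x t -> ex_derive y t -> 0 < x t ->
    ex_derive (fun t => sqrt ((sqrt (x t ^ 2 + y t ^ 2) + x t) / 2)) t /\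
    ex_derive (fun t => y t / (2 * sqrt ((sqrt (x t ^ 2 + y t ^ 2) + x t) / 2))) t).
  { intros x y hx hy h. pose proof (sqrt_pos (x t ^ 2 + y t ^ 2)) as q0.
    assert (hm : 0 < (sqrt (x t ^ 2 + y t ^ 2) + x t) / 2) by lra.
    pose proof (sqrt_lt_R0 _ hm) as hm'.
    split; auto_derive; repeat split; trivial; try nra; try exact hm.
    intros k. apply (Rgt_not_eq _ _ (Rmult_lt_0_compat 2 _ Rlt_0_2 hm')). exact k. }
  destruct (aux (fun t => Re (u t)) (fun t => Im (u t))) as [k1 k2].
  - eexists; exact h1.
  - eexists; exact h2.
  - exact h0.
  - apply ex_derive_C; [exact k1 | exact k2].
Qed.

(** The factor acquired by a continuous square root of [r cis th - v] when [th] grows by [2 PI]: for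
    [|v|] different from [r] the path winds around [0] exactly when [v] is inside the circle. *)
Definition monodromy (v : C) (r : R) : R := if Rlt_dec (Cmod v) r then -1 else 1.

Lemma re_pos_of_Cmod_lt (z : C) : Cmod z < 1 -> 0 < Re (1 - z)%C.
Proof.
  intros h. pose proof (re_le_Cmod z) as k. pose proof (Rle_abs (Re z)) as k2. simpl.
  unfold Re in *. lra.
Qed.

(** The dominant term is factored out: [r cis th] if [v] is inside, [- v] if it is outside. The
    other factor is [1 - x] with [|x| < 1], which stays in the right half-plane, so its [psqrt] is
    smooth and [2 PI]-periodic. The sign comes from the root [cis (th / 2)] of [cis th]. *)
Lemma circle_sqrt (v : C) (r : R) : 0 < r -> Cmod v <> r ->
  exists s : R -> C, forall th : R, ex_derive s th /\ (s th * s th)%C = (RtoC r * cis th - v)%C /\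
    s (th + 2 * PI) = (RtoC (monodromy v r) * s th)%C.
Proof.
  intros hr hv. unfold monodromy. destruct (Rlt_dec (Cmod v) r) as [h | h].
  - assert (hb : forall th, 0 < Re (1 - v * RtoC (/ r) * cis (- 1 * th))%C).
    { intros th. apply re_pos_of_Cmod_lt. rewrite !Cmod_mult, Cmod_cis, Cmod_R, Rabs_pos_eq.
      - apply Rmult_lt_reg_r with r; [exact hr |]. field_simplify; lra.
      - apply Rlt_le, Rinv_0_lt_compat, hr. }
    exists (fun th : R => RtoC (sqrt r) * cis (/ 2 * th) * psqrt (1 - v * RtoC (/ r) * cis (- 1 * th)))%C.
    intros th. split; [| split].
    + assert (e1 : ex_derive (fun th => psqrt (1 - v * RtoC (/ r) * cis (- 1 * th))) th).
      { apply (ex_derive_psqrt (fun th => (1 - v * RtoC (/ r) * cis (- 1 * th))%C)); [| apply hb].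
        eexists. derive_C. }
      destruct e1 as [d hd]. eexists. derive_C.
    + set (q := psqrt _). set (k := RtoC (sqrt r)).
      replace (k * cis (/ 2 * th) * q * (k * cis (/ 2 * th) * q))%C
        with ((k * k) * (cis (/ 2 * th) * cis (/ 2 * th)) * (q * q))%C by ring.
      unfold q. rewrite psqrt_sqr by apply hb. unfold k.
      rewrite <- RtoC_mult, sqrt_sqrt by lra. rewrite <- cis_plus.
      replace (/ 2 * th + / 2 * th) with th by field.
      replace (RtoC r * cis th * (1 - v * RtoC (/ r) * cis (- 1 * th)))%C
        with (RtoC r * cis th - v * (RtoC r * RtoC (/ r)) * (cis th * cis (- 1 * th)))%C by ring.
      rewrite <- RtoC_mult, Rinv_r by lra. rewrite <- cis_plus.
      replace (th + - 1 * th) with 0 by ring. unfold cis at 2. rewrite cos_0, sin_0.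
      change ((1, 0) : C) with (RtoC 1). ring.
    + replace (/ 2 * (th + 2 * PI)) with (/ 2 * th + PI) by field. rewrite cis_PI.
      rewrite <- (cis_2PI (- 1 * (th + 2 * PI))).
      replace (- 1 * (th + 2 * PI) + 2 * PI) with (- 1 * th) by ring. ring.
  - assert (h' : r < Cmod v) by lra.
    assert (v0 : v <> RtoC 0) by (intros ->; rewrite Cmod_0 in h'; lra).
    destruct (Csqrt_ex (- v)) as [k hk].
    assert (hb : forall th, 0 < Re (1 - RtoC r / v * cis (1 * th))%C).
    { intros th. apply re_pos_of_Cmod_lt.
      rewrite Cmod_mult, Cmod_cis, Cmod_div, Cmod_R, Rabs_pos_eq by (auto; lra).
      apply Rmult_lt_reg_r with (Cmod v); [lra |]. field_simplify; lra. }
    exists (fun th : R => k * psqrt (1 - RtoC r / v * cis (1 * th)))%C.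
    intros th. split; [| split].
    + assert (e1 : ex_derive (fun th => psqrt (1 - RtoC r / v * cis (1 * th))) th).
      { apply (ex_derive_psqrt (fun th => (1 - RtoC r / v * cis (1 * th))%C)); [| apply hb].
        eexists. derive_C. }
      destruct e1 as [d hd]. eexists. derive_C.
    + set (q := psqrt _).
      replace (k * q * (k * q))%C with ((k * k) * (q * q))%C by ring.
      unfold q. rewrite psqrt_sqr by apply hb. rewrite hk, Rmult_1_l. field. exact v0.
    + replace (1 * (th + 2 * PI)) with (1 * th + 2 * PI) by ring. rewrite cis_2PI. ring.
Qed.

(** For [Z = z - p] the equation [F z = w] reads [Z^2 - (w + (b - p) + (c - p)) Z + (b - p) (c - p)
    = 0], of discriminant [s^2]; the constant term is nonzero, so no root is [p]. *)
Lemma Frat_root (p b c w s : C) : p <> b -> p <> c ->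
  (s * s)%C = ((w + (b - p) + (c - p)) * (w + (b - p) + (c - p)) - 4 * ((b - p) * (c - p)))%C ->
  let z := (p + (w + (b - p) + (c - p) + s) / 2)%C in z <> p /\ Frat p b c z = w.
Proof.
  intros hb hc hs z.
  assert (hq : ((z - p) * (z - p) - (w + (b - p) + (c - p)) * (z - p) + (b - p) * (c - p))%C = RtoC 0).
  { unfold z. transitivity ((s * s - ((w + (b - p) + (c - p)) * (w + (b - p) + (c - p)) - 4 * ((b - p) * (c - p)))) / 4)%C.
    - field.
    - rewrite hs. field. }
  assert (hz : z <> p).
  { intros k. rewrite k in hq.
    destruct (Cmult_integral (b - p) (c - p)) as [q | q].
    - rewrite <- hq. ring.
    - apply hb. symmetry. apply Cminus_eq_zero, q.
    - apply hc. symmetry. apply Cminus_eq_zero, q. }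
  split; [exact hz |].
  apply Cminus_eq_zero. unfold Frat.
  transitivity (((z - p) * (z - p) - (w + (b - p) + (c - p)) * (z - p) + (b - p) * (c - p)) / (z - p))%C.
  - field. apply Cminus_neq_zero, hz.
  - rewrite hq. field. apply Cminus_neq_zero, hz.
Qed.

Lemma ex_derive_root (p b c : C) (r : R) (s : R -> C) (th : R) : ex_derive s th ->
  ex_derive (fun th : R => p + (RtoC r * cis th + (b - p) + (c - p) + s th) / 2)%C th.
Proof. intros [d hd]. eexists. unfold Cdiv. derive_C. Qed.

Lemma Frat_root_inv (p b c w s z : C) : z <> p -> Frat p b c z = w ->
  (s * s)%C = ((w + (b - p) + (c - p)) * (w + (b - p) + (c - p)) - 4 * ((b - p) * (c - p)))%C ->
  z = (p + (w + (b - p) + (c - p) + s) / 2)%C \/ z = (p + (w + (b - p) + (c - p) - s) / 2)%C.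
Proof.
  intros hz hw hs.
  assert (h2 : RtoC 2 <> RtoC 0) by (intros k; injection k; lra).
  assert (e : ((2 * (z - p) - (w + (b - p) + (c - p))) * (2 * (z - p) - (w + (b - p) + (c - p))))%C = (s * s)%C).
  { rewrite hs, <- hw. unfold Frat. field. apply Cminus_neq_zero, hz. }
  destruct (Csqr_eq _ _ e) as [k | k]; [left | right].
  - replace z with (p + (2 * (z - p) - (w + (b - p) + (c - p)) + (w + (b - p) + (c - p))) / 2)%C by field.
    rewrite k. field.
  - replace z with (p + (2 * (z - p) - (w + (b - p) + (c - p)) + (w + (b - p) + (c - p))) / 2)%C by field.
    rewrite k. field.
Qed.

(* The hypotheses on [v1] and [v2] say that they are the critical values of [Frat]: the right-hand side is [(w - v1) (w - v2)], [w = r cis th]. *)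
Lemma discriminant_path (p b c v1 v2 : C) (r : R) :
  (v1 + v2)%C = (- 2 * ((b - p) + (c - p)))%C ->
  (v1 * v2)%C = (((b - p) + (c - p)) * ((b - p) + (c - p)) - 4 * ((b - p) * (c - p)))%C ->
  0 < r -> Cmod v1 <> r -> Cmod v2 <> r ->
  exists s : R -> C, forall th : R, ex_derive s th /\
    (s th * s th)%C = ((RtoC r * cis th + (b - p) + (c - p)) * (RtoC r * cis th + (b - p) + (c - p))
                       - 4 * ((b - p) * (c - p)))%C /\
    s (th + 2 * PI) = (RtoC (monodromy v1 r * monodromy v2 r) * s th)%C.
Proof.
  intros hs hp hr h1 h2.
  destruct (circle_sqrt v1 r hr h1) as [s1 q1]. destruct (circle_sqrt v2 r hr h2) as [s2 q2].
  exists (fun th : R => s1 th * s2 th)%C. intros th.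
  destruct (q1 th) as [[d1 a1] [a2 a3]]. destruct (q2 th) as [[d2 b1] [b2 b3]].
  split; [| split].
  - eexists. apply is_derive_C_mult; eassumption.
  - replace (s1 th * s2 th * (s1 th * s2 th))%C with ((s1 th * s1 th) * (s2 th * s2 th))%C by ring.
    rewrite a2, b2.
    replace ((RtoC r * cis th - v1) * (RtoC r * cis th - v2))%C
      with (RtoC r * cis th * (RtoC r * cis th) - (v1 + v2) * (RtoC r * cis th) + v1 * v2)%C by ring.
    rewrite hs, hp. ring.
  - rewrite a3, b3, RtoC_mult. ring.
Qed.

(** With [om = 1] the equation [F = r cis th] already makes the curve horizontal. The last
    hypothesis is maximality, which is proved each time from a description of the image. *)
Lemma closed_traj_of_level_param f ps p b c (g : R -> C) (r T : R) :
  log_square f ps p b c -> 0 < r -> 0 < T ->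
  (forall th : R, g th <> p /\ ex_derive g th /\ Frat p b c (g th) = (RtoC r * cis th)%C /\ g (th + T) = g th) ->
  (forall h a e, horiz f ps h a e -> (exists t, Defs.in_int a e t /\ img g m_infty p_infty (h t)) ->
     forall t, Defs.in_int a e t -> img g m_infty p_infty (h t)) ->
  closed_traj f ps (img g m_infty p_infty).
Proof.
  intros hq hr hT hg hmax.
  assert (hh : horiz f ps g m_infty p_infty).
  { apply (level_param_horiz f ps p b c g _ _ r 1); auto; try lra; [exact I |].
    intros t _. destruct (hg t) as [h1 [h2 [h3 h4]]]. rewrite Rmult_1_l. auto. }
  split; [split |].
  - exists g, m_infty, p_infty. split; [exact hh | intros z; tauto].
  - exact hmax.
  - exists g, T. repeat split; auto; try apply hh; try apply hg; auto.
Qed.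

(** The critical values of [F] are [v1 = -(B - D)^2], taken at [p + B D], and [v2 = -(B + D)^2],
    taken at [p - B D]. For [|v1| < r < |v2|] the level [|F| = r] is one closed trajectory. The
    poles [p] and infinity of [F] are joined within [|F| > r], the zeros [b] and [c] within
    [|F| < r]. *)
Lemma not_strebel_of_unequal_critical_values f ps p b c (B D : C) :
  log_square f ps p b c -> (B * B)%C = (b - p)%C -> (D * D)%C = (c - p)%C ->
  Cmod (B - D) < Cmod (B + D) ->
  exists S, closed_traj f ps S /\ ~ circle_around ps S.
Proof.
  intros hq hB hD hlt. destruct hq as [hps [[npb [npc nbc]] hf]] eqn:Ehq.
  pose proof (Cmod_ge_0 (B - D)) as m0.
  set (v1 := (- ((B - D) * (B - D)))%C). set (v2 := (- ((B + D) * (B + D)))%C).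
  assert (e1 : Cmod v1 = Cmod (B - D) ^ 2) by (unfold v1; rewrite Cmod_opp, Cmod_mult; ring).
  assert (e2 : Cmod v2 = Cmod (B + D) ^ 2) by (unfold v2; rewrite Cmod_opp, Cmod_mult; ring).
  assert (h12 : Cmod v1 < Cmod v2) by (rewrite e1, e2; nra).
  assert (h10 : 0 <= Cmod v1) by apply Cmod_ge_0.
  set (r := (Cmod v1 + Cmod v2) / 2).
  assert (hr : 0 < r) by (unfold r; lra).
  assert (hr1 : Cmod v1 < r) by (unfold r; lra). assert (hr2 : r < Cmod v2) by (unfold r; lra).
  destruct (discriminant_path p b c v1 v2 r) as [s hs]; try lra.
  { unfold v1, v2. rewrite <- hB, <- hD. ring. }
  { unfold v1, v2. rewrite <- hB, <- hD. ring. }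
  assert (hmono : monodromy v1 r * monodromy v2 r = -1).
  { unfold monodromy. destruct (Rlt_dec (Cmod v1) r), (Rlt_dec (Cmod v2) r); lra. }
  set (g := fun th => (p + (RtoC r * cis th + (b - p) + (c - p) + s th) / 2)%C).
  (* Exactly one critical value is inside the circle, so after one turn [g] has passed to the other
     root of the quadratic equation; two turns exhaust the level. *)
  assert (hg2 : forall th, g (th + 2 * PI) = (p + (RtoC r * cis th + (b - p) + (c - p) - s th) / 2)%C).
  { intros th. unfold g. rewrite cis_2PI. destruct (hs th) as [_ [_ ->]]. rewrite hmono.
    unfold Cdiv. ring. }
  assert (himg : forall z, img g m_infty p_infty z <-> z <> p /\ Cmod (Frat p b c z) = r).
  { intros z. split.
    - intros [th [_ <-]]. destruct (hs th) as [_ [h _]].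
      destruct (Frat_root p b c _ _ npb npc h) as [k1 k2]. split; [exact k1 |].
      unfold g. rewrite k2, Cmod_mult, Cmod_cis, Cmod_R, Rabs_pos_eq; lra.
    - intros [h1 h2]. destruct (polar (Frat p b c z)) as [th [_ hth]]. rewrite h2 in hth.
      destruct (hs th) as [_ [h _]].
      destruct (Frat_root_inv p b c _ _ z h1 hth h) as [k | k].
      + exists th. split; [apply in_int_all | symmetry; exact k].
      + exists (th + 2 * PI). split; [apply in_int_all |]. rewrite hg2. symmetry; exact k. }
  exists (img g m_infty p_infty). split.
  - apply (closed_traj_of_level_param f ps p b c g r (2 * PI + 2 * PI)); auto.
    + pose proof PI_RGT_0; lra.
    + intros th. destruct (hs th) as [[d hd] [h h3]].
      destruct (Frat_root p b c _ _ npb npc h) as [k1 k2]. repeat split; auto.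
      * apply ex_derive_root. eexists; exact hd.
      * rewrite <- Rplus_assoc, hg2. unfold g. rewrite cis_2PI. destruct (hs th) as [_ [_ ->]]. rewrite hmono.
        unfold Cdiv. ring.
    + intros h a e hh [t1 [i1 j1]] t it. apply himg in j1. apply himg. split.
      * intros k. destruct hh as [_ hh]. destruct (hh t it) as [n _]. apply n, hps. auto.
      * rewrite <- (proj2 j1). apply (horiz_Cmod_constant f ps p b c h a e); auto.
  (* [|B + D|^2 - |B - D|^2 = 4 Re (B conj D)]; this sign is what keeps [|F|] at least [|v2|] along
     the ray. *)
  - assert (hre : 0 < Re (B * Cconj D)).
    { assert (Cmod (B - D) ^ 2 < Cmod (B + D) ^ 2) as q by nra. rewrite !Cmod_sqr in q.
      destruct B as [B1 B2], D as [D1 D2]. simpl in *. nra. }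
    assert (hBD : (B * D)%C <> RtoC 0).
    { intros k. destruct (Cmult_integral _ _ k) as [q | q].
      - apply npb. symmetry. apply Cminus_eq_zero. rewrite <- hB, q. ring.
      - apply npc. symmetry. apply Cminus_eq_zero. rewrite <- hD, q. ring. }
    (* the ray from p through the critical point p - BD stays where |F| >= |v2| *)
    assert (hinf : same_comp (img g m_infty p_infty) (Some p) None).
    (* [k |B D| = |M| + |p| + 1] brings the end of the ray beyond modulus [M]. *)
    { intros M. set (k := (Rabs M + Cmod p + 1) / Cmod (B * D)).
      assert (hm : 0 < Cmod (B * D)) by apply Cmod_gt_0, hBD.
      assert (hk : 0 < k).
      { apply Rdiv_lt_0_compat; [| exact hm]. pose proof (Rabs_pos M). pose proof (Cmod_ge_0 p). lra. }
      exists (p - RtoC k * (B * D))%C. split.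
      - assert (q : Cmod (RtoC k * (B * D)) = Rabs M + Cmod p + 1).
        { rewrite Cmod_mult, Cmod_R, Rabs_pos_eq by lra. unfold k. field. lra. }
        pose proof (Cmod_triangle (p - RtoC k * (B * D)) (- p)) as t.
        replace (p - RtoC k * (B * D) + - p)%C with (- (RtoC k * (B * D)))%C in t by ring.
        rewrite !Cmod_opp, q in t. pose proof (Rle_abs M). lra.
      - exists (fun t => p - RtoC (t * k) * (B * D))%C. split; [| split; [| split]].
        + intros t. eapply is_derive_C_continuous. derive_C.
          apply is_derive_RtoC. auto_derive; trivial.
        + rewrite Rmult_0_l. ring.
        + rewrite Rmult_1_l. reflexivity.
        + intros t [ht0 ht1] hS. apply himg in hS. destruct hS as [n1 n2].
          assert (ht : 0 < t * k).
          { destruct (Req_dec t 0) as [-> |]; [| nra]. exfalso. apply n1. rewrite Rmult_0_l. ring. }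
          set (x := t * k) in *.
          assert (hx0 : RtoC x <> RtoC 0) by (intros q; injection q; lra).
          assert (eF : Frat p b c (p - RtoC x * (B * D)) =
                       (- ((B + D) * (B + D) + RtoC (x + / x - 2) * (B * D)))%C).
          { unfold Frat. replace b with (p + B * B)%C by (rewrite hB; ring).
            replace c with (p + D * D)%C by (rewrite hD; ring).
            rewrite RtoC_minus, RtoC_plus, RtoC_inv by lra. field. split.
            - intros q; apply hx0; exact q.
            - intros q. destruct (Cmult_integral (RtoC x) (B * D)) as [q' | q']; auto.
              transitivity (- (p - RtoC x * (B * D) - p))%C; [ring |].
              rewrite q. ring. }
          rewrite eF, Cmod_opp in n2.
          assert (hm2 : 0 <= x + / x - 2).
          { replace (x + / x - 2) with ((x - 1) ^ 2 / x) by (field; lra).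
            apply Rdiv_le_0_compat; [apply pow2_ge_0 | lra]. }
          set (m := x + / x - 2) in *.
          assert (hge : Cmod v2 ^ 2 <= r ^ 2); [| nra].
          rewrite <- n2. unfold v2. rewrite Cmod_opp, !Cmod_sqr.
          clear - hre hm2. destruct B as [B1 B2], D as [D1 D2]. simpl in *.
          (* One has [|F|^2 - |v2|^2 = 2 m Re ((B + D)^2 conj (B D)) + m^2 |B D|^2], and the real
             part is [(|B|^2 + |D|^2) Re (B conj D) + 2 |B D|^2]. *)
          assert (id : 0 <= (B1 * B1 + B2 * B2 + D1 * D1 + D2 * D2) * (B1 * D1 - B2 * - D2)
                            + 2 * ((B1 * B1 + B2 * B2) * (D1 * D1 + D2 * D2))).
          { apply Rplus_le_le_0_compat; [apply Rmult_le_pos; [nra | lra] |].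
            apply Rmult_le_pos; [lra |]. apply Rmult_le_pos; nra. }
          assert (id2 : 0 <= m * ((B1 * B1 + B2 * B2 + D1 * D1 + D2 * D2) * (B1 * D1 - B2 * - D2)
                            + 2 * ((B1 * B1 + B2 * B2) * (D1 * D1 + D2 * D2)))) by (apply Rmult_le_pos; assumption).
          assert (id3 : 0 <= m ^ 2 * ((B1 * B1 + B2 * B2) * (D1 * D1 + D2 * D2))).
          { apply Rmult_le_pos; [nra |]. apply Rmult_le_pos; nra. }
          nra. }
    assert (hbc : same_comp (img g m_infty p_infty) (Some b) (Some c)).
    (* The path [p + B D num / den] is a Moebius image of the segment of [x = cos (PI t)]: it is at
       [b] for [x = 1], at the critical point [p + B D] for [x = 0] and at [c] for [x = -1]. A path
       must be continuous on the whole line, and the cosine keeps [x] in [[-1, 1]] for every [t], so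
       [den] never vanishes. *)
    { set (num := fun t => (B * (1 + RtoC (cos (PI * t))) + D * (1 - RtoC (cos (PI * t))))%C).
      set (den := fun t => (B * (1 - RtoC (cos (PI * t))) + D * (1 + RtoC (cos (PI * t))))%C).
      (* This is the product of [num] and [den]. Its modulus is at least
         [|v2| - x^2 |v1| >= (1 - x^2) |v2|], so that on the path [|F| = (1 - x^2) |v1| |v2| / |num
         den| <= |v1| < r]. *)
      assert (hnd : forall x : R, -1 <= x <= 1 ->
        ((1 - x ^ 2) * Cmod v2 <= Cmod ((B + D) * (B + D) - RtoC (x ^ 2) * ((B - D) * (B - D)))
         /\ 0 < Cmod ((B + D) * (B + D) - RtoC (x ^ 2) * ((B - D) * (B - D))))).
      { intros x hx. set (P := ((B + D) * (B + D) - RtoC (x ^ 2) * ((B - D) * (B - D)))%C).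
        pose proof (Cmod_triangle P (RtoC (x ^ 2) * ((B - D) * (B - D)))%C) as q.
        replace (P + RtoC (x ^ 2) * ((B - D) * (B - D)))%C with ((B + D) * (B + D))%C in q by (unfold P; ring).
        rewrite (Cmod_mult (RtoC (x ^ 2))), Cmod_R, Rabs_pos_eq in q by nra.
        rewrite <- (Cmod_opp ((B - D) * (B - D))), <- (Cmod_opp ((B + D) * (B + D))) in q.
        fold v1 v2 in q.
        assert (hx2 : 0 <= x ^ 2 <= 1) by nra.
        assert (x ^ 2 * Cmod v1 <= x ^ 2 * Cmod v2) by (apply Rmult_le_compat_l; lra).
        assert (x ^ 2 * Cmod v1 <= 1 * Cmod v1) by (apply Rmult_le_compat_r; lra).
        split; lra. }
      assert (hprod : forall t, (num t * den t)%C =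
         ((B + D) * (B + D) - RtoC (cos (PI * t) ^ 2) * ((B - D) * (B - D)))%C).
      { intros t. unfold num, den. set (x := cos (PI * t)). simpl. rewrite !RtoC_mult. ring. }
      assert (hne : forall t, num t <> RtoC 0 /\ den t <> RtoC 0).
      { intros t. destruct (hnd (cos (PI * t)) (COS_bound _)) as [_ q]. rewrite <- hprod in q.
        split; intros k; rewrite k in q.
        - rewrite Cmult_0_l, Cmod_0 in q; lra.
        - rewrite Cmult_0_r, Cmod_0 in q; lra. }
      exists (fun t => p + (B * D) * num t / den t)%C. split; [| split; [| split]].
      - intros t. assert (hc : is_derive (fun t => RtoC (cos (PI * t))) t (RtoC (- (PI * sin (PI * t))))).
        { apply is_derive_RtoC. auto_derive; trivial. ring. }
        eapply is_derive_C_continuous. unfold Cdiv, num.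
        derive_C. apply is_derive_C_inv; [unfold den; derive_C | apply hne].
      - pose proof (proj2 (hne 0)) as k. unfold num, den in *. rewrite Rmult_0_r, cos_0 in *.
        replace b with (p + B * B)%C by (rewrite hB; ring). field.
        intros q. apply k. rewrite q. ring.
      - pose proof (proj2 (hne 1)) as k. unfold num, den in *. rewrite Rmult_1_r, cos_PI in *.
        replace c with (p + D * D)%C by (rewrite hD; ring). field.
        intros q. apply k. rewrite q. ring.
      - intros t _ hS. apply himg in hS. destruct hS as [_ n2].
        destruct (hne t) as [q1 q2]. destruct (hnd (cos (PI * t)) (COS_bound _)) as [w1 w2].
        rewrite <- hprod in w1, w2.
        assert (eF : Frat p b c (p + (B * D) * num t / den t) =
                     (- (RtoC (1 - cos (PI * t) ^ 2) * v1 * v2 / (num t * den t)))%C).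
        { unfold Frat. replace b with (p + B * B)%C by (rewrite hB; ring).
          replace c with (p + D * D)%C by (rewrite hD; ring).
          unfold v1, v2. unfold num, den in *. rewrite RtoC_minus. simpl. rewrite !RtoC_mult.
          set (x := RtoC (cos (PI * t))) in *. field. repeat split; auto.
          - intros q. destruct (Cmult_integral (B * D) (B * (1 + x) + D * (1 - x))) as [q' | q']; auto.
            rewrite <- q. ring. }
        rewrite eF, Cmod_opp, Cmod_div, !Cmod_mult, Cmod_R in n2.
        2:{ intros q. destruct (Cmult_integral _ _ q); contradiction. }
        rewrite Rabs_pos_eq in n2 by (pose proof (COS_bound (PI * t)); nra).
        rewrite Cmod_mult in w1, w2. set (N := Cmod (num t) * Cmod (den t)) in *.
        set (a := 1 - cos (PI * t) ^ 2) in *.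
        assert (n3 : a * Cmod v1 * Cmod v2 = r * N) by (rewrite <- n2; field; lra).
        assert (a * Cmod v2 * Cmod v1 <= N * Cmod v1) by (apply Rmult_le_compat_r; assumption).
        nra. }
    (* Every marked point has a partner on its own side: [p] and infinity, [b] and [c]. Hence none
       is separated from all the others. *)
    intros [q [hin hsep]].
    assert (him : forall z, In (Some z) (marked ps) <-> z = p \/ z = b \/ z = c).
    { intros z. unfold marked. rewrite in_app_iff, in_map_iff, <- hps. split.
      - intros [[y [k1 k2]] | [k | []]]; [injection k1; intros; subst; auto | discriminate].
      - intros k. left. exists z; auto. }
    assert (hnone : In None (marked ps)) by (unfold marked; rewrite in_app_iff; simpl; auto).
    assert (hsym : forall x y, pconn (fun z => ~ img g m_infty p_infty z) x y -> pconn (fun z => ~ img g m_infty p_infty z) y x).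
    { intros x y [u [u1 [u2 [u3 u4]]]]. exists (fun t => u (1 - t)). repeat split.
      - intros t. apply (continuous_comp (fun t => 1 - t) u); [| apply u1].
        apply (ex_derive_continuous (fun t : R => 1 - t)). auto_derive; trivial.
      - rewrite Rminus_0_r. exact u3.
      - rewrite Rminus_diag. exact u2.
      - intros t ht. apply u4. lra. }
    destruct q as [z |].
    + apply him in hin. destruct hin as [-> | [-> | ->]].
      * apply (hsep None); auto; discriminate.
      * apply (hsep (Some c)); auto; [apply him; auto | congruence].
      * apply (hsep (Some b)); auto; [apply him; auto | congruence | apply hsym; exact hbc].
    + apply (hsep (Some p)); auto; [apply him; auto | discriminate].
Qed.

(** * The quartic numerator *)

(** Both structures unfold to the same operations and neighbourhoods, so only the linearity record
    is rebuilt. The second form is the one to which the product and chain rules apply. *)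
Lemma holo_at_iff (f : C -> C) (z : C) : holo_at f z <-> @ex_derive C_AbsRing (AbsRing_NormedModule C_AbsRing) f z.
Proof.
  unfold holo_at. split; intros [d [[l1 l2 l3] h2]]; exists d; (split; [constructor; [exact l1 | exact l2 | exact l3] | exact h2]).
Qed.

Lemma holo_const (k z : C) : holo_at (fun _ => k) z.
Proof. apply holo_at_iff. apply (@ex_derive_const C_AbsRing (AbsRing_NormedModule C_AbsRing)). Qed.

Lemma holo_id (z : C) : holo_at (fun z => z) z.
Proof. apply holo_at_iff. apply ex_derive_id. Qed.

Lemma holo_plus (f g : C -> C) z : holo_at f z -> holo_at g z -> holo_at (fun z => f z + g z)%C z.
Proof. rewrite !holo_at_iff. apply (ex_derive_plus (V := AbsRing_NormedModule C_AbsRing) f g). Qed.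

Lemma holo_opp (f : C -> C) z : holo_at f z -> holo_at (fun z => - f z)%C z.
Proof. rewrite !holo_at_iff. apply (ex_derive_opp (V := AbsRing_NormedModule C_AbsRing) f). Qed.

Lemma holo_mult (f g : C -> C) z : holo_at f z -> holo_at g z -> holo_at (fun z => f z * g z)%C z.
Proof.
  rewrite !holo_at_iff. intros [a ha] [b hb]. eexists.
  apply (is_derive_mult (K := C_AbsRing) f g z a b ha hb). exact Cmult_comm.
Qed.

Lemma holo_Cinv (z0 : C) : z0 <> RtoC 0 -> holo_at Cinv z0.
Proof.
  intros h0. apply holo_at_iff.
  assert (m0 : 0 < Cmod z0) by (apply Cmod_gt_0, h0).
  exists (- / (z0 * z0))%C. split; [apply is_linear_scal_l |].
  intros x hx.
  assert (e : z0 = x) by (apply (is_filter_lim_locally_unique (V := AbsRing_NormedModule C_AbsRing)), hx). subst x.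
  intros eps.
  (* The remainder is [(z - z0)^2 / (z z0^2)]. The first bound gives [|z| >= |z0| / 2], and the
     second then makes the remainder at most [eps |z - z0|]. *)
  assert (hd : 0 < Rmin (Cmod z0 / 2) (eps * Cmod z0 ^ 3 / 2)).
  { apply Rmin_glb_lt; [lra |]. destruct eps as [eps he]. simpl. apply Rmult_lt_0_compat; [| lra].
    apply Rmult_lt_0_compat; [lra |]. apply Rmult_lt_0_compat; [lra |]. nra. }
  exists (mkposreal _ hd). intros z hz.
  change (Cmod (z - z0) < Rmin (Cmod z0 / 2) (eps * Cmod z0 ^ 3 / 2)) in hz.
  change (Cmod (/ z - / z0 - (z - z0) * (- / (z0 * z0))) <= eps * Cmod (z - z0)).
  pose proof (Rmin_l (Cmod z0 / 2) (eps * Cmod z0 ^ 3 / 2)).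
  pose proof (Rmin_r (Cmod z0 / 2) (eps * Cmod z0 ^ 3 / 2)).
  assert (hz2 : Cmod z0 / 2 <= Cmod z).
  { pose proof (Cmod_triangle z (- (z - z0))) as t. replace (z + - (z - z0))%C with z0 in t by ring.
    rewrite Cmod_opp in t. lra. }
  assert (hzn : z <> RtoC 0) by (intros ->; rewrite Cmod_0 in hz2; lra).
  replace (/ z - / z0 - (z - z0) * (- / (z0 * z0)))%C with ((z - z0) * (z - z0) / (z * (z0 * z0)))%C by (field; auto).
  rewrite Cmod_div.
  2:{ intros k. destruct (Cmult_integral _ _ k) as [q | q]; auto. destruct (Cmult_integral _ _ q); auto. }
  rewrite !Cmod_mult. set (m := Cmod (z - z0)) in *. set (M := Cmod z0) in *. set (n := Cmod z) in *.
  assert (hm : 0 <= m) by apply Cmod_ge_0.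
  apply Rmult_le_reg_r with (n * (M * M)).
  { apply Rmult_lt_0_compat; nra. }
  unfold Rdiv. rewrite Rmult_assoc, Rinv_l, Rmult_1_r.
  2:{ apply Rgt_not_eq, Rmult_lt_0_compat; nra. }
  assert (q : m <= eps * (n * (M * M))).
  { apply Rle_trans with (eps * M ^ 3 / 2); [lra |].
    replace (eps * M ^ 3 / 2) with (eps * (M / 2 * (M * M))) by field.
    apply Rmult_le_compat_l; [apply Rlt_le, eps |]. apply Rmult_le_compat_r; nra. }
  replace (eps * m * (n * (M * M))) with (m * (eps * (n * (M * M)))) by ring.
  apply Rmult_le_compat_l; assumption.
Qed.

Lemma holo_inv (f : C -> C) z : holo_at f z -> f z <> RtoC 0 -> holo_at (fun z => / f z)%C z.
Proof.
  intros hf h0. pose proof (holo_Cinv _ h0) as hi. rewrite holo_at_iff in *.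
  destruct hf as [a ha], hi as [b hb]. eexists.
  apply (is_derive_comp (K := C_AbsRing) (V := AbsRing_NormedModule C_AbsRing) Cinv f z b a hb ha).
Qed.

Ltac holo := repeat match goal with
  | |- holo_at (fun z => z) _ => apply holo_id
  | |- holo_at (fun _ => ?k) _ => apply (holo_const k)
  | |- holo_at (fun z => Cplus (@?f z) (@?g z)) _ => apply (holo_plus f g)
  | |- holo_at (fun z => Cmult (@?f z) (@?g z)) _ => apply (holo_mult f g)
  | |- holo_at (fun z => Copp (@?f z)) _ => apply (holo_opp f)
  | |- holo_at (fun z => Cinv (@?f z)) _ => apply (holo_inv f)
  end.

Definition cubic (lam z : C) : C := (z * (z - 1) * (z - lam))%C.

Definition quartic (lam nu z : C) : C :=
  ((z * z - lam) * (z * z - lam) + nu * (z * (z - 1) * (z - lam)))%C.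

Lemma in_qpoles (lam z : C) : In z (qpoles lam) <-> z = RtoC 0 \/ z = RtoC 1 \/ z = lam.
Proof. unfold qpoles. simpl. intuition congruence. Qed.

Lemma cubic_neq_0 (lam z : C) : ~ In z (qpoles lam) -> cubic lam z <> RtoC 0.
Proof.
  intros h k. apply h, in_qpoles. unfold cubic in k.
  destruct (Cmult_integral _ _ k) as [q | q]; [| right; right; apply Cminus_eq_zero, q].
  destruct (Cmult_integral _ _ q) as [q' | q']; [left; exact q' | right; left; apply Cminus_eq_zero, q'].
Qed.

Lemma factors_neq_0 (lam z : C) : ~ In z (qpoles lam) ->
  z <> RtoC 0 /\ (z - 1)%C <> RtoC 0 /\ (z - lam)%C <> RtoC 0.
Proof.
  rewrite in_qpoles. intros h. repeat split; intros k; apply h; auto.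
  - right; left; apply Cminus_eq_zero, k.
  - right; right; apply Cminus_eq_zero, k.
Qed.

Lemma qf_quartic (lam mu z : C) : ~ In z (qpoles lam) ->
  qf lam mu z = (RtoC (- / (4 * PI ^ 2)) * (quartic lam (mu - 2 * (1 + lam)) z / (cubic lam z * cubic lam z)))%C.
Proof.
  intros h. unfold qf, quartic, cubic.
  destruct (factors_neq_0 lam z h) as [h1 [h2 h3]].
  apply f_equal. field. auto.
Qed.

Lemma kappa_neq_0 : RtoC (- / (4 * PI ^ 2)) <> RtoC 0.
Proof.
  intros k. injection k. intros q. pose proof (Rinv_0_lt_compat _ PI2_pos) as h. simpl in *. lra.
Qed.

(** At a marked point the [nu] term vanishes and [(z^2 - lam)^2] equals [lam^2], [(1 - lam)^2] or
    [(lam^2 - lam)^2]. So no zero of the numerator is cancelled by the denominator, and the zeros of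
    [q] are exactly those of the quartic. *)
Lemma quartic_pole_neq_0 (lam nu z : C) : lam <> RtoC 0 -> lam <> RtoC 1 -> In z (qpoles lam) -> quartic lam nu z <> RtoC 0.
Proof.
  intros h0 h1 hz k. apply in_qpoles in hz. unfold quartic in k.
  assert (hk : ((z * z - lam) * (z * z - lam))%C = RtoC 0).
  { rewrite <- k. destruct hz as [-> | [-> | ->]]; ring. }
  assert (hk2 : (z * z - lam)%C = RtoC 0) by (destruct (Cmult_integral _ _ hk); assumption).
  apply Cminus_eq_zero in hk2. destruct hz as [-> | [-> | ->]].
  - apply h0. rewrite <- hk2. ring.
  - apply h1. rewrite <- hk2. ring.
  - destruct (Cmult_integral lam (lam - 1)) as [q | q]; auto.
    + replace (lam * (lam - 1))%C with (lam * lam - lam)%C by ring. rewrite hk2. ring.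
    + apply h1, Cminus_eq_zero, q.
Qed.

Lemma is_zero_qf (lam mu z : C) : lam <> RtoC 0 -> lam <> RtoC 1 ->
  (is_zero (qf lam mu) (qpoles lam) z <-> quartic lam (mu - 2 * (1 + lam)) z = RtoC 0).
Proof.
  intros h0 h1. split.
  - intros [hz hf]. rewrite qf_quartic in hf by assumption.
    destruct (Cmult_integral _ _ hf) as [k | k]; [destruct (kappa_neq_0 k) |].
    pose proof (cubic_neq_0 lam z hz) as hc.
    transitivity (quartic lam (mu - 2 * (1 + lam)) z / (cubic lam z * cubic lam z) * (cubic lam z * cubic lam z))%C.
    + field. exact hc.
    + rewrite k. ring.
  - intros hq.
    assert (hz : ~ In z (qpoles lam)) by (intros k; exact (quartic_pole_neq_0 lam _ z h0 h1 k hq)).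
    split; [exact hz |]. rewrite qf_quartic, hq by assumption. unfold Cdiv. ring.
Qed.

Lemma not_pole_nearby (ps : list C) (z0 : C) : ~ In z0 ps ->
  exists r, 0 < r /\ forall z, Cmod (z - z0) < r -> ~ In z ps.
Proof.
  induction ps as [| a ps IH]; intros h.
  - exists 1. split; [lra | simpl; auto].
  - destruct IH as [r [hr hz]]; [simpl in h; auto |].
    assert (ha : 0 < Cmod (a - z0)).
    { apply Cmod_gt_0, Cminus_neq_zero. simpl in h. auto. }
    exists (Rmin r (Cmod (a - z0))). split; [apply Rmin_glb_lt; assumption |].
    intros z k [<- | q].
    + pose proof (Rmin_r r (Cmod (a - z0))). lra.
    + apply (hz z); auto. pose proof (Rmin_l r (Cmod (a - z0))). lra.
Qed.

Lemma zero_order_qf (lam mu z0 : C) (k : nat) (h : C -> C) :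
  lam <> RtoC 0 -> lam <> RtoC 1 -> (0 < k)%nat -> h z0 <> RtoC 0 -> (forall z, holo_at h z) ->
  (forall z, quartic lam (mu - 2 * (1 + lam)) z = (Cpown (z - z0) k * h z)%C) ->
  zero_order (qf lam mu) z0 k.
Proof.
  intros h0 h1 hk hh holo_h hq.
  assert (hz0 : is_zero (qf lam mu) (qpoles lam) z0).
  { apply is_zero_qf; auto. rewrite hq. destruct k; [lia |]. simpl. ring. }
  destruct hz0 as [np hf]. split; [exact hf |].
  destruct (not_pole_nearby _ _ np) as [r [hr hn]].
  exists r, (fun z => RtoC (- / (4 * PI ^ 2)) * (h z * / (cubic lam z * cubic lam z)))%C.
  split; [exact hr | split].
  - pose proof (cubic_neq_0 lam z0 np) as hc. intros q.
    destruct (Cmult_integral _ _ q) as [q1 | q1]; [apply (kappa_neq_0 q1) |].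
    apply hh. transitivity (h z0 * / (cubic lam z0 * cubic lam z0) * (cubic lam z0 * cubic lam z0))%C.
    + field. exact hc.
    + rewrite q1. ring.
  - intros z hz. pose proof (cubic_neq_0 lam z (hn z hz)) as hc. split.
    + unfold cubic. unfold Cminus. holo; auto.
      intros q; destruct (Cmult_integral _ _ q); auto.
    + rewrite qf_quartic by auto. rewrite hq. field. exact hc.
Qed.

Lemma quadratic_roots (s t : C) : exists a b : C, (a + b)%C = s /\ (a * b)%C = t.
Proof.
  destruct (Csqrt_ex (s * s - 4 * t)) as [d hd].
  exists ((s + d) / 2)%C, ((s - d) / 2)%C. split; [field |].
  replace ((s + d) / 2 * ((s - d) / 2))%C with ((s * s - d * d) / 4)%C by field.
  rewrite hd. field.
Qed.

Lemma double_zeros_of_square (lam mu a b : C) : lam <> RtoC 0 -> lam <> RtoC 1 -> a <> b ->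
  (forall z, quartic lam (mu - 2 * (1 + lam)) z = (((z - a) * (z - b)) * ((z - a) * (z - b)))%C) ->
  two_double_zeros (qf lam mu) (qpoles lam).
Proof.
  intros h0 h1 hab hq. exists a, b. split; [exact hab | split; [| split]].
  - intros z. rewrite is_zero_qf by assumption. rewrite hq. split.
    + intros k. assert (k' : ((z - a) * (z - b))%C = RtoC 0) by (destruct (Cmult_integral _ _ k); assumption).
      destruct (Cmult_integral _ _ k') as [q | q]; apply Cminus_eq_zero in q; auto.
    + intros [-> | ->]; ring.
  - apply zero_order_qf with (fun z => (z - b) * (z - b))%C; auto; try lia.
    + intros q; destruct (Cmult_integral _ _ q) as [k | k]; apply hab, Cminus_eq_zero, k.
    + intros z; unfold Cminus; holo.
    + intros z; rewrite hq; simpl; ring.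
  - apply zero_order_qf with (fun z => (z - a) * (z - a))%C; auto; try lia.
    + intros q; destruct (Cmult_integral _ _ q) as [k | k]; apply hab; symmetry; apply Cminus_eq_zero, k.
    + intros z; unfold Cminus; holo.
    + intros z; rewrite hq; simpl; ring.
Qed.

Lemma simple_zero_of_factor (lam mu a b c d : C) : lam <> RtoC 0 -> lam <> RtoC 1 ->
  a <> b -> a <> c -> a <> d ->
  (forall z, quartic lam (mu - 2 * (1 + lam)) z = ((z - a) * (z - b) * (z - c) * (z - d))%C) ->
  zero_order (qf lam mu) a 1.
Proof.
  intros h0 h1 ab ac ad hq. apply zero_order_qf with (fun z => (z - b) * (z - c) * (z - d))%C; auto.
  - apply Cminus_neq_zero in ab, ac, ad.
    intros q; destruct (Cmult_integral _ _ q) as [k | k]; auto. destruct (Cmult_integral _ _ k); auto.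
  - intros z; unfold Cminus; holo.
  - intros z; rewrite hq; simpl; ring.
Qed.

(* In terms of [w = z + lam / z] the quartic is [z^2 (w^2 + nu w - 4 lam - nu (1 + lam))], of discriminant [(nu + 4) (nu + 4 lam)]. *)
Lemma quartic_zeros (lam mu : C) : lam <> RtoC 0 -> lam <> RtoC 1 ->
  let nu := (mu - 2 * (1 + lam))%C in
  ((nu = RtoC 0 \/ nu = RtoC (-4) \/ nu = (-4 * lam)%C) /\ two_double_zeros (qf lam mu) (qpoles lam)) \/
  (~ (nu = RtoC 0 \/ nu = RtoC (-4) \/ nu = (-4 * lam)%C) /\ four_simple_zeros (qf lam mu) (qpoles lam)).
Proof.
  intros h0 h1 nu.
  destruct (Ceq_dec nu (RtoC 0)) as [e | n0]; [left; split; auto |].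
  (* Here the quartic is [(z^2 - lam)^2]; in the next two cases it is [(z^2 - 2 z + lam)^2] and
     [(z^2 - 2 lam z + lam)^2]. A repeated root of the inner quadratic would force [lam] to be [0]
     or [1]. *)
  { destruct (quadratic_roots (RtoC 0) (- lam)) as [a [b [hs hp]]].
    apply (double_zeros_of_square lam mu a b); auto.
    - intros <-. apply h0. replace a with (RtoC 0) in hp.
      + replace lam with (- - lam)%C by ring. rewrite <- hp. ring.
      + replace a with ((a + a) / 2)%C by field. rewrite hs. field.
    - intros z. fold nu. unfold quartic. rewrite e.
      replace ((z - a) * (z - b))%C with (z * z - (a + b) * z + a * b)%C by ring. rewrite hs, hp. ring. }
  destruct (Ceq_dec nu (RtoC (-4))) as [e | n4]; [left; split; auto |].
  { destruct (quadratic_roots (RtoC 2) lam) as [a [b [hs hp]]].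
    apply (double_zeros_of_square lam mu a b); auto.
    - intros <-. apply h1. replace a with (RtoC 1) in hp.
      + rewrite <- hp. ring.
      + replace a with ((a + a) / 2)%C by field. rewrite hs. field.
    - intros z. fold nu. unfold quartic. rewrite e.
      replace ((z - a) * (z - b))%C with (z * z - (a + b) * z + a * b)%C by ring. rewrite hs, hp. ring. }
  destruct (Ceq_dec nu (-4 * lam)%C) as [e | n5]; [left; split; auto |].
  { destruct (quadratic_roots (2 * lam)%C lam) as [a [b [hs hp]]].
    apply (double_zeros_of_square lam mu a b); auto.
    - intros <-. replace a with lam in hp.
      + destruct (Cmult_integral lam (lam - 1)) as [q | q]; auto.
        * replace (lam * (lam - 1))%C with (lam * lam - lam)%C by ring. rewrite hp. ring.
        * apply h1, Cminus_eq_zero, q.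
      + replace a with ((a + a) / 2)%C by field. rewrite hs. field.
    - intros z. fold nu. unfold quartic. rewrite e.
      replace ((z - a) * (z - b))%C with (z * z - (a + b) * z + a * b)%C by ring. rewrite hs, hp. ring. }
  right. split; [tauto |].
  (* [w1] and [w2] are the two values of [z + lam / z]; each contributes the two roots of
     [z^2 - w z + lam]. *)
  destruct (quadratic_roots (- nu) (- 4 * lam - nu * (1 + lam))) as [w1 [w2 [hs hp]]].
  destruct (quadratic_roots w1 lam) as [a1 [b1 [s1 p1]]].
  destruct (quadratic_roots w2 lam) as [a2 [b2 [s2 p2]]].
  assert (hq : forall z, quartic lam nu z = ((z - a1) * (z - b1) * (z - a2) * (z - b2))%C).
  { intros z. replace ((z - a1) * (z - b1) * (z - a2) * (z - b2))%C
      with ((z * z - (a1 + b1) * z + a1 * b1) * (z * z - (a2 + b2) * z + a2 * b2))%C by ring.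
    rewrite s1, p1, s2, p2.
    replace ((z * z - w1 * z + lam) * (z * z - w2 * z + lam))%C with
      ((z * z + lam) * (z * z + lam) - (w1 + w2) * z * (z * z + lam) + w1 * w2 * (z * z))%C by ring.
    rewrite hs, hp. unfold quartic. ring. }
  (* A repeated root [a] has [a^2 = lam] and [w = 2 a]; inserted in the quadratic equation for [w]
     this leaves [nu (a - 1)^2 = 0]. *)
  assert (hsame : forall w a b w', (a + b)%C = w -> (a * b)%C = lam -> w' = (- nu - w)%C ->
            (w * w')%C = (- 4 * lam - nu * (1 + lam))%C -> a <> b).
  { intros w a b w' e1 e2 e3 e4 <-. subst w w' . rewrite <- e2 in e4.
    assert (q : (nu * ((a - 1) * (a - 1)))%C = RtoC 0).
    { transitivity ((a + a) * (- nu - (a + a)) - (- 4 * (a * a) - nu * (1 + a * a)))%C; [ring |]. rewrite e4. ring. }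
    destruct (Cmult_integral _ _ q) as [k | k]; auto.
    assert (a = RtoC 1) by (destruct (Cmult_integral _ _ k); apply Cminus_eq_zero; assumption).
    subst a. apply h1. rewrite <- e2. ring. }
  assert (hww : w1 <> w2).
  { intros <-. assert (q : ((nu + 4) * (nu + 4 * lam))%C = RtoC 0).
    { transitivity ((- nu) * (- nu) - 4 * (- 4 * lam - nu * (1 + lam)))%C; [ring |]. rewrite <- hs, <- hp. ring. }
    destruct (Cmult_integral _ _ q) as [k | k].
    - apply n4. replace nu with ((nu + 4) - 4)%C by ring. rewrite k. ring.
    - apply n5. replace nu with ((nu + 4 * lam) - 4 * lam)%C by ring. rewrite k. ring. }
  (* A root [a] common to both quadratics has the same partner [lam / a] in each, hence the same sum
     [w]. *)
  assert (hcross : forall a b w a' b' w', (a + b)%C = w -> (a * b)%C = lam -> (a' + b')%C = w' -> (a' * b')%C = lam ->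
            w <> w' -> a <> a').
  { intros a b w a' b' w' e1 e2 e3 e4 ne <-. apply ne. rewrite <- e1, <- e3.
    assert (ha : a <> RtoC 0) by (intros ->; apply h0; rewrite <- e2; ring).
    assert (q : (a * (b - b'))%C = RtoC 0) by (transitivity (a * b - a * b')%C; [ring | rewrite e2, e4; ring]).
    destruct (Cmult_integral _ _ q) as [k | k]; [contradiction |]. apply Cminus_eq_zero in k. rewrite k. reflexivity. }
  assert (d1 : a1 <> b1) by (apply (hsame w1 a1 b1 w2); auto; rewrite <- hs; ring).
  assert (d2 : a2 <> b2).
  { apply (hsame w2 a2 b2 w1); auto; [rewrite <- hs; ring | rewrite <- hp; ring]. }
  assert (s1' : (b1 + a1)%C = w1) by (rewrite <- s1; ring). assert (p1' : (b1 * a1)%C = lam) by (rewrite <- p1; ring).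
  assert (s2' : (b2 + a2)%C = w2) by (rewrite <- s2; ring). assert (p2' : (b2 * a2)%C = lam) by (rewrite <- p2; ring).
  assert (d3 : a1 <> a2) by (apply (hcross a1 b1 w1 a2 b2 w2); auto).
  assert (d4 : a1 <> b2) by (apply (hcross a1 b1 w1 b2 a2 w2); auto).
  assert (d5 : b1 <> a2) by (apply (hcross b1 a1 w1 a2 b2 w2); auto).
  assert (d6 : b1 <> b2) by (apply (hcross b1 a1 w1 b2 a2 w2); auto).
  exists a1, b1, a2, b2. repeat (split; [assumption |]). split; [| split; [| split; [| split]]].
  - intros z. rewrite is_zero_qf by assumption. fold nu. rewrite hq. split.
    + intros k. destruct (Cmult_integral _ _ k) as [k1 | k1]; [| apply Cminus_eq_zero in k1; auto].
      destruct (Cmult_integral _ _ k1) as [k2 | k2]; [| apply Cminus_eq_zero in k2; auto].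
      destruct (Cmult_integral _ _ k2) as [k3 | k3]; apply Cminus_eq_zero in k3; auto.
    + intros [-> | [-> | [-> | ->]]]; ring.
  - apply (simple_zero_of_factor lam mu a1 b1 a2 b2); auto.
  - apply (simple_zero_of_factor lam mu b1 a1 a2 b2); auto. intros z; rewrite hq; ring.
  - apply (simple_zero_of_factor lam mu a2 b2 a1 b1); auto. intros z; rewrite hq; ring.
  - apply (simple_zero_of_factor lam mu b2 a2 a1 b1); auto. intros z; rewrite hq; ring.
Qed.

Lemma not_two_double_and_four_simple (f : C -> C) (ps : list C) :
  two_double_zeros f ps -> four_simple_zeros f ps -> False.
Proof.
  intros [u [v [_ [h _]]]] [z1 [z2 [z3 [z4 [d1 [d2 [d3 [d4 [d5 [d6 [k _]]]]]]]]]]].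
  assert (q1 : z1 = u \/ z1 = v) by (apply h, k; auto).
  assert (q2 : z2 = u \/ z2 = v) by (apply h, k; auto).
  assert (q3 : z3 = u \/ z3 = v) by (apply h, k; auto).
  destruct q1, q2, q3; congruence.
Qed.

(** In each case the square root of the quartic is the numerator of [dlogF]. Both orders of the
    symmetric pair [b], [c] are recorded, since in the real case they get sorted and an affine map
    may reverse them. *)
Lemma log_square_qf (lam mu p b c : C) : lam <> RtoC 0 -> lam <> RtoC 1 ->
  (mu - 2 * (1 + lam))%C = RtoC 0 /\ p = RtoC 0 /\ b = RtoC 1 /\ c = lam \/
  (mu - 2 * (1 + lam))%C = RtoC (-4) /\ p = RtoC 1 /\ b = RtoC 0 /\ c = lam \/
  (mu - 2 * (1 + lam))%C = (-4 * lam)%C /\ p = lam /\ b = RtoC 0 /\ c = RtoC 1 ->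
  log_square (qf lam mu) (qpoles lam) p b c /\ log_square (qf lam mu) (qpoles lam) p c b.
Proof.
  intros h0 h1 hc.
  assert (h01 : RtoC 0 <> RtoC 1) by (intros k; injection k; lra).
  assert (key : log_square (qf lam mu) (qpoles lam) p b c).
  { split; [| split].
    - intros z. rewrite in_qpoles. destruct hc as [[_ [-> [-> ->]]] | [[_ [-> [-> ->]]] | [_ [-> [-> ->]]]]]; tauto.
    - destruct hc as [[_ [-> [-> ->]]] | [[_ [-> [-> ->]]] | [_ [-> [-> ->]]]]]; auto.
    - intros z hz. rewrite qf_quartic by assumption. destruct (factors_neq_0 lam z hz) as [n1 [n2 n3]].
      apply f_equal. unfold quartic, cubic, dlogF.
      destruct hc as [[-> [-> [-> ->]]] | [[-> [-> [-> ->]]] | [-> [-> [-> ->]]]]];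
        rewrite ?Cminus_0_r; field; auto. }
  split; [exact key |]. destruct key as [k1 [[k2 [k3 k4]] k5]]. split; [| split].
  - intros z. rewrite k1. tauto.
  - auto.
  - intros z hz. rewrite (k5 z hz). apply f_equal. apply not_eq_sym in k4.
    assert (e : dlogF p b c z = dlogF p c b z); [| rewrite e; reflexivity].
    unfold dlogF. f_equal; ring.
Qed.

(** * The arcs of the critical graph *)

Lemma filterlim_C_iff {T} (F : (T -> Prop) -> Prop) {FF : Filter F} (f : T -> C) (z : C) :
  filterlim f F (locally z) <->
  filterlim (fun t => Re (f t)) F (locally (Re z)) /\ filterlim (fun t => Im (f t)) F (locally (Im z)).
Proof.
  split.
  - intros h. split.
    + apply (filterlim_comp _ _ _ f (fun w : C => fst w) F (locally z)); [exact h |].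
      destruct z. apply continuous_fst.
    + apply (filterlim_comp _ _ _ f (fun w : C => snd w) F (locally z)); [exact h |].
      destruct z. apply continuous_snd.
  - intros [h1 h2]. apply filterlim_locally. intros eps.
    pose proof (proj1 (filterlim_locally _ _) h1 eps) as k1.
    pose proof (proj1 (filterlim_locally _ _) h2 eps) as k2.
    apply (filter_imp _ _) with (2 := filter_and _ _ k1 k2). intros t [q1 q2]. split; assumption.
Qed.

Lemma filterlim_R_plus {T} (F : (T -> Prop) -> Prop) {FF : Filter F} (f g : T -> R) (x y : R) :
  filterlim f F (locally x) -> filterlim g F (locally y) -> filterlim (fun t => f t + g t) F (locally (x + y)).
Proof. intros h k. eapply filterlim_comp_2; [exact h | exact k | apply (filterlim_plus x y)]. Qed.

Lemma filterlim_R_mult {T} (F : (T -> Prop) -> Prop) {FF : Filter F} (f g : T -> R) (x y : R) :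
  filterlim f F (locally x) -> filterlim g F (locally y) -> filterlim (fun t => f t * g t) F (locally (x * y)).
Proof. intros h k. eapply filterlim_comp_2; [exact h | exact k | apply (filterlim_mult (K := R_AbsRing) x y)]. Qed.

Lemma filterlim_R_comp {T} (F : (T -> Prop) -> Prop) (u : R -> R) (f : T -> R) (x : R) :
  continuity_pt u x -> filterlim f F (locally x) -> filterlim (fun t => u (f t)) F (locally (u x)).
Proof. intros hu hf. eapply filterlim_comp; [exact hf | apply continuity_pt_filterlim, hu]. Qed.

Lemma filterlim_R_opp {T} (F : (T -> Prop) -> Prop) (f : T -> R) (x : R) :
  filterlim f F (locally x) -> filterlim (fun t => - f t) F (locally (- x)).
Proof. apply (filterlim_R_comp F Ropp). reg. Qed.

Lemma filterlim_C_plus {T} (F : (T -> Prop) -> Prop) {FF : Filter F} (f g : T -> C) (z w : C) :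
  filterlim f F (locally z) -> filterlim g F (locally w) -> filterlim (fun t => f t + g t)%C F (locally (z + w)%C).
Proof.
  rewrite !(filterlim_C_iff F). intros [h1 h2] [k1 k2].
  split; [apply (filterlim_R_plus F _ _ _ _ h1 k1) | apply (filterlim_R_plus F _ _ _ _ h2 k2)].
Qed.

Lemma filterlim_C_conj {T} (F : (T -> Prop) -> Prop) {FF : Filter F} (f : T -> C) (z : C) :
  filterlim f F (locally z) -> filterlim (fun t => Cconj (f t)) F (locally (Cconj z)).
Proof.
  rewrite !(filterlim_C_iff F). intros [h1 h2]. split; [exact h1 | apply (filterlim_R_opp F _ _ h2)].
Qed.

Lemma filterlim_C_mult {T} (F : (T -> Prop) -> Prop) {FF : Filter F} (f g : T -> C) (z w : C) :
  filterlim f F (locally z) -> filterlim g F (locally w) -> filterlim (fun t => f t * g t)%C F (locally (z * w)%C).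
Proof.
  rewrite !(filterlim_C_iff F). intros [h1 h2] [k1 k2]. split.
  - apply filterlim_R_plus; [exact _ | apply (filterlim_R_mult F _ _ _ _ h1 k1) |].
    apply filterlim_R_opp, (filterlim_R_mult F _ _ _ _ h2 k2).
  - apply filterlim_R_plus; [exact _ | apply (filterlim_R_mult F _ _ _ _ h1 k2) |].
    apply (filterlim_R_mult F _ _ _ _ h2 k1).
Qed.

Lemma filterlim_C_inv {T} (F : (T -> Prop) -> Prop) {FF : Filter F} (f : T -> C) (z : C) :
  z <> RtoC 0 -> filterlim f F (locally z) -> filterlim (fun t => / f t)%C F (locally (/ z)%C).
Proof.
  intros h0. rewrite !(filterlim_C_iff F). intros [h1 h2].
  assert (hn : filterlim (fun t => / (Re (f t) ^ 2 + Im (f t) ^ 2)) F (locally (/ (Re z ^ 2 + Im z ^ 2)))).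
  { apply (filterlim_R_comp F Rinv (fun t => Re (f t) ^ 2 + Im (f t) ^ 2)).
    - apply continuity_pt_inv; [reg |]. intros k. apply h0, C_eq_zero_iff. split; nra.
    - apply filterlim_R_plus; [exact _ | |].
      + apply (filterlim_R_comp F (fun x => x ^ 2) (fun t => Re (f t))); [reg | exact h1].
      + apply (filterlim_R_comp F (fun x => x ^ 2) (fun t => Im (f t))); [reg | exact h2]. }
  split.
  - apply (filterlim_R_mult F _ _ _ _ h1 hn).
  - apply (filterlim_R_mult F _ _ _ _ (filterlim_R_opp F _ _ h2) hn).
Qed.

Lemma filterlim_RtoC {T} (F : (T -> Prop) -> Prop) {FF : Filter F} (f : T -> R) (x : R) :
  filterlim f F (locally x) -> filterlim (fun t => RtoC (f t)) F (locally (RtoC x)).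
Proof. intros h. apply filterlim_C_iff; [exact _ |]. split; [exact h | apply filterlim_const]. Qed.

Lemma filterlim_cis {T} (F : (T -> Prop) -> Prop) {FF : Filter F} (f : T -> R) (x : R) :
  filterlim f F (locally x) -> filterlim (fun t => cis (f t)) F (locally (cis x)).
Proof.
  intros h. apply filterlim_C_iff; [exact _ |].
  split; [apply (filterlim_R_comp F cos) | apply (filterlim_R_comp F sin)]; trivial; reg.
Qed.

Ltac limit := repeat match goal with
  | |- filterlim (fun _ => ?k) _ _ => apply filterlim_const
  | |- filterlim (fun t => Rplus (@?f t) (@?g t)) ?F _ => apply (filterlim_R_plus F f g)
  | |- filterlim (fun t => Rmult (@?f t) (@?g t)) ?F _ => apply (filterlim_R_mult F f g)
  | |- filterlim (fun t => Ropp (@?f t)) ?F _ => apply (filterlim_R_opp F f)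
  | |- filterlim (fun t => Cplus (@?f t) (@?g t)) ?F _ => apply (filterlim_C_plus F f g)
  | |- filterlim (fun t => Cmult (@?f t) (@?g t)) ?F _ => apply (filterlim_C_mult F f g)
  | |- filterlim (fun t => RtoC (@?f t)) ?F _ => apply (filterlim_RtoC F f)
  | |- filterlim (fun t => cis (@?f t)) ?F _ => apply (filterlim_cis F f)
  | |- _ => eassumption
  end.

Lemma filterlim_Cmod {T} (F : (T -> Prop) -> Prop) {FF : Filter F} (f : T -> C) (z : C) :
  filterlim f F (locally z) -> filterlim (fun t => Cmod (f t)) F (locally (Cmod z)).
Proof.
  rewrite (filterlim_C_iff F). intros [h1 h2].
  apply (filterlim_R_comp F sqrt (fun t => Re (f t) ^ 2 + Im (f t) ^ 2)).
  - apply continuity_pt_sqrt. nra.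
  - apply filterlim_R_plus; [exact _ | |].
    + apply (filterlim_R_comp F (fun x => x ^ 2) (fun t => Re (f t))); [reg | exact h1].
    + apply (filterlim_R_comp F (fun x => x ^ 2) (fun t => Im (f t))); [reg | exact h2].
Qed.

Lemma filterlim_Frat {T} (F : (T -> Prop) -> Prop) {FF : Filter F} (p b c : C) (g : T -> C) (z : C) :
  z <> p -> filterlim g F (locally z) -> filterlim (fun t => Frat p b c (g t)) F (locally (Frat p b c z)).
Proof.
  intros hz h. unfold Frat, Cdiv, Cminus.
  assert (hs : forall w : C, filterlim (fun t => g t + - w)%C F (locally (z + - w)%C)).
  { intros w. limit. }
  limit; try apply hs.
  apply filterlim_C_inv; [exact _ | apply (Cminus_neq_zero _ _ hz) | apply hs].
Qed.

Lemma at_right_in_int (a : R) (b : Rbar) : Rbar_lt a b -> at_right a (fun t => Defs.in_int a b t).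
Proof.
  intros h. unfold at_right, within.
  apply (filter_imp _ _) with (2 := open_Rbar_lt' a b h). intros t ht k. split; assumption.
Qed.

(** The critical values of [F] are [eps (c - b) cis phi] and its conjugate, with [phi] this angle.
    They cut the circle [|w| = c - b] in two parts, and [phi] is half the opening of the part
    centred at [eps (c - b)]. *)
Definition arc_angle (p b c eps : R) : R := acos (- eps * ((b - p) + (c - p)) / (c - b)).

(** The distance from [p] to either zero: these are [p + i h] and [p - i h] with [h] this number. *)
Definition half_gap (p b c : R) : R := sqrt ((p - b) * (c - p)).

Definition is_sign (x : R) : Prop := x = 1 \/ x = -1.

(* Parametrization of one of the four edges of the critical graph: on it [F = eps (c - b) cis (2 om - phi)] for [0 < om < phi];
   [sig] selects one of the two roots of the quadratic equation for [z]. *)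
Definition arc (p b c eps sig om : R) : C :=
  let phi := arc_angle p b c eps in
  (RtoC p + (RtoC (eps * (c - b)) * cis (2 * om - phi) + (RtoC b - RtoC p) + (RtoC c - RtoC p)
     + RtoC (2 * sig * (c - b) * (sqrt (sin om) * sqrt (sin (phi - om)))) * cis (om - phi / 2)) / 2)%C.

Lemma arc_angle_spec (p b c eps : R) : b < p < c -> is_sign eps ->
  let phi := arc_angle p b c eps in
  0 < phi < PI /\ (c - b) * cos phi = - eps * ((b - p) + (c - p)) /\
  (c - b) * sin phi = 2 * half_gap p b c.
Proof.
  intros h he phi. unfold phi, arc_angle. set (x := - eps * (b - p + (c - p)) / (c - b)).
  assert (hx : -1 < x < 1).
  { unfold x. split; apply Rmult_lt_reg_r with (c - b); try lra; unfold Rdiv;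
      rewrite Rmult_assoc, Rinv_l by lra; destruct he; subst eps; lra. }
  assert (hx' : -1 <= x <= 1) by lra.
  assert (hR : (c - b) * x = - eps * (b - p + (c - p))) by (unfold x; field; lra).
  split; [| split].
  - apply acos_bound_lt, hx.
  - rewrite cos_acos by exact hx'. exact hR.
  - rewrite sin_acos by exact hx'. rewrite <- (sqrt_Rsqr (c - b)) at 1 by lra.
    rewrite <- sqrt_mult by (unfold Rsqr; nra).
    unfold half_gap. rewrite <- (sqrt_Rsqr 2) by lra. rewrite <- sqrt_mult by (unfold Rsqr; nra).
    f_equal. unfold Rsqr. replace ((c - b) * (c - b) * (1 - x * x)) with ((c - b) * (c - b) - ((c - b) * x) * ((c - b) * x)) by ring.
    rewrite hR. destruct he; subst eps; ring.
Qed.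

Lemma half_gap_pos (p b c : R) : b < p < c -> 0 < half_gap p b c.
Proof. intros h. apply sqrt_lt_R0. nra. Qed.

Lemma half_gap_sqr (p b c : R) : b < p < c -> half_gap p b c * half_gap p b c = (p - b) * (c - p).
Proof. intros h. apply sqrt_sqrt. nra. Qed.

Lemma arc_sin_product (phi om : R) : 2 * (sin om * sin (phi - om)) = cos (2 * om - phi) - cos phi.
Proof.
  replace (2 * om - phi) with (om - (phi - om)) by ring.
  replace (cos phi) with (cos (om + (phi - om))) by (f_equal; ring).
  rewrite cos_minus, cos_plus. ring.
Qed.

Lemma arc_sin_pos (phi om : R) : 0 < om < phi -> phi < PI -> 0 < sin om /\ 0 < sin (phi - om).
Proof. intros h k. split; apply sin_gt_0; lra. Qed.

(** The discriminant is [(F - v1) (F - v2)] with [v1], [v2] equal to [eps (c - b)] times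
    [cis (- phi)], [cis phi]. Writing the argument of [eps F] as [2 om - phi] turns the differences
    into chords, [eps (c - b)] times [2 i sin om cis (om - phi)] and [2 i sin (om - phi) cis om], so
    that the root [s] is explicit. *)
Lemma arc_discriminant (p b c eps sig om : R) : b < p < c -> is_sign eps -> is_sign sig ->
  let phi := arc_angle p b c eps in 0 < om < phi ->
  let s := (RtoC (2 * sig * (c - b) * (sqrt (sin om) * sqrt (sin (phi - om)))) * cis (om - phi / 2))%C in
  let w := (RtoC (eps * (c - b)) * cis (2 * om - phi) + (RtoC b - RtoC p) + (RtoC c - RtoC p))%C in
  (s * s)%C = (w * w - 4 * ((RtoC b - RtoC p) * (RtoC c - RtoC p)))%C.
Proof.
  intros h he hs phi ho s w.
  destruct (arc_angle_spec p b c eps h he) as [hphi [hcos _]]. fold phi in hphi, hcos.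
  destruct (arc_sin_pos phi om ho (proj2 hphi)) as [p1 p2].
  assert (hss : (s * s)%C = (RtoC (2 * (c - b) ^ 2 * (cos (2 * om - phi) - cos phi)) * cis (2 * om - phi))%C).
  { replace (2 * om - phi) with ((om - phi / 2) + (om - phi / 2)) at 2 by field. rewrite cis_plus.
    unfold s. rewrite <- (arc_sin_product phi om).
    pose proof (sqrt_sqrt _ (Rlt_le _ _ p1)) as q1. pose proof (sqrt_sqrt _ (Rlt_le _ _ p2)) as q2.
    set (a := sqrt (sin om)) in *. set (d := sqrt (sin (phi - om))) in *.
    replace (2 * (c - b) ^ 2 * (2 * (sin om * sin (phi - om)))) with
      ((2 * sig * (c - b) * (a * d)) * (2 * sig * (c - b) * (a * d))).
    - set (k := 2 * sig * (c - b) * (a * d)). rewrite (RtoC_mult k k). ring.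
    - rewrite <- q1, <- q2. destruct hs; subst sig; ring. }
  rewrite hss. unfold w. clear hss s w p1 p2.
  pose proof (sin2_cos2 (2 * om - phi)) as hsc. unfold Rsqr in hsc. unfold cis.
  set (x := cos (2 * om - phi)) in *. set (y := sin (2 * om - phi)) in *. set (k := cos phi) in *.
  assert (he2 : eps * eps = 1) by (destruct he; subst eps; ring).
  apply C_ext; simpl; clear - hcos hsc he2; nsatz.
Qed.

Lemma arc_spec (p b c eps sig om : R) : b < p < c -> is_sign eps -> is_sign sig ->
  0 < om < arc_angle p b c eps ->
  arc p b c eps sig om <> RtoC p /\
  Frat p b c (arc p b c eps sig om) = (RtoC (eps * (c - b)) * cis (2 * om - arc_angle p b c eps))%C.
Proof.
  intros h he hs ho. unfold arc. apply Frat_root.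
  - intros k; injection k; lra.
  - intros k; injection k; lra.
  - apply (arc_discriminant p b c eps sig om h he hs ho).
Qed.

Lemma ex_derive_arc (p b c eps sig om : R) : b < p < c -> is_sign eps ->
  0 < om < arc_angle p b c eps -> ex_derive (arc p b c eps sig) om.
Proof.
  intros h he ho. destruct (arc_angle_spec p b c eps h he) as [hphi _].
  destruct (arc_sin_pos _ om ho (proj2 hphi)) as [p1 p2].
  unfold arc. set (phi := arc_angle p b c eps) in *.
  apply ex_derive_C; simpl; auto_derive; repeat split; trivial; lra.
Qed.

Lemma arc_signs (p b c eps sig om : R) : b < p < c -> is_sign eps -> is_sign sig ->
  0 < om < arc_angle p b c eps ->
  0 < sig * (Re (arc p b c eps sig om) - p) /\
  0 < eps * (Re (Frat p b c (arc p b c eps sig om)) + ((b - p) + (c - p))).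
Proof.
  intros h he hs ho. destruct (arc_angle_spec p b c eps h he) as [hphi [hcos _]].
  destruct (arc_sin_pos _ om ho (proj2 hphi)) as [p1 p2].
  rewrite (proj2 (arc_spec p b c eps sig om h he hs ho)).
  set (phi := arc_angle p b c eps) in *.
  pose proof (arc_sin_product phi om) as hK.
  pose proof (sqrt_sqrt _ (Rlt_le _ _ p1)) as q1. pose proof (sqrt_sqrt _ (Rlt_le _ _ p2)) as q2.
  pose proof (sqrt_lt_R0 _ p1) as r1. pose proof (sqrt_lt_R0 _ p2) as r2.
  assert (he2 : eps * eps = 1) by (destruct he; subst eps; ring).
  split.
  - unfold arc. simpl. fold phi.
    set (a := sqrt (sin om)) in *. set (d := sqrt (sin (phi - om))) in *.
    assert (hq : 0 < a * d) by (apply Rmult_lt_0_compat; assumption).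
    assert (hal : 0 < cos (om - phi / 2)) by (apply cos_gt_0; lra).
    assert (hd : cos (2 * om - phi) = 2 * (cos (om - phi / 2) * cos (om - phi / 2)) - 1).
    { replace (2 * om - phi) with (2 * (om - phi / 2)) by field. rewrite cos_2a_cos. ring. }
    assert (hphi1 : -1 < cos phi).
    { rewrite <- cos_PI. apply cos_decreasing_1; lra. }
    assert (hqq : (a * d) * (a * d) = sin om * sin (phi - om)) by (rewrite <- q1, <- q2; ring).
    set (q := a * d) in *. set (u := cos (om - phi / 2)) in *.
    (* [q^2] and [u^2] are the halves of [cos (2 om - phi) - cos phi] and of
       [cos (2 om - phi) + 1]. *)
    assert (hlt : q < u) by nra.
    match goal with |- 0 < sig * (?X - p) => assert (hX : X = p + (c - b) * (eps * (q * q) + sig * q * u)) end.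
    { rewrite !Rmult_0_l, !Rminus_0_r, ?Rplus_0_r.
      replace (cos (2 * om - phi)) with (2 * (q * q) + cos phi) by (rewrite hqq; lra).
      replace (eps * (c - b) * (2 * (q * q) + cos phi)) with (2 * eps * (c - b) * (q * q) + eps * ((c - b) * cos phi)) by ring.
      rewrite hcos. replace (eps * (- eps * (b - p + (c - p)))) with (- (eps * eps) * (b - p + (c - p))) by ring.
      rewrite he2. field. }
    rewrite hX. replace (sig * (p + (c - b) * (eps * (q * q) + sig * q * u) - p)) with
      ((c - b) * q * (sig * eps * q + sig * sig * u)) by ring.
    apply Rmult_lt_0_compat; [apply Rmult_lt_0_compat; lra |].
    destruct he, hs; subst eps sig; lra.
  - simpl. rewrite Rmult_0_l, Rminus_0_r.
    replace (eps * (eps * (c - b) * cos (2 * om - phi) + (b - p + (c - p)))) with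
      (eps * eps * (c - b) * cos (2 * om - phi) - - eps * (b - p + (c - p))) by ring.
    rewrite <- hcos, he2. assert (0 < sin om * sin (phi - om)) by (apply Rmult_lt_0_compat; assumption). nra.
Qed.

(** On the critical level the signs of [arc_signs] can change only at a zero of [q]. If the first
    expression vanishes, [F] is a critical value. If [Re z = p], the imaginary part of the quadratic
    equation for [z - p] leads back to that case. *)
Lemma critical_level_nondegenerate (p b c : R) (z : C) : b < p < c -> z <> RtoC p ->
  Cmod (Frat p b c z) = c - b -> dlogF p b c z <> RtoC 0 ->
  Re (Frat p b c z) + ((b - p) + (c - p)) <> 0 /\ Re z - p <> 0.
Proof.
  intros h hz hF hL.
  set (e := (b - p) + (c - p)).
  assert (he : RtoC e = ((RtoC b - RtoC p) + (RtoC c - RtoC p))%C) by (unfold e; rewrite RtoC_plus, !RtoC_minus; ring).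
  assert (hz' : (z - RtoC p)%C <> RtoC 0) by apply Cminus_neq_zero, hz.
  assert (hquad : ((z - RtoC p) * (z - RtoC p) - (Frat p b c z + RtoC e) * (z - RtoC p) +
            (RtoC b - RtoC p) * (RtoC c - RtoC p))%C = RtoC 0).
  { rewrite he. unfold Frat. field. exact hz'. }
  assert (hsq : ((z - RtoC p) * (z - RtoC p))%C <> ((RtoC b - RtoC p) * (RtoC c - RtoC p))%C).
  { intros k. apply hL. unfold dlogF. rewrite k. unfold Cdiv. ring. }
  assert (h1 : Re (Frat p b c z) + e <> 0).
  { intros k. apply hsq.
    (* [|F| = R] and [Re F = -e] make the discriminant [(F + e)^2 - 4 (b - p) (c - p)] vanish *)
    assert (hdisc : ((Frat p b c z + RtoC e) * (Frat p b c z + RtoC e))%C = (4 * ((RtoC b - RtoC p) * (RtoC c - RtoC p)))%C).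
    { pose proof (Cmod_sqr (Frat p b c z)) as hm. rewrite hF in hm.
      destruct (Frat p b c z) as [x y]. simpl in k, hm. unfold e in *.
      apply C_ext; simpl; nra. }
    assert (hy : ((2 * (z - RtoC p) - (Frat p b c z + RtoC e)) * (2 * (z - RtoC p) - (Frat p b c z + RtoC e)))%C = RtoC 0).
    { transitivity (4 * ((z - RtoC p) * (z - RtoC p) - (Frat p b c z + RtoC e) * (z - RtoC p) +
            (RtoC b - RtoC p) * (RtoC c - RtoC p)) + ((Frat p b c z + RtoC e) * (Frat p b c z + RtoC e)
            - 4 * ((RtoC b - RtoC p) * (RtoC c - RtoC p))))%C; [ring |]. rewrite hquad, hdisc. ring. }
    assert (hy2 : (2 * (z - RtoC p) - (Frat p b c z + RtoC e))%C = RtoC 0) by (destruct (Cmult_integral _ _ hy); assumption).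
    apply Cminus_eq_zero in hy2.
    transitivity ((2 * (z - RtoC p)) * (2 * (z - RtoC p)) / 4)%C; [field |].
    rewrite hy2, hdisc. field. }
  split; [exact h1 |]. intros k. apply h1.
  destruct z as [x y]. simpl in k.
  assert (hy0 : y <> 0). { intros ->. apply hz'. apply C_ext; simpl; lra. }
  destruct (Frat p b c (x, y)) as [F1 F2]. simpl in hquad |- *.
  pose proof (f_equal Im hquad) as q. simpl in q. assert (hx : x - p = 0) by lra.
  assert (q' : (F1 + e) * y = 0) by nra.
  destruct (Rmult_integral _ _ q'); [assumption | contradiction].
Qed.

Lemma arc_cover (p b c : R) (z : C) : b < p < c -> z <> RtoC p ->
  Cmod (Frat p b c z) = c - b -> dlogF p b c z <> RtoC 0 ->
  exists eps sig om, is_sign eps /\ is_sign sig /\ 0 < om < arc_angle p b c eps /\ z = arc p b c eps sig om.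
Proof.
  intros h hz hF hL. destruct (critical_level_nondegenerate p b c z h hz hF hL) as [h1 _].
  assert (heps : exists eps, is_sign eps /\ 0 < eps * (Re (Frat p b c z) + ((b - p) + (c - p)))).
  { destruct (Rtotal_order 0 (Re (Frat p b c z) + ((b - p) + (c - p)))) as [k | [k | k]].
    - exists 1. split; [left; reflexivity | lra].
    - congruence.
    - exists (-1). split; [right; reflexivity | lra]. }
  destruct heps as [eps [he hpos]].
  destruct (arc_angle_spec p b c eps h he) as [hphi [hcos _]]. set (phi := arc_angle p b c eps) in *.
  assert (he2 : eps * eps = 1) by (destruct he; subst eps; ring).
  assert (heabs : Cmod (RtoC eps) = 1).
  { rewrite Cmod_R. destruct he; subst eps; [apply Rabs_R1 | rewrite Rabs_left; lra]. }
  (* Multiplication by [eps] centres the arc of values at argument [0], so the argument chosen in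
     [[-PI, PI]] lands in [(-phi, phi)] and no cut is met. *)
  destruct (polar (RtoC eps * Frat p b c z)%C) as [th [hth hpol]].
  rewrite Cmod_mult, heabs, hF, Rmult_1_l in hpol.
  assert (hF2 : Frat p b c z = (RtoC (eps * (c - b)) * cis th)%C).
  { rewrite RtoC_mult, <- Cmult_assoc, <- hpol, Cmult_assoc, <- RtoC_mult, he2. ring. }
  assert (hct : cos phi < cos th).
  { rewrite hF2 in hpos. simpl in hpos. rewrite Rmult_0_l, Rminus_0_r in hpos.
    apply Rmult_lt_reg_l with (c - b); [lra |]. rewrite hcos.
    replace (eps * (eps * (c - b) * cos th + (b - p + (c - p)))) with
      (eps * eps * ((c - b) * cos th) - - eps * (b - p + (c - p))) in hpos by ring.
    rewrite he2 in hpos. lra. }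
  assert (hth' : - phi < th < phi).
  { split; apply Rnot_le_lt; intros k.
    - assert (cos (- th) <= cos phi) by (apply cos_decr_1; lra). rewrite cos_neg in *. lra.
    - assert (cos th <= cos phi) by (apply cos_decr_1; lra). lra. }
  set (om := (th + phi) / 2).
  assert (ho : 0 < om < phi) by (unfold om; lra).
  assert (eth : 2 * om - phi = th) by (unfold om; field).
  pose proof (arc_discriminant p b c eps 1 om h he (or_introl eq_refl) ho) as hd. cbv zeta in hd. fold phi in hd.
  rewrite eth in hd.
  destruct (Frat_root_inv p b c _ _ z hz hF2 hd) as [k | k].
  - exists eps, 1, om. repeat split; try (left; reflexivity); try apply ho; auto.
    rewrite k. unfold arc. fold phi. rewrite eth. reflexivity.
  - exists eps, (-1), om. repeat split; try (right; reflexivity); try apply ho; auto.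
    rewrite k. unfold arc. fold phi. rewrite eth.
    replace (2 * -1 * (c - b) * (sqrt (sin om) * sqrt (sin (phi - om)))) with
      (- (2 * 1 * (c - b) * (sqrt (sin om) * sqrt (sin (phi - om))))) by ring.
    rewrite RtoC_opp. unfold Cdiv. ring.
Qed.

(** Conjugation reverses each arc. Hence only the end [om -> 0] needs a local study; the other end
    is its mirror image. *)
Lemma arc_conj (p b c eps sig om : R) :
  Cconj (arc p b c eps sig om) = arc p b c eps sig (arc_angle p b c eps - om).
Proof.
  unfold arc. set (phi := arc_angle p b c eps).
  replace (2 * (phi - om) - phi) with (- (2 * om - phi)) by ring.
  replace (phi - om - phi / 2) with (- (om - phi / 2)) by field.
  replace (phi - (phi - om)) with om by ring. rewrite !cis_opp_conj.
  set (t := sqrt (sin om)). set (t' := sqrt (sin (phi - om))).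
  apply C_ext; simpl; field.
Qed.

(** The limit of the arc for [om -> 0]: the lower zero if [eps = 1], the upper one if [eps = -1]. *)
Definition arc_start (p b c eps : R) : C := (p, - eps * half_gap p b c).

Definition arc_dir (p b c eps sig : R) : C := (RtoC sig * cis (- (arc_angle p b c eps / 2)))%C.

(** Near the zero, [F] minus its critical value is of order [om] but quadratic in [z], so the
    distance to the zero is of order [sqrt om]. This is the secant divided by
    [(c - b) sqrt (sin om)]; its limit at [om = 0] is nonzero and gives the direction of the arc. *)
Definition arc_secant (p b c eps sig om : R) : C :=
  let phi := arc_angle p b c eps in
  (RtoC (eps * sqrt (sin om)) * Ci * cis (om - phi) + RtoC (sig * sqrt (sin (phi - om))) * cis (om - phi / 2))%C.

Lemma arc_secant_spec (p b c eps sig om : R) : b < p < c -> is_sign eps -> 0 < om < arc_angle p b c eps ->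
  (arc p b c eps sig om - arc_start p b c eps)%C =
  (RtoC ((c - b) * sqrt (sin om)) * arc_secant p b c eps sig om)%C.
Proof.
  intros h he ho. destruct (arc_angle_spec p b c eps h he) as [hphi [hcos hsin]].
  destruct (arc_sin_pos _ om ho (proj2 hphi)) as [p1 _].
  unfold arc, arc_start, arc_secant. set (phi := arc_angle p b c eps) in *.
  pose proof (sqrt_sqrt _ (Rlt_le _ _ p1)) as q1.
  set (t := sqrt (sin om)) in *. set (t' := sqrt (sin (phi - om))).
  assert (he2 : eps * eps = 1) by (destruct he; subst eps; ring).
  assert (hstart : (eps * (c - b) * (cos (2 * om - phi) - cos phi)) = - 2 * (eps * (c - b) * (t * t) * sin (om - phi)) /\
                   (eps * (c - b) * (sin (2 * om - phi) + sin phi)) = 2 * (eps * (c - b) * (t * t) * cos (om - phi))).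
  { rewrite q1. replace (2 * om - phi) with (om + (om - phi)) by ring.
    replace (cos phi) with (cos (om - (om - phi))) by (f_equal; ring).
    replace (sin phi) with (sin (om - (om - phi))) by (f_equal; ring). clear.
    generalize (om - phi). intros x. rewrite cos_plus, cos_minus, sin_plus, sin_minus. split; ring. }
  destruct hstart as [s1 s2].
  replace (eps * (c - b) * (sin (2 * om - phi) + sin phi)) with
    (eps * (c - b) * sin (2 * om - phi) + eps * ((c - b) * sin phi)) in s2 by ring.
  replace (eps * (c - b) * (cos (2 * om - phi) - cos phi)) with
    (eps * (c - b) * cos (2 * om - phi) - eps * ((c - b) * cos phi)) in s1 by ring.
  rewrite hsin in s2. rewrite hcos in s1.
  set (ct := cos (2 * om - phi)) in *. set (st := sin (2 * om - phi)) in *.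
  set (hg := half_gap p b c) in *.
  unfold cis. fold ct st. set (c1 := cos (om - phi / 2)). set (s1' := sin (om - phi / 2)).
  set (c2 := cos (om - phi)) in *. set (s2' := sin (om - phi)) in *.
  clearbody t t' ct st hg c1 s1' c2 s2'.
  apply C_ext; simpl; clear - s1 s2 he2.
  - assert (e1 : eps * (c - b) * ct = - 2 * (eps * (c - b) * (t * t) * s2') - (b - p + (c - p))).
    { replace (b - p + (c - p)) with (eps * eps * (b - p + (c - p))) by (rewrite he2; ring). lra. }
    field_simplify. lra.
  - field_simplify. lra.
Qed.

(** * Half-edges at the zeros *)

(** For [om = PI t + phi / 2] the argument [2 om - phi] is [2 PI t]: this is the unit-speed
    parametrization, on a symmetric interval of length [phi / PI]. *)
Definition arcset (p b c eps sig : R) : C -> Prop :=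
  img (fun t => arc p b c eps sig (PI * t + arc_angle p b c eps / 2))
      (- (arc_angle p b c eps / (2 * PI))) (arc_angle p b c eps / (2 * PI)).

Lemma arc_time (phi t : R) :
  Defs.in_int (- (phi / (2 * PI))) (phi / (2 * PI)) t <-> 0 < PI * t + phi / 2 < phi.
Proof.
  pose proof PI_RGT_0 as hp.
  assert (e : phi = PI * 2 * (phi / (2 * PI))) by (field; lra).
  unfold Defs.in_int. simpl. set (a := phi / (2 * PI)) in *. rewrite e. clearbody a.
  split; intros [h1 h2]; split; nra.
Qed.

Lemma arcset_iff (p b c eps sig : R) (z : C) :
  arcset p b c eps sig z <-> exists om, 0 < om < arc_angle p b c eps /\ z = arc p b c eps sig om.
Proof.
  set (phi := arc_angle p b c eps). split.
  - intros [t [ht <-]]. exists (PI * t + phi / 2). split; [apply arc_time, ht | reflexivity].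
  - intros [om [ho ->]].
    assert (e : PI * ((om - phi / 2) / PI) + phi / 2 = om) by (field; apply PI_neq0).
    exists ((om - phi / 2) / PI). split.
    + apply arc_time. fold phi. rewrite e. exact ho.
    + fold phi. rewrite e. reflexivity.
Qed.

Lemma arcset_conj (p b c eps sig : R) (z : C) : arcset p b c eps sig z -> arcset p b c eps sig (Cconj z).
Proof.
  rewrite !arcset_iff. intros [om [ho ->]]. exists (arc_angle p b c eps - om).
  split; [lra | apply arc_conj].
Qed.

(** Each set is the image of a horizontal curve, which the maximality of the other set forces into
    it. *)
Lemma traj_meet_same (f : C -> C) (ps : list C) (S S' : C -> Prop) (z : C) :
  is_traj f ps S -> is_traj f ps S' -> S z -> S' z -> same_set S S'.
Proof.
  intros [[g [a [b [hg e]]]] m] [[g' [a' [b' [hg' e']]]] m'] hz hz' w. split; intros hw.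
  - apply e in hw. destruct hw as [t [it <-]]. apply (m' g a b hg); [| exact it].
    apply e in hz. destruct hz as [s [is hs]]. exists s. rewrite hs. auto.
  - apply e' in hw. destruct hw as [t [it <-]]. apply (m g' a' b' hg'); [| exact it].
    apply e' in hz'. destruct hz' as [s [is hs]]. exists s. rewrite hs. auto.
Qed.

Lemma int_same_sign (u : R -> R) a b :
  (forall t, Defs.in_int a b t -> continuous u t /\ u t <> 0) ->
  forall t1 t2 k, Defs.in_int a b t1 -> Defs.in_int a b t2 -> 0 < k * u t1 -> 0 < k * u t2.
Proof.
  intros h t1 t2 k i1 i2 hk. apply (int_sign (fun t => k * u t) a b) with t1; auto.
  intros t it. destruct (h t it) as [h1 h2]. split.
  - apply (continuous_mult (K := R_AbsRing) (fun _ => k) u); [apply continuous_const | exact h1].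
  - apply Rmult_integral_contrapositive_currified; [intros ->; lra | exact h2].
Qed.

Lemma horiz_regular f ps p b c g a e :
  log_square f ps p b c -> horiz f ps g a e -> forall t, Defs.in_int a e t ->
  g t <> p /\ g t <> b /\ g t <> c /\ continuous g t /\ dlogF p b c (g t) <> RtoC 0.
Proof.
  intros [hps [_ hf]] [_ hg] t it. destruct (hg t it) as [np [d [hd [_ hre]]]].
  split; [| split; [| split; [| split]]]; try (intros k; apply np, hps; solve [auto]).
  - apply (is_derive_C_continuous g t d hd).
  - intros k. rewrite (hf _ np), k in hre. simpl in hre. lra.
Qed.

Lemma arc_horiz f ps (p b c eps sig : R) : b < p < c -> is_sign eps -> is_sign sig ->
  log_square f ps p b c ->
  unit_horiz f ps (fun t => arc p b c eps sig (PI * t + arc_angle p b c eps / 2))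
    (- (arc_angle p b c eps / (2 * PI))) (arc_angle p b c eps / (2 * PI)) /\
  unit_horiz f ps (fun t => Cconj (arc p b c eps sig (PI * t + arc_angle p b c eps / 2)))
    (- (arc_angle p b c eps / (2 * PI))) (arc_angle p b c eps / (2 * PI)).
Proof.
  intros h he hs hq. destruct (arc_angle_spec p b c eps h he) as [hphi _].
  set (phi := arc_angle p b c eps) in *. pose proof PI_RGT_0 as hpi.
  assert (hk : eps * (c - b) <> 0).
  { apply Rmult_integral_contrapositive_currified; [destruct he; subst eps; lra | lra]. }
  assert (hlt : Rbar_lt (- (phi / (2 * PI))) (phi / (2 * PI))).
  { simpl. assert (0 < phi / (2 * PI)) by (apply Rdiv_lt_0_compat; lra). lra. }
  assert (hex : forall om, 0 < om < phi -> forall k m t : R, k * t + m = om ->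
            ex_derive (fun t => arc p b c eps sig (k * t + m)) t).
  { intros om ho k m t e. apply (ex_derive_comp (arc p b c eps sig) (fun t => k * t + m)).
    - rewrite e. apply ex_derive_arc; auto.
    - auto_derive. trivial. }
  split.
  - apply (level_param_unit f ps p b c _ _ _ (eps * (c - b)) (2 * PI)); auto; [ring |].
    intros t it. apply arc_time in it.
    destruct (arc_spec p b c eps sig _ h he hs it) as [h1 h2]. split; [exact h1 | split].
    + apply (hex _ it). reflexivity.
    + rewrite h2. fold phi. do 2 f_equal. field.
  - apply (level_param_unit f ps p b c _ _ _ (eps * (c - b)) (- (2 * PI))); auto; [ring |].
    intros t it. apply arc_time in it.
    assert (it' : 0 < phi - (PI * t + phi / 2) < phi) by lra.
    rewrite arc_conj. fold phi. destruct (arc_spec p b c eps sig _ h he hs it') as [h1 h2].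
    split; [exact h1 | split].
    + apply (ex_derive_ext (fun t => arc p b c eps sig (- PI * t + phi / 2))).
      { intros s. rewrite arc_conj. fold phi. f_equal. field. }
      apply (hex _ it'). field.
    + rewrite h2. fold phi. do 2 f_equal. field.
Qed.

Lemma Frat_Cmod_arc (p b c eps sig om : R) : b < p < c -> is_sign eps -> is_sign sig ->
  0 < om < arc_angle p b c eps -> Cmod (Frat p b c (arc p b c eps sig om)) = c - b.
Proof.
  intros h he hs ho. rewrite (proj2 (arc_spec p b c eps sig om h he hs ho)).
  rewrite Cmod_mult, Cmod_cis, Cmod_R, Rmult_1_r, Rabs_mult, (Rabs_pos_eq (c - b)) by lra.
  destruct he; subst eps; [rewrite Rabs_R1 | rewrite Rabs_left by lra]; ring.
Qed.

(** A horizontal curve meeting the arc stays at regular points of the critical level, where the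
    signs of [arc_signs] cannot change; [arc_cover] then puts it on an arc, and the signs identify
    this arc. *)
Lemma arcset_is_traj f ps (p b c eps sig : R) : b < p < c -> is_sign eps -> is_sign sig ->
  log_square f ps p b c -> is_traj f ps (arcset p b c eps sig).
Proof.
  intros h he hs hq. split.
  - do 3 eexists. split; [apply (proj1 (arc_horiz f ps p b c eps sig h he hs hq)) | intros z; apply iff_refl].
  - intros g a e hg [t1 [i1 j1]] t it.
    apply arcset_iff in j1. destruct j1 as [om [ho e1]].
    pose proof (horiz_regular f ps p b c g a e hq hg) as hreg.
    assert (hlev : forall s, Defs.in_int a e s -> Cmod (Frat p b c (g s)) = c - b).
    { intros s is. rewrite (horiz_Cmod_constant f ps p b c g a e hq hg s t1 is i1), e1.
      apply Frat_Cmod_arc; auto. }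
    destruct (arc_signs p b c eps sig om h he hs ho) as [s1 s2]. rewrite <- e1 in s1, s2.
    assert (k1 : 0 < sig * (Re (g t) - p)).
    { apply (int_same_sign (fun s => Re (g s) - p) a e) with t1; auto.
      intros s is. destruct (hreg s is) as [n1 [_ [_ [hc hL]]]]. split.
      - apply (continuous_minus (V := R_NormedModule) (fun s => Re (g s)) (fun _ => p));
          [apply continuous_Re, hc | apply continuous_const].
      - apply (critical_level_nondegenerate p b c (g s)); auto. }
    assert (k2 : 0 < eps * (Re (Frat p b c (g t)) + ((b - p) + (c - p)))).
    { apply (int_same_sign (fun s => Re (Frat p b c (g s)) + ((b - p) + (c - p))) a e) with t1; auto.
      intros s is. destruct (hreg s is) as [n1 [_ [_ [hc hL]]]]. split.
      - apply (continuous_plus (V := R_NormedModule) (fun s => Re (Frat p b c (g s))) (fun _ => (b - p) + (c - p)));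
          [| apply continuous_const].
        apply (continuous_Re (fun s => Frat p b c (g s))). apply filterlim_Frat; [exact _ | exact n1 | exact hc].
      - apply (critical_level_nondegenerate p b c (g s)); auto. }
    destruct (hreg t it) as [n1 [_ [_ [_ hL]]]].
    destruct (arc_cover p b c (g t) h n1 (hlev t it) hL) as [eps' [sig' [om' [he' [hs' [ho' e']]]]]].
    destruct (arc_signs p b c eps' sig' om' h he' hs' ho') as [q1 q2]. rewrite <- e' in q1, q2.
    assert (eps' = eps) by (destruct he, he'; subst; trivial; lra).
    assert (sig' = sig) by (destruct hs, hs'; subst; trivial; lra).
    subst eps' sig'. apply arcset_iff. exists om'. auto.
Qed.

Lemma critical_traj_is_arc f ps (p b c : R) (S : C -> Prop) (z : C) : b < p < c ->
  log_square f ps p b c -> is_traj f ps S -> S z -> Cmod (Frat p b c z) = c - b ->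
  exists eps sig, is_sign eps /\ is_sign sig /\ same_set S (arcset p b c eps sig).
Proof.
  intros h hq hS hz hF.
  assert (hreg : z <> RtoC p /\ dlogF p b c z <> RtoC 0).
  { destruct hS as [[g [a [e [hg hs]]]] _]. apply hs in hz. destruct hz as [t [it <-]].
    destruct (horiz_regular f ps p b c g a e hq hg t it) as [n1 [_ [_ [_ hL]]]]. auto. }
  destruct hreg as [n1 hL].
  destruct (arc_cover p b c z h n1 hF hL) as [eps [sig [om [he [hs [ho ez]]]]]].
  exists eps, sig. split; [exact he | split; [exact hs |]].
  apply (traj_meet_same f ps S (arcset p b c eps sig) z); auto.
  - apply arcset_is_traj; auto.
  - apply arcset_iff. exists om. auto.
Qed.

Lemma arc_start_neq (p b c eps : R) : b < p < c -> is_sign eps -> arc_start p b c eps <> RtoC p.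
Proof.
  intros h he k. pose proof (half_gap_pos p b c h) as hg. injection k. destruct he; subst eps; intros; lra.
Qed.

(** At a critical point [(z - p)^2 = (b - p) (c - p)], so that
    [F z = 2 (z - p) - ((b - p) + (c - p))]. *)
Lemma Frat_arc_start (p b c eps : R) : b < p < c -> is_sign eps ->
  Frat p b c (arc_start p b c eps) = (RtoC (eps * (c - b)) * cis (- arc_angle p b c eps))%C.
Proof.
  intros h he. destruct (arc_angle_spec p b c eps h he) as [_ [hcos hsin]].
  pose proof (half_gap_sqr p b c h) as hg2.
  pose proof (Cminus_neq_zero _ _ (arc_start_neq p b c eps h he)) as hn.
  transitivity (2 * (arc_start p b c eps - RtoC p) - ((RtoC b - RtoC p) + (RtoC c - RtoC p)))%C.
  - assert (hsq : ((arc_start p b c eps - RtoC p) * (arc_start p b c eps - RtoC p))%C = ((RtoC b - RtoC p) * (RtoC c - RtoC p))%C).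
    { unfold arc_start. apply C_ext; simpl; destruct he; subst eps; nra. }
    unfold Frat. set (z := arc_start p b c eps) in *.
    transitivity (((z - RtoC p) * (z - RtoC p) - ((RtoC b - RtoC p) + (RtoC c - RtoC p)) * (z - RtoC p) +
       (RtoC b - RtoC p) * (RtoC c - RtoC p)) / (z - RtoC p))%C; [field; exact hn |].
    rewrite <- hsq. field. exact hn.
  - unfold arc_start. apply C_ext; simpl; rewrite ?cos_neg, ?sin_neg.
    + replace (eps * (c - b) * cos (arc_angle p b c eps) - 0 * - sin (arc_angle p b c eps))
        with (eps * ((c - b) * cos (arc_angle p b c eps))) by ring.
      rewrite hcos. destruct he; subst eps; ring.
    + replace (eps * (c - b) * - sin (arc_angle p b c eps) + 0 * cos (arc_angle p b c eps))
        with (- eps * ((c - b) * sin (arc_angle p b c eps))) by ring.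
      rewrite hsin. ring.
Qed.

Lemma is_zero_log_square f ps (p b c : R) (z : C) : b < p < c -> log_square f ps p b c ->
  (is_zero f ps z <-> z = arc_start p b c 1 \/ z = arc_start p b c (-1)).
Proof.
  intros h [hps [_ hf]]. pose proof (half_gap_sqr p b c h) as hg2. pose proof (half_gap_pos p b c h) as hg.
  split.
  - intros [np h0]. rewrite (hf _ np) in h0.
    destruct (Cmult_integral _ _ h0) as [k | k]; [destruct (kappa_neq_0 k) |].
    assert (hL : dlogF p b c z = RtoC 0) by (destruct (Cmult_integral _ _ k); assumption).
    assert (np' : z <> RtoC p /\ z <> RtoC b /\ z <> RtoC c).
    { repeat split; intros q; apply np, hps; auto. }
    destruct np' as [n1 [n2 n3]]. apply Cminus_neq_zero in n1, n2, n3.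
    assert (hsq : ((z - RtoC p) * (z - RtoC p))%C = ((0, half_gap p b c) * (0, half_gap p b c))%C).
    { transitivity ((RtoC b - RtoC p) * (RtoC c - RtoC p))%C; [| apply C_ext; simpl; nra].
      apply Cminus_eq_zero.
      transitivity (dlogF p b c z * ((z - RtoC p) * (z - RtoC b) * (z - RtoC c)))%C.
      - unfold dlogF. field. auto.
      - rewrite hL. ring. }
    destruct (Csqr_eq _ _ hsq) as [q | q]; [right | left]; unfold arc_start; destruct z as [x y];
      injection q; simpl; intros; apply C_ext; simpl; lra.
  - assert (aux : forall eps, is_sign eps -> is_zero f ps (arc_start p b c eps)).
    { intros eps he.
      assert (np : ~ In (arc_start p b c eps) ps).
      { rewrite hps. intros [k | [k | k]]; injection k; destruct he; subst eps; intros; lra. }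
      split; [exact np |]. rewrite (hf _ np). unfold dlogF.
      replace ((arc_start p b c eps - RtoC p) * (arc_start p b c eps - RtoC p) - (RtoC b - RtoC p) * (RtoC c - RtoC p))%C
        with (RtoC 0).
      - unfold Cdiv. ring.
      - unfold arc_start. apply C_ext; simpl; destruct he; subst eps; nra. }
    intros [-> | ->]; apply aux; [left | right]; reflexivity.
Qed.

Lemma arc_start_conj (p b c eps : R) : Cconj (arc_start p b c eps) = arc_start p b c (- eps).
Proof. unfold arc_start. apply C_ext; simpl; ring. Qed.

Lemma unit_vector_scale (k : R) (h : C) : 0 < k ->
  (RtoC k * h / RtoC (Cmod (RtoC k * h)))%C = (h / RtoC (Cmod h))%C.
Proof.
  intros hk. destruct (Ceq_dec h (RtoC 0)) as [-> | h0]; [unfold Cdiv; ring |].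
  rewrite Cmod_mult, Cmod_R, Rabs_pos_eq, RtoC_mult by lra. field. split.
  - intros q. apply h0, Cmod_eq_0. injection q; auto.
  - intros q. injection q; lra.
Qed.

(** The filter and the function [om] are arbitrary because this serves both the explicit
    parametrization and an unknown one, whose [om] is recovered by [arc_parameter]. *)
Lemma arc_limit {T} (F : (T -> Prop) -> Prop) {FF : Filter F} (p b c eps sig : R) (om : T -> R) :
  b < p < c -> is_sign eps -> is_sign sig ->
  F (fun t => 0 < om t < arc_angle p b c eps) -> filterlim om F (locally 0) ->
  filterlim (fun t => arc p b c eps sig (om t)) F (locally (arc_start p b c eps)) /\
  filterlim (fun t => (arc p b c eps sig (om t) - arc_start p b c eps) /
                      RtoC (Cmod (arc p b c eps sig (om t) - arc_start p b c eps)))%C F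
    (locally (arc_dir p b c eps sig)).
Proof.
  intros h he hs hev hlim. destruct (arc_angle_spec p b c eps h he) as [hphi _].
  set (phi := arc_angle p b c eps) in *.
  assert (hsin : 0 < sin phi) by (apply sin_gt_0; lra).
  assert (hsq1 : filterlim (fun t => sqrt (sin (om t))) F (locally 0)).
  { rewrite <- sqrt_0, <- sin_0. apply (filterlim_R_comp F sqrt (fun t => sin (om t))).
    - apply continuity_pt_sqrt. rewrite sin_0. lra.
    - apply (filterlim_R_comp F sin); [reg | exact hlim]. }
  assert (hsub : filterlim (fun t => phi - om t) F (locally phi)).
  { rewrite <- (Rminus_0_r phi) at 1. apply (filterlim_R_comp F (fun x => phi - x)); [reg | exact hlim]. }
  assert (hsq2 : filterlim (fun t => sqrt (sin (phi - om t))) F (locally (sqrt (sin phi)))).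
  { apply (filterlim_R_comp F sqrt (fun t => sin (phi - om t))).
    - apply continuity_pt_sqrt. lra.
    - apply (filterlim_R_comp F sin); [reg | exact hsub]. }
  assert (hsec : filterlim (fun t => arc_secant p b c eps sig (om t)) F
            (locally (RtoC (sig * sqrt (sin phi)) * cis (- (phi / 2)))%C)).
  { replace (RtoC (sig * sqrt (sin phi)) * cis (- (phi / 2)))%C with
      (RtoC (eps * 0) * Ci * cis (0 - phi) + RtoC (sig * sqrt (sin phi)) * cis (0 - phi / 2))%C.
    2:{ rewrite !Rminus_0_l, Rmult_0_r. ring. }
    unfold arc_secant. fold phi. limit.
    - apply (filterlim_R_comp F (fun x => x - phi)); [reg | exact hlim].
    - apply (filterlim_R_comp F (fun x => x - phi / 2)); [reg | exact hlim]. }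
  split.
  - apply (filterlim_ext_loc (fun t => RtoC ((c - b) * sqrt (sin (om t))) * arc_secant p b c eps sig (om t) + arc_start p b c eps)%C).
    { apply (filter_imp _ _) with (2 := hev). intros t ht.
      rewrite <- (arc_secant_spec p b c eps sig (om t) h he ht). ring. }
    replace (arc_start p b c eps) with
      (RtoC ((c - b) * 0) * (RtoC (sig * sqrt (sin phi)) * cis (- (phi / 2))) + arc_start p b c eps)%C at 1
      by (rewrite Rmult_0_r; ring).
    limit.
  - apply (filterlim_ext_loc (fun t => arc_secant p b c eps sig (om t) / RtoC (Cmod (arc_secant p b c eps sig (om t))))%C).
    { apply (filter_imp _ _) with (2 := hev). intros t ht.
      rewrite (arc_secant_spec p b c eps sig (om t) h he ht). rewrite unit_vector_scale; [reflexivity |].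
      apply Rmult_lt_0_compat; [lra |]. apply sqrt_lt_R0, (arc_sin_pos phi); [exact ht | lra]. }
    assert (hsq : 0 < sqrt (sin phi)) by (apply sqrt_lt_R0, hsin).
    assert (hm : Cmod (RtoC (sig * sqrt (sin phi)) * cis (- (phi / 2))) = sqrt (sin phi)).
    { rewrite Cmod_mult, Cmod_cis, Cmod_R, Rmult_1_r, Rabs_mult, (Rabs_pos_eq (sqrt _)) by lra.
      destruct hs; subst sig; [rewrite Rabs_R1 | rewrite Rabs_left by lra]; ring. }
    assert (hnz : RtoC (sqrt (sin phi)) <> RtoC 0) by (intros q; injection q; lra).
    replace (arc_dir p b c eps sig) with ((RtoC (sig * sqrt (sin phi)) * cis (- (phi / 2))) /
       RtoC (Cmod (RtoC (sig * sqrt (sin phi)) * cis (- (phi / 2)))))%C.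
    2:{ rewrite hm. unfold arc_dir. fold phi. rewrite RtoC_mult. field. exact hnz. }
    unfold Cdiv. limit.
    apply filterlim_C_inv; [exact _ | rewrite hm; exact hnz |].
    limit. apply filterlim_Cmod; [exact _ | exact hsec].
Qed.

Lemma tan_half (x : R) : - PI < x < PI -> tan (x / 2) = sin x / (1 + cos x).
Proof.
  intros h. assert (hc : 0 < cos (x / 2)) by (apply cos_gt_0; lra).
  replace x with (2 * (x / 2)) at 2 3 by field. rewrite sin_2a, cos_2a_cos. unfold tan. field.
  split; intros k; nra.
Qed.

(** A continuous inverse of [arc]: for [eps F = (c - b) cis th] the formula
    [tan (th / 2) = sin th / (1 + cos th)] yields [th / 2], and [om = th / 2 + phi / 2]. *)
Definition arc_parameter (p b c eps : R) (z : C) : R :=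
  atan (eps * Im (Frat p b c z) / (c - b + eps * Re (Frat p b c z))) + arc_angle p b c eps / 2.

Lemma arc_parameter_of_level (p b c eps th : R) (z : C) : b < p < c -> is_sign eps -> - PI < th < PI ->
  Frat p b c z = (RtoC (eps * (c - b)) * cis th)%C ->
  arc_parameter p b c eps z = th / 2 + arc_angle p b c eps / 2 /\ 0 < c - b + eps * Re (Frat p b c z).
Proof.
  intros h he hth hF. unfold arc_parameter. rewrite hF. simpl.
  assert (he2 : eps * eps = 1) by (destruct he; subst eps; ring).
  replace (eps * (eps * (c - b) * cos th - 0 * sin th)) with (eps * eps * ((c - b) * cos th)) by ring.
  replace (eps * (eps * (c - b) * sin th + 0 * cos th)) with (eps * eps * ((c - b) * sin th)) by ring.
  rewrite he2, !Rmult_1_l.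
  assert (hc : 0 < 1 + cos th).
  { assert (0 < cos (th / 2)) by (apply cos_gt_0; lra).
    replace (cos th) with (cos (2 * (th / 2))) by (f_equal; field). rewrite cos_2a_cos. nra. }
  split; [| nra]. f_equal. rewrite <- (atan_tan (th / 2)) by lra. f_equal.
  rewrite tan_half by exact hth. field. nra.
Qed.

(** A half-edge may come with any parametrization [g]. Since [arc_parameter] is continuous at the
    zero and has value [0] there, [om] tends to [0] along [g]; thus [g] is the arc reparametrized
    and [arc_limit] gives its direction. *)
Lemma arc_end_direction {T} (F : (T -> Prop) -> Prop) {FF : ProperFilter F} (p b c eps sig : R) (g : T -> C) (u : C) :
  b < p < c -> is_sign eps -> is_sign sig ->
  F (fun t => arcset p b c eps sig (g t)) -> filterlim g F (locally (arc_start p b c eps)) ->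
  filterlim (fun t => (g t - arc_start p b c eps) / RtoC (Cmod (g t - arc_start p b c eps)))%C F (locally u) ->
  u = arc_dir p b c eps sig.
Proof.
  intros h he hs hev hlim hdir. destruct (arc_angle_spec p b c eps h he) as [hphi _].
  set (phi := arc_angle p b c eps) in *.
  assert (hthe : forall om, 0 < om < phi -> arc_parameter p b c eps (arc p b c eps sig om) = om).
  { intros om ho. rewrite (proj1 (arc_parameter_of_level p b c eps (2 * om - phi) _ h he
      ltac:(lra) (proj2 (arc_spec p b c eps sig om h he hs ho)))). fold phi. field. }
  destruct (arc_parameter_of_level p b c eps (- phi) (arc_start p b c eps) h he ltac:(lra)
     (Frat_arc_start p b c eps h he)) as [e0 hden]. fold phi in e0.
  assert (hom : filterlim (fun t => arc_parameter p b c eps (g t)) F (locally 0)).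
  { replace 0 with (arc_parameter p b c eps (arc_start p b c eps)) by (rewrite e0; field).
    pose proof (filterlim_Frat F p b c g _ (arc_start_neq p b c eps h he) hlim) as hFl.
    apply (filterlim_C_iff F) in hFl. destruct hFl as [hF1 hF2].
    unfold arc_parameter. limit.
    apply (filterlim_R_comp F atan (fun t => eps * Im (Frat p b c (g t)) / (c - b + eps * Re (Frat p b c (g t))))).
    { apply derivable_continuous_pt, derivable_pt_atan. }
    unfold Rdiv. limit.
    apply (filterlim_R_comp F Rinv (fun t => c - b + eps * Re (Frat p b c (g t)))); [| limit].
    apply continuity_pt_inv; [reg | lra]. }
  assert (hev1 : F (fun t => 0 < arc_parameter p b c eps (g t) < phi)).
  { apply (filter_imp _ _) with (2 := hev). intros t ht. apply arcset_iff in ht. destruct ht as [om [ho ->]].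
    rewrite (hthe om ho). exact ho. }
  destruct (arc_limit F p b c eps sig _ h he hs hev1 hom) as [_ hd].
  apply (filterlim_locally_unique (V := prod_NormedModule R_AbsRing R_NormedModule R_NormedModule) _ _ _ hdir).
  apply (filterlim_ext_loc (fun t => (arc p b c eps sig (arc_parameter p b c eps (g t)) - arc_start p b c eps) /
         RtoC (Cmod (arc p b c eps sig (arc_parameter p b c eps (g t)) - arc_start p b c eps)))%C); [| exact hd].
  apply (filter_imp _ _) with (2 := hev). intros t ht. apply arcset_iff in ht. destruct ht as [om [ho ->]].
  rewrite (hthe om ho). reflexivity.
Qed.

Lemma arc_hedges f ps (p b c eps sig : R) : b < p < c -> is_sign eps -> is_sign sig ->
  log_square f ps p b c ->
  hedge_of f ps (arc_start p b c eps) (arc_dir p b c eps sig) (arcset p b c eps sig) /\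
  hedge_of f ps (Cconj (arc_start p b c eps)) (Cconj (arc_dir p b c eps sig)) (arcset p b c eps sig).
Proof.
  intros h he hs hq. destruct (arc_angle_spec p b c eps h he) as [hphi _].
  destruct (arc_horiz f ps p b c eps sig h he hs hq) as [u1 u2].
  set (phi := arc_angle p b c eps) in *. pose proof PI_RGT_0 as hpi.
  set (t0 := - (phi / (2 * PI))) in *.
  assert (hlt : Rbar_lt t0 (phi / (2 * PI))) by apply u1.
  destruct (arc_limit (at_right t0) p b c eps sig (fun t => PI * t + phi / 2) h he hs) as [l1 l2].
  { apply (filter_imp _ _) with (2 := at_right_in_int t0 _ hlt). intros t. apply arc_time. }
  { replace 0 with (PI * t0 + phi / 2) by (unfold t0; field; lra).
    assert (k : continuity_pt (fun t => PI * t + phi / 2) t0) by reg.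
    apply continuity_pt_filterlim in k. intros P hP. apply (filter_le_within _ (F := locally t0)), k, hP. }
  assert (hz : forall e, is_sign e -> is_zero f ps (arc_start p b c e)).
  { intros e ee. apply is_zero_log_square with (1 := h) (2 := hq). destruct ee; subst e; auto. }
  split.
  - split; [apply arcset_is_traj; auto | split; [apply hz, he |]].
    exists (fun t => arc p b c eps sig (PI * t + phi / 2)), t0, (Finite (phi / (2 * PI))).
    split; [exact u1 | split; [intros z; apply iff_refl | split; assumption]].
  - split; [apply arcset_is_traj; auto | split].
    { rewrite arc_start_conj. apply hz. destruct he; subst eps; [right | left]; ring. }
    exists (fun t => Cconj (arc p b c eps sig (PI * t + phi / 2))), t0, (Finite (phi / (2 * PI))).
    split; [exact u2 | split; [| split]].
    + intros z. split.
      * intros [t [it <-]]. apply arcset_conj. exists t. auto.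
      * intros k. apply arcset_conj in k. destruct k as [t [it e]]. exists t. split; [exact it |].
        fold phi in e. rewrite e. apply Cconj_conj.
    + apply filterlim_C_conj; [exact _ | exact l1].
    + apply filterlim_C_conj in l2; [| exact _].
      apply (filterlim_ext (fun t => Cconj ((arc p b c eps sig (PI * t + phi / 2) - arc_start p b c eps) /
         RtoC (Cmod (arc p b c eps sig (PI * t + phi / 2) - arc_start p b c eps))))); [| exact l2].
      intros t. rewrite <- Cminus_conj, Cmod_conj. unfold Cdiv. rewrite Cmult_conj.
      f_equal. set (m := Cmod _). apply C_ext; simpl; unfold Rdiv; ring.
Qed.

(** Along a half-edge [|F|] is constant and tends to its value [c - b] at the zero, which puts the
    trajectory on the critical level. The zero is then the start of an arc or, by conjugation, its
    other end. *)
Lemma hedge_classification f ps (p b c : R) (z u : C) : b < p < c -> log_square f ps p b c ->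
  hedge f ps (z, u) ->
  exists eps sig, is_sign eps /\ is_sign sig /\
    ((z = arc_start p b c eps /\ u = arc_dir p b c eps sig) \/
     (z = Cconj (arc_start p b c eps) /\ u = Cconj (arc_dir p b c eps sig))).
Proof.
  intros h hq [S [hS [hz [g [a [e [[hg _] [hsame [hlim hdir]]]]]]]]]. simpl in hz, hlim, hdir.
  assert (hz' : exists e0, is_sign e0 /\ z = arc_start p b c e0).
  { apply (is_zero_log_square f ps p b c z h hq) in hz.
    destruct hz; [exists 1 | exists (-1)]; split; trivial; [left | right]; reflexivity. }
  destruct hz' as [e0 [he0 ->]].
  assert (hae : Rbar_lt a e) by apply hg.
  pose proof (at_right_in_int a e hae) as hin.
  destruct (filter_ex _ hin) as [t0 it0].
  assert (hF0 : Cmod (Frat p b c (g t0)) = c - b).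
  { pose proof (filterlim_Cmod (at_right a) _ _ (filterlim_Frat (at_right a) p b c g _ (arc_start_neq p b c e0 h he0) hlim)) as k.
    rewrite (Frat_arc_start p b c e0 h he0), Cmod_mult, Cmod_cis, Cmod_R, Rmult_1_r, Rabs_mult, (Rabs_pos_eq (c - b)) in k by lra.
    replace (Rabs e0 * (c - b)) with (c - b) in k
      by (destruct he0; subst e0; [rewrite Rabs_R1 | rewrite Rabs_left by lra]; ring).
    apply (filterlim_locally_unique (V := R_NormedModule) (F := at_right a) (fun t => Cmod (Frat p b c (g t0)))).
    - apply filterlim_const.
    - apply (filterlim_ext_loc (fun t => Cmod (Frat p b c (g t)))); [| exact k].
      apply (filter_imp _ _) with (2 := hin). intros t it.
      apply (horiz_Cmod_constant f ps p b c g a e); auto. }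
  assert (hS0 : S (g t0)) by (apply hsame; exists t0; auto).
  destruct (critical_traj_is_arc f ps p b c S (g t0) h hq hS hS0 hF0) as [eps [sig [he [hs hSA]]]].
  assert (hev : at_right a (fun t => arcset p b c eps sig (g t))).
  { apply (filter_imp _ _) with (2 := hin). intros t it. apply hSA, hsame. exists t. auto. }
  exists eps, sig. split; [exact he | split; [exact hs |]].
  destruct (Req_dec e0 eps) as [-> | ne].
  - left. split; [reflexivity |]. apply (arc_end_direction (at_right a) p b c eps sig g u); auto.
  - right. assert (e0 = - eps) by (destruct he, he0; subst; lra). subst e0.
    rewrite <- arc_start_conj in *. split; [reflexivity |].
    rewrite <- (Cconj_conj u). f_equal.
    apply (arc_end_direction (at_right a) p b c eps sig (fun t => Cconj (g t))); auto.
    + apply (filter_imp _ _) with (2 := hev). intros t. apply arcset_conj.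
    + rewrite <- (Cconj_conj (arc_start p b c eps)). apply filterlim_C_conj; [exact _ | exact hlim].
    + apply filterlim_C_conj in hdir; [| exact _].
      apply (filterlim_ext (fun t => Cconj ((g t - Cconj (arc_start p b c eps)) /
         RtoC (Cmod (g t - Cconj (arc_start p b c eps)))))%C); [| exact hdir].
      intros t. rewrite <- (Cconj_conj (arc_start p b c eps)) at 3 4.
      rewrite <- Cminus_conj, Cmod_conj. unfold Cdiv. rewrite Cmult_conj.
      f_equal. set (m := Cmod _). apply C_ext; simpl; unfold Rdiv; ring.
Qed.

Lemma arc_length f ps (p b c eps sig : R) : b < p < c -> is_sign eps -> is_sign sig ->
  log_square f ps p b c -> edge_len f ps (arcset p b c eps sig) (arc_angle p b c eps / PI).
Proof.
  intros h he hs hq. do 3 eexists. split; [apply (proj1 (arc_horiz f ps p b c eps sig h he hs hq)) | split].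
  - intros z. apply iff_refl.
  - field. apply PI_neq0.
Qed.

(** * Closed trajectories in the real case *)

Lemma pow2_inj_pos (x y : R) : 0 <= x -> 0 <= y -> x ^ 2 = y ^ 2 -> x = y.
Proof.
  intros hx hy h. rewrite <- (Rabs_pos_eq x), <- (Rabs_pos_eq y) by assumption.
  apply Rsqr_eq_abs_0. unfold Rsqr. lra.
Qed.

Definition rect_area (q : (R * R) * (R * R)) : R := (snd (fst q) - fst (fst q)) * (snd (snd q) - fst (snd q)).

Definition rect_ok (q : (R * R) * (R * R)) : Prop := fst (fst q) <= snd (fst q) /\ fst (snd q) <= snd (snd q).

Definition in_rect (q : (R * R) * (R * R)) (z : C) : Prop :=
  fst (fst q) <= Re z <= snd (fst q) /\ fst (snd q) <= Im z <= snd (snd q).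

Definition total_area (l : list ((R * R) * (R * R))) : R := fold_right (fun q s => rect_area q + s) 0 l.

(** Finite covers are joined by concatenation. The infinite sequence asked for by [null2] is
    obtained by padding with a rectangle of area [0]. *)
Definition finite_null (A : C -> Prop) : Prop :=
  forall eps, 0 < eps -> exists l, (forall q, In q l -> rect_ok q) /\
    (forall z, A z -> exists q, In q l /\ in_rect q z) /\ total_area l <= eps.

Lemma rect_area_pos q : rect_ok q -> 0 <= rect_area q.
Proof. intros [h1 h2]. apply Rmult_le_pos; lra. Qed.

Lemma total_area_app l l' : total_area (l ++ l') = total_area l + total_area l'.
Proof. induction l as [| q l IH]; simpl; [ring | unfold total_area in *; simpl; rewrite IH; ring]. Qed.

Lemma finite_null_union (A B : C -> Prop) :
  finite_null A -> finite_null B -> finite_null (fun z => A z \/ B z).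
Proof.
  intros hA hB eps he. destruct (hA (eps / 2)) as [l [l1 [l2 l3]]]; [lra |].
  destruct (hB (eps / 2)) as [k [k1 [k2 k3]]]; [lra |]. exists (l ++ k). split; [| split].
  - intros q hq. apply in_app_iff in hq. destruct hq; auto.
  - intros z [hz | hz]; [destruct (l2 z hz) as [q [q1 q2]] | destruct (k2 z hz) as [q [q1 q2]]];
      exists q; rewrite in_app_iff; auto.
  - rewrite total_area_app. lra.
Qed.

Lemma sum_nth_le_total l : (forall q, In q l -> rect_ok q) -> forall N,
  sum_f_R0 (fun n => rect_area (nth n l ((0, 0), (0, 0)))) N <= total_area l.
Proof.
  induction l as [| q l IH]; intros hl N.
  - rewrite (sum_eq _ (fun _ => 0)).
    + rewrite sum_cte. unfold total_area. simpl. lra.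
    + intros i _. destruct i; unfold rect_area; simpl; ring.
  - assert (hq : 0 <= rect_area q) by (apply rect_area_pos, hl; left; reflexivity).
    assert (hl' : forall q, In q l -> rect_ok q) by (intros; apply hl; right; assumption).
    destruct N as [| N].
    + simpl. unfold total_area. simpl. fold (total_area l).
      assert (0 <= total_area l); [| lra].
      clear - hl'. induction l as [| q l IH]; unfold total_area; simpl; [lra |]. fold (total_area l).
      assert (0 <= rect_area q) by (apply rect_area_pos, hl'; left; reflexivity).
      assert (0 <= total_area l) by (apply IH; intros; apply hl'; right; assumption). lra.
    + rewrite decomp_sum by lia. simpl. unfold total_area. simpl. fold (total_area l).
      specialize (IH hl' N). simpl in IH. lra.
Qed.

Lemma null2_of_finite_null (A : C -> Prop) : finite_null A -> null2 A.
Proof.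
  intros h eps he. destruct (h eps he) as [l [l1 [l2 l3]]].
  set (q := fun n => nth n l ((0, 0), (0, 0))).
  exists (fun n => fst (fst (q n))), (fun n => snd (fst (q n))), (fun n => fst (snd (q n))), (fun n => snd (snd (q n))).
  split; [| split].
  - intros n. unfold q. destruct (nth_in_or_default n l ((0, 0), (0, 0))) as [k | k].
    + apply (l1 _ k).
    + rewrite k. simpl. lra.
  - intros z hz. destruct (l2 z hz) as [r [r1 r2]]. destruct (In_nth l r ((0, 0), (0, 0)) r1) as [n [_ e]].
    exists n. unfold q. rewrite e. exact r2.
  - intros N. apply Rle_trans with (2 := l3). apply (sum_nth_le_total l l1 N).
Qed.

Lemma null2_subset (A B : C -> Prop) : (forall z, A z -> B z) -> null2 B -> null2 A.
Proof.
  intros hs h eps he. destruct (h eps he) as [x1 [x2 [y1 [y2 [q1 [q2 q3]]]]]].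
  exists x1, x2, y1, y2. auto.
Qed.

Lemma cis_lipschitz (x y : R) : Rabs (cos x - cos y) <= Rabs (x - y) /\ Rabs (sin x - sin y) <= Rabs (x - y).
Proof.
  split.
  - rewrite <- (Rmult_1_l (Rabs (x - y))). apply (bounded_variation cos (fun t => - sin t)). intros t _. split.
    + auto_derive; trivial; ring.
    + rewrite Rabs_Ropp. apply Rabs_le, SIN_bound.
  - rewrite <- (Rmult_1_l (Rabs (x - y))). apply (bounded_variation sin cos). intros t _. split.
    + auto_derive; trivial; ring.
    + apply Rabs_le, COS_bound.
Qed.

Lemma finite_null_circle (k rho : R) : 0 <= rho -> finite_null (fun z => Cmod (z - RtoC k) = rho).
Proof.
  intros hrho eps he. pose proof PI_RGT_0 as hpi.
  (* At most [2 N] boxes of area [4 rho^2 h^2] with [h = 2 PI / N] have total area at most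
     [32 PI^2 rho^2 / N], which is below [eps] once [N > A]. *)
  set (A := 32 * PI ^ 2 * rho ^ 2 / eps).
  assert (hA : 0 <= A) by (apply Rdiv_le_0_compat; nra).
  destruct (nfloor_ex A hA) as [n [_ hn]]. set (N := INR n + 1) in *.
  assert (hN : 1 <= N) by (unfold N; pose proof (pos_INR n); lra).
  set (h := 2 * PI / N). assert (hh : 0 < h) by (apply Rdiv_lt_0_compat; lra).
  set (box := fun j : nat => ((k + rho * (cos (- PI + INR j * h) - h), k + rho * (cos (- PI + INR j * h) + h)),
                              (rho * (sin (- PI + INR j * h) - h), rho * (sin (- PI + INR j * h) + h)))).
  (* One box more than [N = n + 1], because the angle [th = PI] has index [N]. *)
  exists (map box (seq 0 (n + 2))). split; [| split].
  - intros q hq. apply in_map_iff in hq. destruct hq as [j [<- _]]. unfold rect_ok, box. simpl. split; nra.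
  - intros z hz. destruct (polar (z - RtoC k)) as [th [hth e]]. rewrite hz in e.
    assert (ht : 0 <= (th + PI) / h) by (apply Rdiv_le_0_compat; lra).
    destruct (nfloor_ex _ ht) as [j [j1 j2]].
    assert (e2 : (th + PI) / h * h = th + PI) by (field; lra).
    assert (j3 : INR j * h <= th + PI < (INR j + 1) * h) by (rewrite <- e2; split; nra).
    exists (box j). split.
    + apply in_map, in_seq. split; [lia |].
      assert (INR j < INR (0 + (n + 2))); [| apply INR_lt; assumption].
      rewrite plus_INR, plus_INR. simpl. apply Rle_lt_trans with N; [| unfold N; lra].
      apply Rmult_le_reg_r with h; [exact hh |]. replace (N * h) with (2 * PI) by (unfold h; field; lra). lra.
    + destruct (cis_lipschitz th (- PI + INR j * h)) as [c1 c2].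
      assert (hd : Rabs (th - (- PI + INR j * h)) <= h) by (apply Rabs_le; lra).
      assert (c1' := Rle_trans _ _ _ c1 hd). assert (c2' := Rle_trans _ _ _ c2 hd).
      apply Rabs_le_between in c1'. apply Rabs_le_between in c2'.
      destruct z as [x y]. injection e. intros e4 e3. unfold in_rect, box. simpl in *.
      assert (x = k + rho * cos th) by lra. assert (y = rho * sin th) by lra. subst x y.
      split; split; nra.
  - assert (harea : forall j, rect_area (box j) = 4 * rho ^ 2 * h ^ 2) by (intros j; unfold rect_area, box; simpl; ring).
    assert (htot : forall l, total_area (map box l) = INR (length l) * (4 * rho ^ 2 * h ^ 2)).
    { induction l as [| j l IH]; [simpl; unfold total_area; simpl; ring |].
      change (total_area (map box (j :: l))) with (rect_area (box j) + total_area (map box l)).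
      rewrite IH, harea. change (length (j :: l)) with (S (length l)). rewrite S_INR. ring. }
    rewrite htot, length_seq, plus_INR. simpl (INR 2).
    apply Rle_trans with (2 * N * (4 * rho ^ 2 * h ^ 2)).
    + apply Rmult_le_compat_r; [apply Rmult_le_pos; nra |]. unfold N in *. pose proof (pos_INR n). lra.
    + unfold h. replace (2 * N * (4 * rho ^ 2 * (2 * PI / N) ^ 2)) with (32 * PI ^ 2 * rho ^ 2 / N) by (field; lra).
      apply Rmult_le_reg_r with N; [lra |]. unfold Rdiv at 1. rewrite Rmult_assoc, Rinv_l, Rmult_1_r by lra.
      apply Rmult_le_reg_r with (/ eps); [apply Rinv_0_lt_compat, he |].
      replace (eps * N * / eps) with N by (field; lra). unfold A in hn. unfold Rdiv in hn. lra.
Qed.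

(* The critical graph is the union of the circles [conic b p c = 0] and [conic c p b = 0] centred at the zeros [b], [c] of [F]. *)
Definition conic (b p c : R) (z : C) : R := (Re z - b) ^ 2 + Im z ^ 2 - (p - b) * (c - b).

(** Off [p] the right-hand side is [(|F|^2 - (c - b)^2) |z - p|^2]. So the critical level is where
    one of the conics vanishes, and on any other level neither does. *)
Lemma conic_product (b p c : R) (z : C) :
  conic b p c z * conic c p b z = Cmod (z - RtoC b) ^ 2 * Cmod (z - RtoC c) ^ 2 - (c - b) ^ 2 * Cmod (z - RtoC p) ^ 2.
Proof. rewrite !Cmod_sqr. unfold conic. destruct z as [x y]. simpl. ring. Qed.

Lemma Cmod_Frat_sqr (p b c z : C) : z <> p ->
  Cmod (z - b) ^ 2 * Cmod (z - c) ^ 2 = Cmod (Frat p b c z) ^ 2 * Cmod (z - p) ^ 2.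
Proof.
  intros h. apply Cminus_neq_zero in h. rewrite <- !Rpow_mult_distr, <- !Cmod_mult. do 2 f_equal.
  unfold Frat. field. exact h.
Qed.

(* The deck involution [z -> p + (b - p) (c - p) / (z - p)] of [F] exchanges the inside and the outside of the circle. *)
Lemma conic_involution (b p c : R) (z z' : C) : b < p < c ->
  ((z - RtoC p) * (z' - RtoC p))%C = ((RtoC b - RtoC p) * (RtoC c - RtoC p))%C ->
  0 < conic b p c z * conic b p c z' -> False.
Proof.
  intros h e hp. destruct z as [x y], z' as [x' y']. injection e. unfold conic in hp. simpl in *.
  set (X := x + - p) in *. set (X' := x' + - p) in *.
  replace (x - b) with (X + (p - b)) in hp by (unfold X; ring).
  replace (x' - b) with (X' + (p - b)) in hp by (unfold X'; ring).
  clearbody X X'. clear e. intros e2 e1.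
  set (u := p - b) in *. set (v := c - p) in *.
  replace (c - b) with (u + v) in hp by (unfold u, v; ring).
  assert (e1' : X * X' - y * y' = - (u * v)) by (unfold u, v; lra).
  assert (e2' : X * y' + y * X' = 0) by lra.
  assert (hu : 0 < u) by (unfold u; lra). assert (hv : 0 < v) by (unfold v; lra).
  clearbody u v. clear e1 e2 h.
  set (n := X * X + y * y).
  assert (f1 : n * X' = - (u * v) * X) by (unfold n; clear - e1' e2'; nsatz).
  assert (f2 : n * y' = u * v * y) by (unfold n; clear - e1' e2'; nsatz).
  assert (hn : 0 < n).
  { unfold n. destruct (Req_dec X 0) as [-> |]; [| nra]. destruct (Req_dec y 0) as [-> |]; [| nra].
    exfalso. assert (0 < u * v) by (apply Rmult_lt_0_compat; assumption). lra. }
  set (U := n + 2 * u * X - u * v).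
  assert (hU : (X + u) * ((X + u) * 1) + y * (y * 1) - u * (u + v) = U) by (unfold U, n; ring).
  assert (hU' : n * ((X' + u) * ((X' + u) * 1) + y' * (y' * 1) - u * (u + v)) = - (u * v) * U).
  { apply Rmult_eq_reg_l with n; [| lra].
    transitivity ((n * X') * (n * X') + 2 * u * n * (n * X') + (n * y') * (n * y') - n * n * (u * v)); [ring |].
    rewrite f1, f2. unfold U, n. ring. }
  rewrite hU in hp. assert (hp' := Rmult_lt_0_compat _ _ hn hp).
  replace (n * (U * ((X' + u) * ((X' + u) * 1) + y' * (y' * 1) - u * (u + v))))
    with (U * (n * ((X' + u) * ((X' + u) * 1) + y' * (y' * 1) - u * (u + v)))) in hp' by ring.
  rewrite hU' in hp'. assert (0 <= (u * v) * (U * U)); [| lra].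
  apply Rmult_le_pos; [apply Rmult_le_pos; lra | apply Rle_0_sqr].
Qed.

Lemma filterlim_conic {T} (F : (T -> Prop) -> Prop) {FF : Filter F} (b p c : R) (g : T -> C) (z : C) :
  filterlim g F (locally z) -> filterlim (fun t => conic b p c (g t)) F (locally (conic b p c z)).
Proof.
  intros h. apply (filterlim_C_iff F) in h. destruct h as [h1 h2]. unfold conic.
  unfold Rminus. limit.
  - apply (filterlim_R_comp F (fun x => (x + - b) ^ 2) (fun t => Re (g t))); [reg | exact h1].
  - apply (filterlim_R_comp F (fun x => x ^ 2) (fun t => Im (g t))); [reg | exact h2].
Qed.

(** Both critical values have modulus [c - b], so they are inside the circle of radius [r] together
    or not at all, and the discriminant has a [2 PI]-periodic root. The level consists of two closed
    curves, exchanged by the deck involution and told apart by the sign of the conic. *)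
Lemma noncritical_curve f ps (p b c : R) (z0 : C) : b < p < c -> log_square f ps p b c ->
  z0 <> RtoC p -> z0 <> RtoC b -> z0 <> RtoC c -> Cmod (Frat p b c z0) <> c - b ->
  exists S, closed_traj f ps S /\ forall z, S z <->
    z <> RtoC p /\ Cmod (Frat p b c z) = Cmod (Frat p b c z0) /\ 0 < conic b p c z * conic b p c z0.
Proof.
  intros h hq n0 nb nc hR. set (r := Cmod (Frat p b c z0)) in *.
  assert (hr : 0 < r).
  { apply Cmod_gt_0. intros k. destruct (Frat_zero p b c z0 n0 k); contradiction. }
  assert (npb : RtoC p <> RtoC b) by (intros k; injection k; lra).
  assert (npc : RtoC p <> RtoC c) by (intros k; injection k; lra).
  assert (hconic : forall z, z <> RtoC p -> Cmod (Frat p b c z) = r -> conic b p c z <> 0).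
  { intros z hz hF k. pose proof (conic_product b p c z) as q. rewrite k, Rmult_0_l in q.
    rewrite (Cmod_Frat_sqr p b c z hz), hF in q.
    assert (0 < Cmod (z - RtoC p)) by (apply Cmod_gt_0, Cminus_neq_zero, hz).
    assert (q' : (r ^ 2 - (c - b) ^ 2) * Cmod (z - RtoC p) ^ 2 = 0) by lra.
    destruct (Rmult_integral _ _ q') as [q2 | q2]; [| nra].
    apply hR. assert (0 < c - b) by lra. nra. }
  assert (h0 : conic b p c z0 <> 0) by (apply hconic; auto).
  set (dl := half_gap p b c). set (e := (b - p) + (c - p)).
  assert (hdl : dl * dl = (p - b) * (c - p)) by (apply half_gap_sqr, h).
  assert (hv : forall k : R, k = 2 * dl \/ k = - (2 * dl) -> Cmod (- e, k) = c - b).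
  { intros k hk. pose proof (Cmod_ge_0 (- e, k)). pose proof (Cmod_sqr (- e, k)) as q. simpl in q.
    assert ((c - b) ^ 2 = e * e + k * k) by (unfold e; destruct hk; subst k; nra). nra. }
  destruct (discriminant_path p b c (- e, 2 * dl) (- e, - (2 * dl)) r) as [s hs]; auto.
  { apply C_ext; simpl; unfold e; ring. }
  { apply C_ext; simpl; unfold e; nra. }
  { rewrite hv by auto. auto. }
  { rewrite hv by auto. auto. }
  assert (hmono : monodromy (- e, 2 * dl) r * monodromy (- e, - (2 * dl)) r = 1).
  { unfold monodromy. rewrite !hv by auto. destruct (Rlt_dec (c - b) r); ring. }
  rewrite hmono in hs.
  destruct (polar (Frat p b c z0)) as [th0 [_ hth0]]. fold r in hth0.
  (* The sign of the root is chosen so that the curve passes through [z0]. *)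
  assert (hbranch : exists s : R -> C,
    (forall th : R, ex_derive s th /\
     (s th * s th)%C = ((RtoC r * cis th + (RtoC b - RtoC p) + (RtoC c - RtoC p)) *
        (RtoC r * cis th + (RtoC b - RtoC p) + (RtoC c - RtoC p)) - 4 * ((RtoC b - RtoC p) * (RtoC c - RtoC p)))%C /\
     s (th + 2 * PI) = s th) /\
    z0 = (RtoC p + (RtoC r * cis th0 + (RtoC b - RtoC p) + (RtoC c - RtoC p) + s th0) / 2)%C).
  { destruct (Frat_root_inv p b c _ (s th0) z0 n0 hth0 (proj1 (proj2 (hs th0)))) as [k | k].
    - exists s. split; [| exact k]. intros th. destruct (hs th) as [a1 [a2 a3]].
      split; [exact a1 | split; [exact a2 | rewrite a3; ring]].
    - exists (fun th => - s th)%C. split; [| rewrite k; reflexivity]. intros th. destruct (hs th) as [[d a1] [a2 a3]].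
      split; [eexists; apply is_derive_C_opp, a1 | split].
      + rewrite <- a2. ring.
      + rewrite a3. ring. }
  clear s hs. destruct hbranch as [s [hs hz0]].
  set (g := fun th => (RtoC p + (RtoC r * cis th + (RtoC b - RtoC p) + (RtoC c - RtoC p) + s th) / 2)%C).
  assert (hg : forall th : R, g th <> RtoC p /\ Frat p b c (g th) = (RtoC r * cis th)%C).
  { intros th. apply (Frat_root p b c (RtoC r * cis th) (s th) npb npc), hs. }
  assert (hgd : forall th : R, ex_derive g th).
  { intros th. apply ex_derive_root, hs. }
  assert (hgr : forall th, Cmod (Frat p b c (g th)) = r).
  { intros th. rewrite (proj2 (hg th)), Cmod_mult, Cmod_cis, Cmod_R, Rabs_pos_eq; lra. }
  assert (hgU : forall th, 0 < conic b p c (g th) * conic b p c z0).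
  { intros th. rewrite Rmult_comm. apply (int_same_sign (fun th => conic b p c (g th)) m_infty p_infty) with th0.
    - intros t _. split; [| apply hconic; [apply hg | apply hgr]].
      apply filterlim_conic; [exact _ |]. apply (ex_derive_continuous g), hgd.
    - apply in_int_all.
    - apply in_int_all.
    - unfold g. rewrite <- hz0. destruct (Rtotal_order (conic b p c z0) 0) as [k | [k | k]]; [nra | contradiction | nra]. }
  assert (himg : forall z, img g m_infty p_infty z <-> z <> RtoC p /\ Cmod (Frat p b c z) = r /\ 0 < conic b p c z * conic b p c z0).
  { intros z. split.
    - intros [th [_ <-]]. split; [apply hg | split; [apply hgr | apply hgU]].
    - intros [k1 [k2 k3]]. destruct (polar (Frat p b c z)) as [th [_ hth]]. rewrite k2 in hth.
      exists th. split; [apply in_int_all |].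
      destruct (Frat_root_inv p b c _ (s th) z k1 hth (proj1 (proj2 (hs th)))) as [k | k]; [symmetry; exact k |].
      (* The other root over the same value of [F] is the image of [g th] under the deck involution,
         where the conic has the opposite sign. *)
      exfalso. apply (conic_involution b p c z (g th) h).
      + unfold g. rewrite k. destruct (hs th) as [_ [e2 _]].
        transitivity (((RtoC r * cis th + (RtoC b - RtoC p) + (RtoC c - RtoC p)) *
          (RtoC r * cis th + (RtoC b - RtoC p) + (RtoC c - RtoC p)) - s th * s th) / 4)%C; [field |].
        rewrite e2. field.
      + pose proof (hgU th) as k4. destruct (Rtotal_order (conic b p c z0) 0) as [q | [q | q]]; [nra | contradiction | nra]. }
  exists (img g m_infty p_infty). split; [| exact himg].
  apply (closed_traj_of_level_param f ps p b c g r (2 * PI)); auto.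
  - pose proof PI_RGT_0; lra.
  - intros th. split; [apply hg | split; [apply hgd | split; [apply hg |]]].
    unfold g. rewrite cis_2PI. destruct (hs th) as [_ [_ ->]]. reflexivity.
  - intros q a e0 hh [t1 [i1 j1]] t it. apply himg in j1. apply himg.
    pose proof (horiz_regular f ps p b c q a e0 hq hh) as hreg.
    assert (hl : forall t, Defs.in_int a e0 t -> Cmod (Frat p b c (q t)) = r).
    { intros t' it'. rewrite <- (proj1 (proj2 j1)). apply (horiz_Cmod_constant f ps p b c q a e0); auto. }
    split; [apply (hreg t it) | split; [apply hl, it |]].
    rewrite Rmult_comm. apply (int_same_sign (fun t => conic b p c (q t)) a e0) with t1; auto.
    + intros t' it'. destruct (hreg t' it') as [m1 [_ [_ [mc _]]]]. split; [| apply hconic; auto].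
      apply filterlim_conic; [exact _ | exact mc].
    + rewrite Rmult_comm. apply j1.
Qed.

Lemma periodic_representative (g : R -> C) (T : R) : 0 < T -> (forall t, g (t + T) = g t) ->
  forall t, exists t', 0 <= t' <= T /\ g t' = g t.
Proof.
  intros hT hg.
  assert (hn : forall n t, g (t + INR n * T) = g t).
  { induction n as [| n IH]; intros t; [f_equal; simpl; ring |].
    rewrite S_INR. replace (t + (INR n + 1) * T) with ((t + INR n * T) + T) by ring. rewrite hg. apply IH. }
  intros t. destruct (Rle_dec 0 t) as [h | h].
  - assert (ht : 0 <= t / T) by (apply Rdiv_le_0_compat; lra).
    destruct (nfloor_ex _ ht) as [n [h1 h2]]. assert (e : t / T * T = t) by (field; lra).
    exists (t - INR n * T). split; [nra |]. rewrite <- (hn n). f_equal. ring.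
  - assert (ht : 0 <= - t / T) by (apply Rdiv_le_0_compat; lra).
    destruct (nfloor_ex _ ht) as [n [h1 h2]]. assert (e : - t / T * T = - t) by (field; lra).
    exists (t + INR (S n) * T). rewrite S_INR. split; [nra |]. rewrite <- S_INR. apply hn.
Qed.

(* A closed trajectory is compact and misses the zeros, whereas every arc of the critical graph accumulates at a zero. *)
Lemma closed_traj_noncritical f ps (p b c : R) (S : C -> Prop) (z : C) : b < p < c ->
  log_square f ps p b c -> closed_traj f ps S -> S z -> Cmod (Frat p b c z) <> c - b.
Proof.
  intros h hq [hS [g [T [hT [hg [hper hsame]]]]]] hz hF.
  destruct (critical_traj_is_arc f ps p b c S z h hq hS hz hF) as [eps [sig [he [hs hSA]]]].
  destruct (arc_hedges f ps p b c eps sig h he hs hq) as [[_ [hz0 [k [a [e [[hk _] [hksame [klim _]]]]]]]] _].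
  set (z0 := arc_start p b c eps) in *.
  pose proof (horiz_regular f ps p b c g m_infty p_infty hq hg) as hreg.
  destruct (continuity_ab_min (fun t => Cmod (g t - z0)) 0 T) as [tm [hmin htm]]; [lra | |].
  { intros t _. apply continuity_pt_filterlim. apply (filterlim_Cmod (locally t)). unfold Cminus.
    limit. apply (hreg t (in_int_all t)). }
  assert (hpos : 0 < Cmod (g tm - z0)).
  { apply Cmod_gt_0, Cminus_neq_zero. intros q.
    destruct hg as [_ hg]. destruct (hg tm (in_int_all tm)) as [_ [d [_ [_ hre]]]].
    rewrite q, (proj2 hz0) in hre. simpl in hre. lra. }
  assert (hev : at_right a (fun t => Cmod (k t - z0) < Cmod (g tm - z0))).
  { assert (kl : filterlim (fun t => Cmod (k t - z0)) (at_right a) (locally 0)).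
    { rewrite <- Cmod_0. replace (RtoC 0) with (z0 - z0)%C by ring.
      apply filterlim_Cmod; [exact _ |]. unfold Cminus.
      limit. }
    apply (kl (fun x => x < Cmod (g tm - z0))). apply (open_lt (Cmod (g tm - z0))). exact hpos. }
  pose proof (at_right_in_int a e (proj1 hk)) as hin.
  destruct (filter_ex _ (filter_and _ _ hev hin)) as [t [t1 t2]].
  assert (hSk : S (k t)) by (apply hSA, hksame; exists t; auto).
  apply hsame in hSk. destruct hSk as [t3 [_ e3]].
  destruct (periodic_representative g T hT hper t3) as [t4 [i4 e4]].
  pose proof (hmin t4 i4) as hm. simpl in hm. rewrite e4, e3 in hm. lra.
Qed.

Lemma filterlim_R_max {T} (F : (T -> Prop) -> Prop) {FF : Filter F} (f g : T -> R) (x y : R) :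
  filterlim f F (locally x) -> filterlim g F (locally y) ->
  filterlim (fun t => Rmax (f t) (g t)) F (locally (Rmax x y)).
Proof.
  intros h k.
  assert (e : forall x y, Rmax x y = (x + y + Rabs (x + - y)) * / 2).
  { intros u v. destruct (Rle_dec u v).
    - rewrite Rmax_right, Rabs_left1 by lra. field.
    - rewrite Rmax_left, Rabs_pos_eq by lra. field. }
  rewrite e. apply (filterlim_ext (fun t => (f t + g t + Rabs (f t + - g t)) * / 2)).
  { intros t. symmetry. apply e. }
  limit. apply (filterlim_R_comp F Rabs (fun t => f t + - g t)); [apply Rcontinuity_abs | limit].
Qed.

(** The trajectory is the set where [|F| = r] and [U], [V] have fixed signs, and the signs tell
    which marked point it encloses: both positive for infinity, both negative for [p], only [U]
    negative for [b], only [V] negative for [c]. *)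
Lemma closed_traj_circle_around f ps (p b c : R) (S : C -> Prop) : b < p < c ->
  log_square f ps p b c -> closed_traj f ps S -> circle_around ps S.
Proof.
  intros h hq hcl.
  assert (hex : exists z0, S z0 /\ z0 <> RtoC p /\ z0 <> RtoC b /\ z0 <> RtoC c).
  { destruct hcl as [_ [g [T [_ [hg [_ hs]]]]]]. exists (g 0).
    split; [apply hs; exists 0; split; [apply in_int_all | reflexivity] |].
    destruct (horiz_regular f ps p b c g _ _ hq hg 0 (in_int_all 0)) as [q1 [q2 [q3 _]]]. auto. }
  destruct hex as [z0 [hz0 [n1 [n2 n3]]]].
  pose proof (closed_traj_noncritical f ps p b c S z0 h hq hcl hz0) as hR.
  destruct (noncritical_curve f ps p b c z0 h hq n1 n2 n3 hR) as [S0 [hS0 hSiff]].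
  set (r := Cmod (Frat p b c z0)) in *.
  assert (hr : 0 <= r) by apply Cmod_ge_0.
  set (U := conic b p c) in *. set (V := conic c p b).
  (* Off [p], [G] has the sign of [|F| - r]; being free of denominators it is continuous at [p] as
     well. *)
  set (G := fun z => Cmod (z - RtoC b) ^ 2 * Cmod (z - RtoC c) ^ 2 - r ^ 2 * Cmod (z - RtoC p) ^ 2).
  assert (hUVG : forall z, U z * V z = G z + (r ^ 2 - (c - b) ^ 2) * Cmod (z - RtoC p) ^ 2).
  { intros z. unfold U, V, G. rewrite conic_product. ring. }
  assert (hUV0 : U z0 * V z0 = (r ^ 2 - (c - b) ^ 2) * Cmod (z0 - RtoC p) ^ 2).
  { rewrite hUVG. unfold G. rewrite (Cmod_Frat_sqr p b c z0 n1). fold r. ring. }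
  assert (hy0 : 0 < Cmod (z0 - RtoC p) ^ 2).
  { assert (0 < Cmod (z0 - RtoC p)) by (apply Cmod_gt_0, Cminus_neq_zero, n1). nra. }
  assert (hrR : r ^ 2 - (c - b) ^ 2 <> 0) by (intros k; apply hR; assert (0 < c - b) by lra; nra).
  assert (hsgn : exists s1 s2, is_sign s1 /\ is_sign s2 /\ 0 < s1 * U z0 /\ 0 < s2 * V z0).
  { assert (hne : U z0 * V z0 <> 0).
    { rewrite hUV0. apply Rmult_integral_contrapositive_currified; [exact hrR | lra]. }
    assert (hs : forall x, x <> 0 -> exists s, is_sign s /\ 0 < s * x).
    { intros x hx. destruct (Rlt_dec 0 x); [exists 1; split; [left; reflexivity | lra] |].
      exists (-1). split; [right; reflexivity | lra]. }
    destruct (hs (U z0)) as [s1 [a1 a2]]; [intros k; apply hne; rewrite k; ring |].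
    destruct (hs (V z0)) as [s2 [b1 b2]]; [intros k; apply hne; rewrite k; ring |].
    exists s1, s2. auto. }
  destruct hsgn as [s1 [s2 [is1 [is2 [hs1 hs2]]]]].
  assert (hs12 : 0 < s1 * s2 * (r ^ 2 - (c - b) ^ 2)).
  { assert (q : 0 < (s1 * U z0) * (s2 * V z0)) by (apply Rmult_lt_0_compat; assumption).
    replace (s1 * U z0 * (s2 * V z0)) with (s1 * s2 * (U z0 * V z0)) in q by ring. rewrite hUV0 in q.
    apply Rmult_lt_reg_r with (Cmod (z0 - RtoC p) ^ 2); [exact hy0 |]. lra. }
  assert (hSS : forall z, S0 z -> S z).
  { intros z hz. apply (traj_meet_same f ps S S0 z0 (proj1 hcl) (proj1 hS0) hz0); [| exact hz].
    apply hSiff. split; [exact n1 | split; [reflexivity |]].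
    destruct is1; subst s1; nra. }
  (* negative exactly on the side of S that contains the marked point *)
  set (m := fun z => Rmax (Rmax (- s1 * U z) (- s2 * V z)) (- (s1 * s2) * G z)).
  assert (Up : U (RtoC p) < 0) by (unfold U, conic; simpl; nra).
  assert (Vp : V (RtoC p) < 0) by (unfold V, conic; simpl; nra).
  assert (Ub : U (RtoC b) < 0) by (unfold U, conic; simpl; nra).
  assert (Vb : 0 < V (RtoC b)) by (unfold V, conic; simpl; nra).
  assert (Uc : 0 < U (RtoC c)) by (unfold U, conic; simpl; nra).
  assert (Vc : V (RtoC c) < 0) by (unfold V, conic; simpl; nra).
  (* If [m z = 0], then [s1 U], [s2 V] and [s1 s2 G] are nonnegative. By [hUVG] and [hs12] a zero of
     [U V] gives [s1 s2 G < 0], except at [p], where [U] and [V] are nonzero anyway. So [s1 U] and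
     [s2 V] are positive, and the maximum can only be attained by [G = 0]. *)
  assert (hm0 : forall z, m z = 0 -> S z).
  { intros z hz. unfold m in hz.
    pose proof (Rmax_l (Rmax (- s1 * U z) (- s2 * V z)) (- (s1 * s2) * G z)) as k1.
    pose proof (Rmax_r (Rmax (- s1 * U z) (- s2 * V z)) (- (s1 * s2) * G z)) as k2.
    pose proof (Rmax_l (- s1 * U z) (- s2 * V z)) as k3. pose proof (Rmax_r (- s1 * U z) (- s2 * V z)) as k4.
    rewrite hz in k1, k2. pose proof (hUVG z) as hz2.
    assert (hyz : 0 <= Cmod (z - RtoC p) ^ 2) by apply pow2_ge_0.
    assert (hne : z <> RtoC p -> 0 < Cmod (z - RtoC p) ^ 2).
    { intros q. assert (0 < Cmod (z - RtoC p)) by (apply Cmod_gt_0, Cminus_neq_zero, q). nra. }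
    assert (hUVne : U z * V z <> 0).
    { intros q. rewrite q in hz2.
      assert (z = RtoC p).
      { destruct (Ceq_dec z (RtoC p)) as [|w]; [assumption | exfalso]. specialize (hne w).
        assert (0 < s1 * s2 * (r ^ 2 - (c - b) ^ 2) * Cmod (z - RtoC p) ^ 2) by (apply Rmult_lt_0_compat; assumption).
        assert (s1 * s2 * G z = - (s1 * s2 * (r ^ 2 - (c - b) ^ 2) * Cmod (z - RtoC p) ^ 2)); [| lra].
        replace (G z) with (- (r ^ 2 - (c - b) ^ 2) * Cmod (z - RtoC p) ^ 2) by lra. ring. }
      subst z. destruct (Rmult_integral _ _ q); lra. }
    assert (hU : U z <> 0) by (intros q; apply hUVne; rewrite q; ring).
    assert (hV : V z <> 0) by (intros q; apply hUVne; rewrite q; ring).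
    assert (l1 : 0 < s1 * U z) by (destruct is1; subst s1; lra).
    assert (l2 : 0 < s2 * V z) by (destruct is2; subst s2; lra).
    assert (hG : G z = 0).
    { unfold Rmax at 1 in hz. destruct (Rle_dec (Rmax (- s1 * U z) (- s2 * V z)) (- (s1 * s2) * G z)).
      - destruct is1, is2; subst s1 s2; lra.
      - exfalso. unfold Rmax in hz. destruct (Rle_dec (- s1 * U z) (- s2 * V z)); lra. }
    assert (zp : z <> RtoC p).
    { intros ->. rewrite hG in hz2. replace (Cmod (RtoC p - RtoC p)) with 0 in hz2; [nra |].
      replace (RtoC p - RtoC p)%C with (RtoC 0) by ring. symmetry; apply Cmod_0. }
    apply hSS, hSiff. split; [exact zp | split].
    - unfold G in hG. rewrite (Cmod_Frat_sqr p b c z zp) in hG. specialize (hne zp).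
      assert (q : (Cmod (Frat p b c z) ^ 2 - r ^ 2) * Cmod (z - RtoC p) ^ 2 = 0) by lra.
      destruct (Rmult_integral _ _ q) as [q1 | q1]; [| lra].
      apply pow2_inj_pos; [apply Cmod_ge_0 | exact hr | lra].
    - assert (0 < (s1 * U z) * (s1 * U z0)) by (apply Rmult_lt_0_compat; assumption).
      destruct is1; subst s1; lra. }
  assert (hmc : forall g : R -> C, (forall t, continuous g t) -> forall t, continuous (fun t => m (g t)) t).
  { intros g hg t. assert (hs : forall w : C, filterlim (fun t => Cmod (g t - w) ^ 2) (locally t) (locally (Cmod (g t - w) ^ 2))).
    { intros w. apply (filterlim_R_comp (locally t) (fun x => x ^ 2) (fun t => Cmod (g t - w))); [reg |].
      apply filterlim_Cmod; [exact _ |]. unfold Cminus.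
      limit. apply hg. }
    unfold m, G, Rminus. apply filterlim_R_max; [exact _ | apply filterlim_R_max; [exact _ | |] |];
      limit; try apply hs; apply filterlim_conic; try exact _; apply hg. }
  assert (hsep : forall x y, pconn (fun z => ~ S z) x y -> (m x < 0 /\ 0 < m y) \/ (m y < 0 /\ 0 < m x) -> False).
  { intros x y [g [g1 [g2 [g3 g4]]]] hxy.
    assert (q : exists t, 0 <= t <= 1 /\ m (g t) = 0).
    { destruct hxy as [[k1 k2] | [k1 k2]].
      - destruct (IVT_zero (fun t => m (g t)) 0 1) as [t [ht et]]; rewrite ?g2, ?g3; auto.
        rewrite Rmin_left, Rmax_right in ht by lra. exists t; auto.
      - destruct (IVT_zero (fun t => m (g t)) 1 0) as [t [ht et]]; rewrite ?g2, ?g3; auto.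
        rewrite Rmin_right, Rmax_left in ht by lra. exists t; auto. }
    destruct q as [t [ht et]]. apply (g4 t ht), hm0, et. }
  assert (hpos : forall z, 0 < - s1 * U z \/ 0 < - s2 * V z -> 0 < m z).
  { intros z hz. unfold m. apply Rlt_le_trans with (2 := Rmax_l _ _).
    destruct hz as [k | k]; [apply Rlt_le_trans with (2 := Rmax_l _ _) | apply Rlt_le_trans with (2 := Rmax_r _ _)]; exact k. }
  assert (hneg : forall z, 0 < s1 * U z -> 0 < s2 * V z -> 0 < s1 * s2 * G z -> m z < 0).
  { intros z k1 k2 k3. unfold m. apply Rmax_lub_lt; [apply Rmax_lub_lt |]; lra. }
  assert (Gp : 0 < G (RtoC p)).
  { pose proof (hUVG (RtoC p)) as q. replace (RtoC p - RtoC p)%C with (RtoC 0) in q by ring. rewrite Cmod_0 in q. nra. }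
  assert (r0 : 0 < r).
  { apply Cmod_gt_0. intros k. destruct (Frat_zero p b c z0 n1 k); contradiction. }
  assert (Gz : forall z, z = RtoC b \/ z = RtoC c -> G z < 0).
  { intros z hz. assert (zp : 0 < Cmod (z - RtoC p)).
    { apply Cmod_gt_0, Cminus_neq_zero. intros k. destruct hz; subst z; injection k; lra. }
    unfold G. assert (e : Cmod (z - RtoC b) ^ 2 * Cmod (z - RtoC c) ^ 2 = 0).
    { destruct hz as [-> | ->]; [replace (RtoC b - RtoC b)%C with (RtoC 0) by ring | replace (RtoC c - RtoC c)%C with (RtoC 0) by ring];
        rewrite Cmod_0; ring. }
    rewrite e. assert (0 < (r * Cmod (z - RtoC p)) ^ 2); [| lra].
    assert (0 < r * Cmod (z - RtoC p)) by (apply Rmult_lt_0_compat; assumption). nra. }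
  (* Beyond modulus [4 K] the distances to [b], [c], [p] exceed [3 K], whereas the squared radii of
     the circles are at most [4 K^2] and [r <= K]. *)
  set (K := Rabs b + Rabs c + Rabs p + r).
  assert (hinf : forall w, 4 * K < Cmod w -> 0 < U w /\ 0 < V w /\ 0 < G w).
  { intros w hw.
    pose proof (Rabs_pos b). pose proof (Rabs_pos c). pose proof (Rabs_pos p).
    assert (hK : 0 < K) by (unfold K; lra).
    assert (tri : forall q : R, Rabs q <= K -> 3 * K < Cmod (w - RtoC q) /\ Cmod w - K <= Cmod (w - RtoC q) /\ Cmod (w - RtoC q) <= Cmod w + K).
    { intros q hqK. pose proof (Cmod_triangle (w - RtoC q) (RtoC q)) as t1.
      replace (w - RtoC q + RtoC q)%C with w in t1 by ring.
      pose proof (Cmod_triangle w (- RtoC q)) as t2. rewrite Cmod_opp in t2. rewrite Cmod_R in *.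
      unfold Cminus in *. lra. }
    destruct (tri b) as [b1 [b2 b3]]; [unfold K; lra |]. destruct (tri c) as [c1 [c2 c3]]; [unfold K; lra |].
    destruct (tri p) as [p1 [p2 p3]]; [unfold K; lra |].
    assert (hbnd : (p - b) * (c - b) <= 4 * (K * K) /\ (p - c) * (b - c) <= 4 * (K * K)).
    { pose proof (Rle_abs b). pose proof (Rle_abs c). pose proof (Rle_abs (- b)). pose proof (Rle_abs (- c)).
      pose proof (Rle_abs p). pose proof (Rle_abs (- p)). rewrite !Rabs_Ropp in *.
      assert (0 < p - b <= 2 * K) by (unfold K; lra). assert (0 < c - b <= 2 * K) by (unfold K; lra).
      assert (0 < c - p <= 2 * K) by (unfold K; lra). clearbody K.
      replace (4 * (K * K)) with ((2 * K) * (2 * K)) by ring.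
      replace ((p - c) * (b - c)) with ((c - p) * (c - b)) by ring.
      split; apply Rmult_le_compat; lra. }
    assert (eU : U w = Cmod (w - RtoC b) ^ 2 - (p - b) * (c - b)).
    { rewrite Cmod_sqr. unfold U, conic. destruct w as [w1 w2]. simpl. ring. }
    assert (eV : V w = Cmod (w - RtoC c) ^ 2 - (p - c) * (b - c)).
    { rewrite Cmod_sqr. unfold V, conic. destruct w as [w1 w2]. simpl. ring. }
    assert (hrK : r <= K) by (unfold K; lra).
    rewrite eU, eV. unfold G.
    set (x := Cmod w) in *. set (xb := Cmod (w - RtoC b)) in *. set (xc := Cmod (w - RtoC c)) in *.
    set (xp := Cmod (w - RtoC p)) in *. clearbody K x xb xc xp.
    clear - hK hw b1 b2 b3 c1 c2 c3 p1 p2 p3 hbnd hrK r0.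
    split; [nra | split; [nra |]].
    assert (q1 : r * xp <= K * (x + K)) by (apply Rmult_le_compat; lra).
    assert (q2 : (x - K) * (x - K) <= xb * xc) by (apply Rmult_le_compat; lra).
    assert (q3 : K * (x + K) < (x - K) * (x - K)) by nra.
    assert (q4 : 0 <= r * xp) by (apply Rmult_le_pos; lra).
    replace (xb ^ 2 * xc ^ 2 - r ^ 2 * xp ^ 2) with ((xb * xc - r * xp) * (xb * xc + r * xp)) by ring.
    apply Rmult_lt_0_compat; lra. }
  assert (him : forall q, In q (marked ps) <-> q = Some (RtoC p) \/ q = Some (RtoC b) \/ q = Some (RtoC c) \/ q = None).
  { intros q. unfold marked. rewrite in_app_iff, in_map_iff. destruct hq as [hps _]. split.
    - intros [[y [k1 k2]] | [k | []]]; [| subst; auto].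
      apply hps in k2. subst q. destruct k2 as [-> | [-> | ->]]; auto.
    - intros [-> | [-> | [-> | ->]]]; [left; eexists; split; [reflexivity | apply hps; auto] .. | right; left; reflexivity]. }
  assert (hfinite : forall q0, q0 = RtoC p \/ q0 = RtoC b \/ q0 = RtoC c -> m q0 < 0 ->
    (forall z, z = RtoC p \/ z = RtoC b \/ z = RtoC c -> z <> q0 -> 0 < m z) ->
    (forall w, 0 < U w /\ 0 < V w /\ 0 < G w -> 0 < m w) -> circle_around ps S).
  { intros q0 h0 h1 h2 h3. exists (Some q0). split; [apply him; intuition congruence |].
    intros [z |] hqm hne hsc.
    - apply (hsep _ _ hsc). left. split; [exact h1 |]. apply h2; [| congruence].
      apply him in hqm. intuition congruence.
    - destruct (hsc (4 * K)) as [w [w1 w2]]. apply (hsep _ _ w2). left. split; [exact h1 | apply h3, hinf, w1]. }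
  destruct is1, is2; subst s1 s2.
  - exists None. split; [apply him; auto |]. intros q hqm hne hsc.
    assert (hq2 : exists z, q = Some z /\ 0 < m z).
    { apply him in hqm. destruct hqm as [-> | [-> | [-> | ->]]]; [.. | contradiction];
        eexists; (split; [reflexivity |]); apply hpos; lra. }
    destruct hq2 as [z [-> hz]]. destruct (hsc (4 * K)) as [w [w1 w2]].
    destruct (hinf w w1) as [a1 [a2 a3]]. apply (hsep z w w2). right. split; [apply hneg; lra | exact hz].
  - apply (hfinite (RtoC c)); auto.
    + pose proof (Gz (RtoC c) (or_intror eq_refl)). apply hneg; lra.
    + intros z [-> | [-> | ->]] hne; [| | congruence]; apply hpos; lra.
    + intros w [a1 [a2 a3]]. apply hpos; lra.
  - apply (hfinite (RtoC b)); auto.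
    + pose proof (Gz (RtoC b) (or_introl eq_refl)). apply hneg; lra.
    + intros z [-> | [-> | ->]] hne; [| congruence |]; apply hpos; lra.
    + intros w [a1 [a2 a3]]. apply hpos; lra.
  - apply (hfinite (RtoC p)); auto.
    + apply hneg; lra.
    + intros z [-> | [-> | ->]] hne; [congruence | |]; apply hpos; lra.
    + intros w [a1 [a2 a3]]. apply hpos; lra.
Qed.

(** * The Strebel property in the real case *)

(** A trajectory through a point off the critical level coincides with the closed one of
    [noncritical_curve], so all non-closed ones lie on the two circles. *)
Lemma nonclosed_traj_null f ps (p b c : R) : b < p < c -> log_square f ps p b c ->
  null2 (fun z => exists S, is_traj f ps S /\ ~ closed_traj f ps S /\ S z).
Proof.
  intros h hq.
  apply null2_subset with (B := fun z => Cmod (z - RtoC b) = sqrt ((p - b) * (c - b)) \/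
                                         Cmod (z - RtoC c) = sqrt ((p - c) * (b - c))).
  2:{ apply null2_of_finite_null, finite_null_union; apply finite_null_circle, sqrt_pos. }
  intros z [S [hS [hnc hz]]].
  assert (hreg : z <> RtoC p /\ z <> RtoC b /\ z <> RtoC c).
  { destruct hS as [[g [a [e [hg hs]]]] _]. apply hs in hz. destruct hz as [t [it <-]].
    destruct (horiz_regular f ps p b c g a e hq hg t it) as [q1 [q2 [q3 _]]]. auto. }
  destruct hreg as [n1 [n2 n3]].
  assert (hF : Cmod (Frat p b c z) = c - b).
  { destruct (Req_dec (Cmod (Frat p b c z)) (c - b)) as [|hne]; [assumption | exfalso]. apply hnc.
    destruct (noncritical_curve f ps p b c z h hq n1 n2 n3 hne) as [S0 [[hS0 [g [T [hT [hg [hper hsame]]]]]] hiff]].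
    assert (hzS0 : S0 z).
    { destruct hS0 as [_ hmax]. apply hiff. split; [exact n1 | split; [reflexivity |]].
      pose proof (conic_product b p c z) as q. rewrite (Cmod_Frat_sqr p b c z n1) in q.
      assert (hy : 0 < Cmod (z - RtoC p)) by (apply Cmod_gt_0, Cminus_neq_zero, n1).
      assert (conic b p c z <> 0).
      { intros k. rewrite k, Rmult_0_l in q.
        assert (q' : (Cmod (Frat p b c z) ^ 2 - (c - b) ^ 2) * Cmod (z - RtoC p) ^ 2 = 0) by lra.
        destruct (Rmult_integral _ _ q') as [q2 | q2].
        - apply hne, pow2_inj_pos; [apply Cmod_ge_0 | lra | lra].
        - apply (pow_nonzero (Cmod (z - RtoC p)) 2); lra. }
      destruct (Rtotal_order (conic b p c z) 0) as [k | [k | k]]; [nra | contradiction | nra]. }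
    pose proof (traj_meet_same f ps S S0 z hS hS0 hz hzS0) as hSS.
    split; [exact hS |]. exists g, T. repeat split; try apply hg; auto.
    - intros k. apply hSS, hsame, k.
    - intros k. apply hsame, hSS, k. }
  assert (hprod : conic b p c z * conic c p b z = 0).
  { rewrite conic_product, (Cmod_Frat_sqr p b c z n1), hF. ring. }
  destruct (Rmult_integral _ _ hprod) as [k | k]; [left | right];
    (apply pow2_inj_pos; [apply Cmod_ge_0 | apply sqrt_pos |]; rewrite pow2_sqrt by nra;
     rewrite Cmod_sqr; unfold conic in k; destruct z as [x y]; simpl in *; lra).
Qed.

Lemma Cmod_le_add (z w : C) (x y : R) : Cmod z <= x -> Cmod w <= y -> Cmod (z + w) <= x + y.
Proof. intros h k. apply Rle_trans with (1 := Cmod_triangle z w). lra. Qed.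

Lemma Cmod_mult_le (z w : C) (x y : R) : Cmod z <= x -> Cmod w <= y -> Cmod (z * w) <= x * y.
Proof. intros h k. rewrite Cmod_mult. apply Rmult_le_compat; auto; apply Cmod_ge_0. Qed.

(* Near a marked point [d log F = (+-1 / (z - q) + O(1)) dz]. *)
Lemma dpole_res_simple_pole (f : C -> C) (q q1 q2 : C) (e e1 e2 : R) :
  q <> q1 -> q <> q2 -> is_sign e -> is_sign e1 -> is_sign e2 ->
  (forall z, z <> q -> z <> q1 -> z <> q2 ->
     f z = (RtoC (- / (4 * PI ^ 2)) * ((RtoC e / (z - q) + (RtoC e1 / (z - q1) + RtoC e2 / (z - q2))) *
                                       (RtoC e / (z - q) + (RtoC e1 / (z - q1) + RtoC e2 / (z - q2)))))%C) ->
  dpole_res f q 1.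
Proof.
  intros n1 n2 he he1 he2 hf.
  assert (m1 : 0 < Cmod (q - q1)) by apply Cmod_gt_0, Cminus_neq_zero, n1.
  assert (m2 : 0 < Cmod (q - q2)) by apply Cmod_gt_0, Cminus_neq_zero, n2.
  set (H := 2 / Cmod (q - q1) + 2 / Cmod (q - q2)).
  assert (hH : 0 < H) by (apply Rplus_lt_0_compat; apply Rdiv_lt_0_compat; lra).
  pose proof (Rinv_0_lt_compat _ PI2_pos) as hk. set (k := / (4 * PI ^ 2)) in *.
  (* Within half the distance to each of the other two poles their terms are bounded by [H] in
     total; a radius of at most [1] lets the term [H^2] be absorbed into [1 / |z - q|]. *)
  exists (Rmin 1 (Rmin (Cmod (q - q1) / 2) (Cmod (q - q2) / 2))), (k * (2 * H + H * H)).
  split; [repeat apply Rmin_glb_lt; lra |].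
  intros z [hz0 hz1].
  assert (b1 : Cmod (z - q) < 1) by (apply Rlt_le_trans with (1 := hz1), Rmin_l).
  assert (b2 : Cmod (z - q) < Cmod (q - q1) / 2).
  { apply Rlt_le_trans with (1 := hz1). apply Rle_trans with (1 := Rmin_r _ _), Rmin_l. }
  assert (b3 : Cmod (z - q) < Cmod (q - q2) / 2).
  { apply Rlt_le_trans with (1 := hz1). apply Rle_trans with (1 := Rmin_r _ _), Rmin_r. }
  assert (bound : forall (w : C) (s : R), is_sign s -> 0 < Cmod (q - w) -> Cmod (z - q) < Cmod (q - w) / 2 ->
            z <> w /\ Cmod (RtoC s / (z - w)) <= 2 / Cmod (q - w)).
  { intros w s hs hw hzw.
    pose proof (Cmod_triangle (z - w) (- (z - q))) as t. rewrite Cmod_opp in t.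
    replace (z - w + - (z - q))%C with (q - w)%C in t by ring.
    assert (hpos : 0 < Cmod (z - w)) by lra.
    assert (zw : (z - w)%C <> RtoC 0) by (apply Cmod_gt_0, hpos).
    split; [intros ->; apply zw; ring |].
    rewrite Cmod_div, Cmod_R by exact zw.
    replace (Rabs s) with 1 by (destruct hs; subst s; [rewrite Rabs_R1 | rewrite Rabs_left by lra]; ring).
    apply Rmult_le_reg_r with (Cmod (z - w) * Cmod (q - w)); [apply Rmult_lt_0_compat; lra |].
    field_simplify; lra. }
  destruct (bound q1 e1 he1 m1 b2) as [z1 c1]. destruct (bound q2 e2 he2 m2 b3) as [z2 c2].
  assert (zq : z <> q). { intros ->. replace (q - q)%C with (RtoC 0) in hz0 by ring. rewrite Cmod_0 in hz0. lra. }
  rewrite (hf z zq z1 z2). set (h := (RtoC e1 / (z - q1) + RtoC e2 / (z - q2))%C).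
  assert (hh : Cmod h <= H) by (apply Cmod_le_add; assumption).
  assert (he' : (RtoC e * RtoC e)%C = RtoC 1) by (rewrite <- RtoC_mult; destruct he; subst e; f_equal; ring).
  pose proof (Cminus_neq_zero _ _ zq) as zq'.
  replace (RtoC (1 ^ 2 / (4 * PI ^ 2))) with (RtoC k) by (f_equal; unfold k; unfold Rdiv; ring).
  replace (RtoC (- k) * ((RtoC e / (z - q) + h) * (RtoC e / (z - q) + h)) + RtoC k / ((z - q) * (z - q)))%C
    with (- (RtoC k * (2 * (RtoC e * (h * / (z - q))) + h * h)))%C.
  2:{ replace (RtoC (- k) * ((RtoC e / (z - q) + h) * (RtoC e / (z - q) + h)) + RtoC k / ((z - q) * (z - q)))%C with
        (- (RtoC k * (2 * (RtoC e * (h * / (z - q))) + h * h)) + RtoC k * (1 - RtoC e * RtoC e) / ((z - q) * (z - q)))%C.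
      - rewrite he'. field. exact zq'.
      - rewrite RtoC_opp. field. exact zq'. }
  rewrite Cmod_opp, Cmod_mult, Cmod_R, (Rabs_pos_eq k) by lra.
  set (x := Cmod (z - q)) in *.
  assert (hx : 1 <= / x). { rewrite <- Rinv_1. apply Rinv_le_contravar; lra. }
  assert (hi : Cmod (/ (z - q)) <= / x) by (rewrite Cmod_inv by exact zq'; unfold x; lra).
  assert (hb : Cmod (2 * (RtoC e * (h * / (z - q))) + h * h) <= 2 * (1 * (H * / x)) + H * H).
  { apply Cmod_le_add; [| apply Cmod_mult_le; assumption].
    apply Cmod_mult_le; [rewrite Cmod_R, Rabs_pos_eq; lra |].
    apply Cmod_mult_le; [| apply Cmod_mult_le; assumption].
    rewrite Cmod_R. destruct he; subst e; [rewrite Rabs_R1; lra | rewrite Rabs_left; lra]. }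
  unfold Rdiv. rewrite Rmult_assoc. apply Rmult_le_compat_l; [lra |].
  apply Rle_trans with (1 := hb). nra.
Qed.

Lemma dlogF_partial_fractions (p b c z : C) : z <> p -> z <> b -> z <> c ->
  dlogF p b c z = (RtoC 1 / (z - b) + RtoC 1 / (z - c) + RtoC (-1) / (z - p))%C.
Proof.
  intros n1 n2 n3. apply Cminus_neq_zero in n1, n2, n3. unfold dlogF. field. auto.
Qed.

Lemma dpole_res_marked f ps (p b c q : C) : log_square f ps p b c -> In q ps -> dpole_res f q 1.
Proof.
  intros [hps [[npb [npc nbc]] hf]] hin.
  assert (hf' : forall z, z <> p -> z <> b -> z <> c -> f z = (RtoC (- / (4 * PI ^ 2)) *
     ((RtoC 1 / (z - b) + RtoC 1 / (z - c) + RtoC (-1) / (z - p)) * (RtoC 1 / (z - b) + RtoC 1 / (z - c) + RtoC (-1) / (z - p))))%C).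
  { intros z n1 n2 n3. rewrite hf by (rewrite hps; tauto).
    rewrite <- dlogF_partial_fractions by assumption. reflexivity. }
  apply hps in hin.
  assert (s1 : is_sign 1) by (left; reflexivity). assert (s2 : is_sign (-1)) by (right; reflexivity).
  destruct hin as [-> | [-> | ->]].
  - apply (dpole_res_simple_pole f p b c (-1) 1 1); auto. intros z z1 z2 z3. rewrite hf' by auto. f_equal. ring.
  - apply (dpole_res_simple_pole f b p c 1 (-1) 1); auto. intros z z1 z2 z3. rewrite hf' by auto. f_equal. ring.
  - apply (dpole_res_simple_pole f c p b 1 (-1) 1); auto. intros z z1 z2 z3. rewrite hf' by auto. f_equal. ring.
Qed.

(** For [w = 1 / z] one has [1 / (z - q) = w + w^2 q / (1 - q w)]. The residues [1], [1], [-1] add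
    up to [1], so [dlogF (1 / w) = w + w^2 s] with [s] bounded near [0]. *)
Lemma dpole_res_inf_marked f ps (p b c : C) : log_square f ps p b c -> dpole_res_inf f 1.
Proof.
  intros [hps [_ hf]].
  pose proof (Cmod_ge_0 p) as p0. pose proof (Cmod_ge_0 b) as b0. pose proof (Cmod_ge_0 c) as c0.
  set (H := 2 * Cmod b + 2 * Cmod c + 2 * Cmod p).
  pose proof (Rinv_0_lt_compat _ PI2_pos) as hk. set (k := / (4 * PI ^ 2)) in *.
  set (K := Cmod b + Cmod c + Cmod p + 1).
  assert (hK : 1 <= K) by (unfold K; lra).
  exists (/ (2 * K)), (k * (2 * H + H * H)). split; [apply Rinv_0_lt_compat; lra |].
  intros w [hw0 hw1].
  assert (w0 : w <> RtoC 0) by (apply Cmod_gt_0, hw0).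
  assert (hwK : Cmod w * K < 1 / 2).
  { apply Rmult_lt_reg_r with (/ K); [apply Rinv_0_lt_compat; lra |].
    replace (Cmod w * K * / K) with (Cmod w) by (field; lra).
    replace (1 / 2 * / K) with (/ (2 * K)) by (field; lra). exact hw1. }
  assert (bound : forall q, Cmod q <= K -> (1 - q * w)%C <> RtoC 0 /\ Cmod (q / (1 - q * w)) <= 2 * Cmod q).
  { intros q hq. pose proof (Cmod_ge_0 q).
    assert (hqw : Cmod (q * w) <= 1 / 2) by (rewrite Cmod_mult; nra).
    pose proof (Cmod_triangle (1 - q * w) (q * w)) as t.
    replace (1 - q * w + q * w)%C with (RtoC 1) in t by ring. rewrite Cmod_1 in t.
    assert (hp : 1 / 2 <= Cmod (1 - q * w)) by lra.
    assert (hn : (1 - q * w)%C <> RtoC 0) by (apply Cmod_gt_0; lra).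
    split; [exact hn |]. rewrite Cmod_div by exact hn.
    apply Rmult_le_reg_r with (Cmod (1 - q * w)); [lra |].
    unfold Rdiv. rewrite Rmult_assoc, Rinv_l by lra. nra. }
  destruct (bound b) as [b1 b2]; [unfold K; lra |]. destruct (bound c) as [c1 c2]; [unfold K; lra |].
  destruct (bound p) as [p1 p2]; [unfold K; lra |].
  assert (hne : forall q, (1 - q * w)%C <> RtoC 0 -> (/ w)%C <> q).
  { intros q hq <-. apply hq. field. exact w0. }
  rewrite hf by (rewrite hps; intros [q | [q | q]]; revert q; apply hne; assumption).
  rewrite dlogF_partial_fractions by (apply hne; assumption).
  set (s := (b / (1 - b * w) + c / (1 - c * w) + - (p / (1 - p * w)))%C).
  assert (hs : Cmod s <= H) by (apply Cmod_le_add; [apply Cmod_le_add; assumption | rewrite Cmod_opp; assumption]).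
  replace (RtoC 1 / (/ w - b) + RtoC 1 / (/ w - c) + RtoC (-1) / (/ w - p))%C with (w + w * w * s)%C.
  2:{ unfold s. field. repeat split; auto; try (intros q; apply (Cminus_neq_zero _ _ (hne _ b1)) in q); auto. }
  replace (RtoC (1 ^ 2 / (4 * PI ^ 2))) with (RtoC k) by (f_equal; unfold k; unfold Rdiv; ring).
  fold k. replace (RtoC (- k) * ((w + w * w * s) * (w + w * w * s)) / Cpown w 4 + RtoC k / (w * w))%C
    with (- (RtoC k * (2 * (s * / w) + s * s)))%C.
  2:{ rewrite RtoC_opp. simpl. field. exact w0. }
  rewrite Cmod_opp, Cmod_mult, Cmod_R, (Rabs_pos_eq k) by lra.
  set (x := Cmod w) in *.
  assert (hx : 1 <= / x). { rewrite <- Rinv_1. apply Rinv_le_contravar; nra. }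
  assert (hi : Cmod (/ w) <= / x) by (rewrite Cmod_inv by exact w0; unfold x; lra).
  assert (hb : Cmod (2 * (s * / w) + s * s) <= 2 * (H * / x) + H * H).
  { apply Cmod_le_add; [| apply Cmod_mult_le; assumption].
    apply Cmod_mult_le; [rewrite Cmod_R, Rabs_pos_eq; lra | apply Cmod_mult_le; assumption]. }
  unfold Rdiv. rewrite Rmult_assoc. apply Rmult_le_compat_l; [lra |].
  apply Rle_trans with (1 := hb). assert (0 <= H) by (unfold H; lra). nra.
Qed.

Lemma holo_ext_loc (f g : C -> C) (z : C) (r : R) : 0 < r ->
  (forall w, Cmod (w - z) < r -> f w = g w) -> holo_at f z -> holo_at g z.
Proof.
  intros hr h. rewrite !holo_at_iff.
  apply (ex_derive_ext_loc (V := AbsRing_NormedModule C_AbsRing) f g).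
  exists (mkposreal r hr). intros w hw. apply h, hw.
Qed.

Lemma holo_log_square f ps (p b c z : C) : log_square f ps p b c -> ~ In z ps -> holo_at f z.
Proof.
  intros [hps [_ hf]] hz. destruct (not_pole_nearby ps z hz) as [r [hr hn]].
  apply (holo_ext_loc (fun z => RtoC (- / (4 * PI ^ 2)) * (dlogF p b c z * dlogF p b c z))%C f z r hr).
  - intros w hw. symmetry. apply hf, hn, hw.
  - assert (hh : z <> p /\ z <> b /\ z <> c) by (repeat split; intros k; apply hz, hps; auto).
    destruct hh as [n1 [n2 n3]]. apply Cminus_neq_zero in n1, n2, n3.
    assert (hd : ((z - p) * (z - b) * (z - c))%C <> RtoC 0).
    { intros k. destruct (Cmult_integral _ _ k) as [k1 | k1]; auto. destruct (Cmult_integral _ _ k1); auto. }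
    unfold dlogF, Cdiv, Cminus. holo; exact hd.
Qed.

Lemma strebel_of_real_log_square f ps (p b c : R) : b < p < c -> NoDup ps -> log_square f ps p b c -> is_strebel f ps.
Proof.
  intros h hnd hq. split; [exact hnd | split; [| split; [| split; [| split]]]].
  - intros z. apply (holo_log_square f ps p b c z hq).
  - intros q hin. exists 1. split; [lra | apply (dpole_res_marked f ps p b c q hq hin)].
  - exists 1. split; [lra | apply (dpole_res_inf_marked f ps p b c hq)].
  - apply (nonclosed_traj_null f ps p b c h hq).
  - intros S. apply (closed_traj_circle_around f ps p b c S h hq).
Qed.

(** * Affine changes of coordinate and the main theorem *)

Definition affine (al be : R) (z : C) : C := (RtoC al * z + RtoC be)%C.

(** [f1 dz^2] is the pull-back of [f2 dw^2] under [w = al z + be], whence the factor [al^2]. As [al]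
    is real, directions change at most by a sign, and for [al < 0] this is a half-turn and not a
    reflection, so cyclic orders are kept. *)
Definition affine_equiv (al be : R) (f1 : C -> C) (ps1 : list C) (f2 : C -> C) (ps2 : list C) : Prop :=
  al <> 0 /\ (forall z, In z ps1 <-> In (affine al be z) ps2) /\
  forall z, ~ In z ps1 -> f1 z = (RtoC (al * al) * f2 (affine al be z))%C.

Lemma affine_inv_l (al be : R) (z : C) : al <> 0 -> affine (/ al) (- be / al) (affine al be z) = z.
Proof.
  intros h. unfold affine. unfold Rdiv. rewrite RtoC_mult, RtoC_opp, RtoC_inv by exact h.
  field. intros k; apply h; injection k; auto.
Qed.

Lemma affine_inv_r (al be : R) (z : C) : al <> 0 -> affine al be (affine (/ al) (- be / al) z) = z.
Proof.
  intros h. unfold affine. unfold Rdiv. rewrite RtoC_mult, RtoC_opp, RtoC_inv by exact h.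
  field. intros k; apply h; injection k; auto.
Qed.

Lemma affine_equiv_sym al be f1 ps1 f2 ps2 :
  affine_equiv al be f1 ps1 f2 ps2 -> affine_equiv (/ al) (- be / al) f2 ps2 f1 ps1.
Proof.
  intros [h0 [h1 h2]]. split; [apply Rinv_neq_0_compat, h0 | split].
  - intros z. rewrite h1, affine_inv_r by exact h0. tauto.
  - intros z hz. rewrite h2.
    + rewrite affine_inv_r by exact h0. rewrite Cmult_assoc, <- RtoC_mult.
      replace (/ al * / al * (al * al)) with 1 by (field; exact h0). ring.
    + rewrite h1, affine_inv_r by exact h0. exact hz.
Qed.

(** An affine map carries [Frat] of the three points to [Frat] of their images up to a constant
    factor, so the logarithmic derivatives differ only by the chain-rule factor [al]. *)
Lemma affine_equiv_of_log_square f1 ps1 f2 ps2 (al be : R) (p b c : C) : al <> 0 ->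
  log_square f1 ps1 p b c -> log_square f2 ps2 (affine al be p) (affine al be b) (affine al be c) ->
  affine_equiv al be f1 ps1 f2 ps2.
Proof.
  intros h0 [k1 [_ k3]] [m1 [_ m3]].
  assert (hal : RtoC al <> RtoC 0) by (intros q; apply h0; injection q; auto).
  assert (hinj : forall z w, affine al be z = affine al be w <-> z = w).
  { intros z w. split; [| intros ->; reflexivity]. intros q.
    rewrite <- (affine_inv_l al be z h0), <- (affine_inv_l al be w h0), q. reflexivity. }
  assert (hin : forall z, In z ps1 <-> In (affine al be z) ps2).
  { intros z. rewrite k1, m1, !hinj. tauto. }
  split; [exact h0 | split; [exact hin |]].
  intros z hz. rewrite k3 by exact hz. rewrite m3 by (rewrite <- hin; exact hz).
  assert (hh : z <> p /\ z <> b /\ z <> c) by (repeat split; intros k; apply hz, k1; auto).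
  destruct hh as [n1 [n2 n3]]. apply Cminus_neq_zero in n1, n2, n3.
  assert (e : dlogF p b c z = (RtoC al * dlogF (affine al be p) (affine al be b) (affine al be c) (affine al be z))%C).
  { unfold dlogF, affine.
    replace (RtoC al * z + RtoC be - (RtoC al * p + RtoC be))%C with (RtoC al * (z - p))%C by ring.
    replace (RtoC al * z + RtoC be - (RtoC al * b + RtoC be))%C with (RtoC al * (z - b))%C by ring.
    replace (RtoC al * z + RtoC be - (RtoC al * c + RtoC be))%C with (RtoC al * (z - c))%C by ring.
    field. auto. }
  rewrite e, RtoC_mult. ring.
Qed.

Lemma horiz_affine al be f1 ps1 f2 ps2 g a b : affine_equiv al be f1 ps1 f2 ps2 ->
  horiz f1 ps1 g a b -> horiz f2 ps2 (fun t => affine al be (g t)) a b.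
Proof.
  intros [h0 [h1 h2]] [hab hg]. split; [exact hab |]. intros t it.
  destruct (hg t it) as [np [d [hd hf]]]. split; [rewrite <- h1; exact np |].
  exists (RtoC al * d)%C. split.
  - unfold affine. evar_last; [derive_C | simpl; ring].
  - rewrite (h2 _ np) in hf.
    replace (f2 (affine al be (g t)) * (RtoC al * d) * (RtoC al * d))%C with
      (RtoC (al * al) * f2 (affine al be (g t)) * d * d)%C; [exact hf |]. rewrite RtoC_mult. ring.
Qed.

Lemma unit_horiz_affine al be f1 ps1 f2 ps2 g a b : affine_equiv al be f1 ps1 f2 ps2 ->
  unit_horiz f1 ps1 g a b -> unit_horiz f2 ps2 (fun t => affine al be (g t)) a b.
Proof.
  intros h [hg hu]. split; [apply (horiz_affine al be f1 ps1); assumption |].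
  intros t it. destruct (hu t it) as [d [hd e]]. destruct hg as [_ hg]. destruct (hg t it) as [np _].
  destruct h as [h0 [h1 h2]]. exists (RtoC al * d)%C. split.
  - unfold affine. evar_last; [derive_C | simpl; ring].
  - rewrite <- e, (h2 _ np), !Cmod_mult, RtoC_mult, Cmod_mult. ring.
Qed.

Definition transport (al be : R) (S : C -> Prop) : C -> Prop := fun w => S (affine (/ al) (- be / al) w).

Lemma img_affine al be g a b (S : C -> Prop) : al <> 0 -> same_set (img g a b) S ->
  same_set (img (fun t => affine al be (g t)) a b) (transport al be S).
Proof.
  intros h0 hs w. unfold transport. split.
  - intros [t [it <-]]. rewrite affine_inv_l by exact h0. apply hs. exists t. auto.
  - intros k. apply hs in k. destruct k as [t [it e]]. exists t. split; [exact it |].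
    rewrite e. apply affine_inv_r, h0.
Qed.

Lemma is_traj_affine al be f1 ps1 f2 ps2 S : affine_equiv al be f1 ps1 f2 ps2 ->
  is_traj f1 ps1 S -> is_traj f2 ps2 (transport al be S).
Proof.
  intros h [[g [a [b [hg hs]]]] hmax]. split.
  - exists (fun t => affine al be (g t)), a, b. split; [apply (horiz_affine al be f1 ps1); assumption |].
    apply img_affine; [apply h | exact hs].
  - intros k a' b' hk hmeet t it.
    apply (hmax (fun t => affine (/ al) (- be / al) (k t)) a' b'); auto.
    apply (horiz_affine (/ al) (- be / al) f2 ps2); [apply affine_equiv_sym, h | exact hk].
Qed.

Definition sgn (al : R) : R := if Rlt_dec 0 al then 1 else -1.

Lemma sgn_abs (al : R) : Rabs al * sgn al = al.
Proof.
  unfold sgn. destruct (Rlt_dec 0 al); [rewrite Rabs_pos_eq by lra | rewrite Rabs_left1 by lra]; ring.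
Qed.

Lemma sgn_sqr (al : R) : (RtoC (sgn al) * RtoC (sgn al))%C = RtoC 1.
Proof. rewrite <- RtoC_mult. unfold sgn. destruct (Rlt_dec 0 al); f_equal; ring. Qed.

Lemma sgn_inv (al : R) : al <> 0 -> sgn (/ al) = sgn al.
Proof.
  intros h. unfold sgn. destruct (Rlt_dec 0 al) as [k | k], (Rlt_dec 0 (/ al)) as [q | q]; trivial; exfalso.
  - apply q, Rinv_0_lt_compat, k.
  - apply k. rewrite <- (Rinv_inv al). apply Rinv_0_lt_compat, q.
Qed.

Lemma is_zero_affine al be f1 ps1 f2 ps2 z : affine_equiv al be f1 ps1 f2 ps2 ->
  is_zero f1 ps1 z -> is_zero f2 ps2 (affine al be z).
Proof.
  intros [h0 [h1 h2]] [np hz]. split; [rewrite <- h1; exact np |].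
  rewrite (h2 _ np) in hz. destruct (Cmult_integral _ _ hz) as [k | k]; [| exact k].
  exfalso. injection k. intros q. destruct (Rmult_integral _ _ q); auto.
Qed.

Lemma hedge_of_affine al be f1 ps1 f2 ps2 z u S : affine_equiv al be f1 ps1 f2 ps2 ->
  hedge_of f1 ps1 z u S ->
  hedge_of f2 ps2 (affine al be z) (RtoC (sgn al) * u)%C (transport al be S).
Proof.
  intros h [hS [hz [g [a [b [hg [hs [hl hd]]]]]]]].
  split; [apply (is_traj_affine al be f1 ps1); assumption |].
  split; [apply (is_zero_affine al be f1 ps1 f2 ps2 z); assumption |].
  exists (fun t => affine al be (g t)), a, b. split; [apply (unit_horiz_affine al be f1 ps1); assumption |].
  split; [apply img_affine; [apply h | exact hs] |]. split.
  - unfold affine. limit.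
  - apply (filterlim_ext (fun t => RtoC (sgn al) * ((g t - z) / RtoC (Cmod (g t - z))))%C).
    + intros t. unfold affine.
      replace (RtoC al * g t + RtoC be - (RtoC al * z + RtoC be))%C with (RtoC (Rabs al) * (RtoC (sgn al) * (g t - z)))%C.
      * rewrite unit_vector_scale by (apply Rabs_pos_lt, h).
        replace (Cmod (RtoC (sgn al) * (g t - z))) with (Cmod (g t - z)); [unfold Cdiv; ring |].
        rewrite Cmod_mult, Cmod_R. unfold sgn. destruct (Rlt_dec 0 al); [rewrite Rabs_R1 | rewrite Rabs_left by lra]; ring.
      * rewrite Cmult_assoc, <- RtoC_mult, sgn_abs. ring.
    + limit.
Qed.

Definition hedge_map (al be : R) (h : C * C) : C * C := (affine al be (fst h), (RtoC (sgn al) * snd h)%C).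

Lemma hedge_map_inv_l al be h : al <> 0 -> hedge_map (/ al) (- be / al) (hedge_map al be h) = h.
Proof.
  intros h0. destruct h as [z u]. unfold hedge_map. simpl. rewrite affine_inv_l, sgn_inv by exact h0. f_equal.
  rewrite Cmult_assoc, sgn_sqr. ring.
Qed.

Lemma hedge_map_inv_r al be h : al <> 0 -> hedge_map al be (hedge_map (/ al) (- be / al) h) = h.
Proof.
  intros h0. destruct h as [z u]. unfold hedge_map. simpl. rewrite affine_inv_r, sgn_inv by exact h0. f_equal.
  rewrite Cmult_assoc, sgn_sqr. ring.
Qed.

Lemma hedge_affine al be f1 ps1 f2 ps2 h : affine_equiv al be f1 ps1 f2 ps2 ->
  hedge f1 ps1 h -> hedge f2 ps2 (hedge_map al be h).
Proof. intros ha [S hS]. exists (transport al be S). apply (hedge_of_affine al be f1 ps1); assumption. Qed.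

Lemma opp_affine al be f1 ps1 f2 ps2 h h' : affine_equiv al be f1 ps1 f2 ps2 ->
  Defs.opp f1 ps1 h h' -> Defs.opp f2 ps2 (hedge_map al be h) (hedge_map al be h').
Proof.
  intros ha [hne [S [h1 h2]]]. split.
  - intros k. apply hne. rewrite <- (hedge_map_inv_l al be h (proj1 ha)), <- (hedge_map_inv_l al be h' (proj1 ha)), k.
    reflexivity.
  - exists (transport al be S). split; apply (hedge_of_affine al be f1 ps1); assumption.
Qed.

Lemma hlen_affine al be f1 ps1 f2 ps2 h l : affine_equiv al be f1 ps1 f2 ps2 ->
  hlen f1 ps1 h l -> hlen f2 ps2 (hedge_map al be h) l.
Proof.
  intros ha [S [hS [g [a [b [hg [hs e]]]]]]]. exists (transport al be S).
  split; [apply (hedge_of_affine al be f1 ps1); assumption |].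
  exists (fun t => affine al be (g t)), a, b. split; [apply (unit_horiz_affine al be f1 ps1); assumption |].
  split; [apply img_affine; [apply ha | exact hs] | exact e].
Qed.

Lemma next_affine al be f1 ps1 f2 ps2 h h' : affine_equiv al be f1 ps1 f2 ps2 ->
  next f1 ps1 h h' -> next f2 ps2 (hedge_map al be h) (hedge_map al be h').
Proof.
  intros ha [h1 [h2 [h3 [th [h4 [h5 h6]]]]]].
  split; [apply (hedge_affine al be f1 ps1); assumption |].
  split; [apply (hedge_affine al be f1 ps1); assumption |].
  split; [simpl; rewrite h3; reflexivity |].
  exists th. split; [exact h4 | split; [simpl; rewrite h5; ring |]].
  intros w th1 hw hth k. simpl in k.
  apply (hedge_affine _ _ _ _ _ _ _ (affine_equiv_sym _ _ _ _ _ _ ha)) in hw.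
  unfold hedge_map in hw. simpl in hw. rewrite affine_inv_l, sgn_inv in hw by apply ha.
  apply (h6 _ th1 hw hth). rewrite k, !Cmult_assoc, sgn_sqr. ring.
Qed.

(** Each notion is transported in one direction only; the converses come from the same lemmas
    applied to the inverse map. *)
Lemma ribbon_iso_of_affine al be f1 ps1 f2 ps2 :
  affine_equiv al be f1 ps1 f2 ps2 -> ribbon_iso f1 ps1 f2 ps2.
Proof.
  intros ha. pose proof (affine_equiv_sym _ _ _ _ _ _ ha) as hb. pose proof (proj1 ha) as h0.
  exists (hedge_map al be). split; [| split; [| split; [| split]]].
  - intros h. apply (hedge_affine al be f1 ps1); assumption.
  - intros h h' _ _ e. rewrite <- (hedge_map_inv_l al be h h0), e. apply hedge_map_inv_l, h0.
  - intros k hk. exists (hedge_map (/ al) (- be / al) k). split; [| apply hedge_map_inv_r, h0].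
    apply (hedge_affine _ _ f2 ps2 f1 ps1); assumption.
  - intros h h' _ _. split; split; intros k.
    + apply (opp_affine al be f1 ps1); assumption.
    + apply (opp_affine _ _ f2 ps2 f1 ps1 _ _ hb) in k. rewrite !hedge_map_inv_l in k by exact h0. exact k.
    + apply (next_affine al be f1 ps1); assumption.
    + apply (next_affine _ _ f2 ps2 f1 ps1 _ _ hb) in k. rewrite !hedge_map_inv_l in k by exact h0. exact k.
  - intros h l _. split; intros k.
    + apply (hlen_affine al be f1 ps1); assumption.
    + apply (hlen_affine _ _ f2 ps2 f1 ps1 _ _ hb) in k. rewrite hedge_map_inv_l in k by exact h0. exact k.
Qed.

Lemma RtoC_neq (x y : R) : x <> y -> RtoC x <> RtoC y.
Proof. intros h k. apply h. injection k. auto. Qed.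

(** For [l < 0], [0 < l < 1], [l > 1] the value [mu_of l] makes [nu] equal to [0], [-4 l], [-4]: in
    each case the one whose point [p] is the middle one of [0], [1], [l]. *)
Lemma log_square_real (l : R) : l <> 0 -> l <> 1 ->
  exists p b c : R, b < p < c /\ (0 < l < 1 -> p = l /\ b = 0 /\ c = 1) /\
    log_square (qf (RtoC l) (RtoC (mu_of l))) (qpoles (RtoC l)) p b c /\
    log_square (qf (RtoC l) (RtoC (mu_of l))) (qpoles (RtoC l)) p c b.
Proof.
  intros h0 h1. pose proof (RtoC_neq l 0 h0) as c0. pose proof (RtoC_neq l 1 h1) as c1.
  unfold mu_of. destruct (Rlt_dec l 0) as [k | k]; [| destruct (Rlt_dec l 1) as [k' | k']].
  - exists 0, l, 1. split; [lra | split; [lra |]]. apply and_comm.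
    apply (log_square_qf (RtoC l) _ 0 1 (RtoC l)); auto.
    left. repeat split; apply C_ext; simpl; ring.
  - exists l, 0, 1. split; [lra | split; [auto |]].
    apply (log_square_qf (RtoC l) _ (RtoC l) 0 1); auto.
    right; right. repeat split; apply C_ext; simpl; ring.
  - exists 1, 0, l. split; [lra | split; [lra |]].
    apply (log_square_qf (RtoC l) _ 1 0 (RtoC l)); auto.
    right; left. repeat split; apply C_ext; simpl; ring.
Qed.

Lemma NoDup_qpoles (lam : C) : lam <> RtoC 0 -> lam <> RtoC 1 -> NoDup (qpoles lam).
Proof.
  intros h0 h1. pose proof (RtoC_neq 0 1 ltac:(lra)) as h01.
  unfold qpoles. repeat constructor; simpl; intuition congruence.
Qed.

Lemma affine_R (al be x : R) : affine al be (RtoC x) = RtoC (al * x + be).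
Proof. unfold affine. rewrite RtoC_plus, RtoC_mult. reflexivity. Qed.

Lemma ribbon_iso_standard (l : R) : l <> 0 -> l <> 1 ->
  exists l0 : R, 1 / 2 <= l0 < 1 /\
    ribbon_iso (qf (RtoC l) (RtoC (mu_of l))) (qpoles (RtoC l))
               (qf (RtoC l0) (RtoC (mu_of l0))) (qpoles (RtoC l0)).
Proof.
  intros h0 h1. destruct (log_square_real l h0 h1) as [p [b [c [h [_ [q1 q2]]]]]].
  assert (hR : 0 < c - b) by lra. set (t := (p - b) / (c - b)).
  assert (ht : t * (c - b) = p - b) by (unfold t; field; lra).
  assert (ht01 : 0 < t < 1) by (split; nra).
  assert (std : forall l0, 0 < l0 < 1 ->
     log_square (qf (RtoC l0) (RtoC (mu_of l0))) (qpoles (RtoC l0)) (RtoC l0) (RtoC 0) (RtoC 1) /\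
     log_square (qf (RtoC l0) (RtoC (mu_of l0))) (qpoles (RtoC l0)) (RtoC l0) (RtoC 1) (RtoC 0)).
  { intros l0 hl. destruct (log_square_real l0) as [p' [b' [c' [_ [e [r1 r2]]]]]]; try lra.
    destruct (e hl) as [-> [-> ->]]. auto. }
  (* [t] is the relative position of [p] between [b] and [c]; if it is below [1/2], the map
     [z -> (c - z) / (c - b)] sends [p] to [1 - t]. *)
  destruct (Rle_dec (1 / 2) t) as [k | k].
  - exists t. split; [lra |].
    apply (ribbon_iso_of_affine (/ (c - b)) (- b / (c - b))).
    apply (affine_equiv_of_log_square _ _ _ _ _ _ p b c); auto; [apply Rinv_neq_0_compat; lra |].
    rewrite !affine_R. replace (/ (c - b) * p + - b / (c - b)) with t by (unfold t; field; lra).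
    replace (/ (c - b) * b + - b / (c - b)) with 0 by (field; lra).
    replace (/ (c - b) * c + - b / (c - b)) with 1 by (field; lra). apply std, ht01.
  - exists (1 - t). split; [lra |].
    apply (ribbon_iso_of_affine (- / (c - b)) (c / (c - b))).
    apply (affine_equiv_of_log_square _ _ _ _ _ _ p b c); auto.
    { apply Ropp_neq_0_compat, Rinv_neq_0_compat; lra. }
    rewrite !affine_R. replace (- / (c - b) * p + c / (c - b)) with (1 - t) by (unfold t; field; lra).
    replace (- / (c - b) * b + c / (c - b)) with 1 by (field; lra).
    replace (- / (c - b) * c + c / (c - b)) with 0 by (field; lra). apply std. lra.
Qed.

(* [|B - D| = |B + D|] means [B / D] is imaginary, so [B^2 / D^2] is negative. *)
Lemma strebel_real_ratio f ps (p b c : C) : is_strebel f ps -> log_square f ps p b c ->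
  Im ((b - p) * Cconj (c - p)) = 0 /\ Re ((b - p) * Cconj (c - p)) < 0.
Proof.
  intros hst hq. destruct (Csqrt_ex (b - p)) as [B hB]. destruct (Csqrt_ex (c - p)) as [D hD].
  assert (hno : forall S, closed_traj f ps S -> ~ circle_around ps S -> False).
  { intros S h1 h2. apply h2. destruct hst as [_ [_ [_ [_ [_ hc]]]]]. apply hc, h1. }
  destruct (Rtotal_order (Cmod (B - D)) (Cmod (B + D))) as [k | [k | k]].
  - destruct (not_strebel_of_unequal_critical_values f ps p b c B D hq hB hD k) as [S [h1 h2]]. destruct (hno S h1 h2).
  - assert (e : Re (B * Cconj D) = 0).
    { assert (q : Cmod (B - D) ^ 2 = Cmod (B + D) ^ 2) by (rewrite k; reflexivity).
      rewrite !Cmod_sqr in q. destruct B as [B1 B2], D as [D1 D2]. simpl in *. lra. }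
    assert (hne : (B * Cconj D)%C <> RtoC 0).
    { destruct hq as [_ [[npb [npc _]] _]]. intros q. destruct (Cmult_integral _ _ q) as [r | r].
      - apply npb. symmetry. apply Cminus_eq_zero. rewrite <- hB, r. ring.
      - apply npc. symmetry. apply Cminus_eq_zero. rewrite <- hD.
        rewrite <- (Cconj_conj D), r. apply C_ext; simpl; ring. }
    rewrite <- hB, <- hD, Cmult_conj.
    replace (B * B * (Cconj D * Cconj D))%C with ((B * Cconj D) * (B * Cconj D))%C by ring.
    destruct (B * Cconj D)%C as [x y]. simpl in e. subst x. simpl. split; [ring |].
    assert (y <> 0) by (intros ->; apply hne; reflexivity). nra.
  (* [- D] is the other square root of [c - p], and it exchanges the two critical values. *)
  - destruct (not_strebel_of_unequal_critical_values f ps p b c B (- D) hq) as [S [h1 h2]]; auto.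
    + rewrite <- hD. ring.
    + replace (B - - D)%C with (B + D)%C by ring. exact k.
    + destruct (hno S h1 h2).
Qed.

(** For [p = 0], [1], [lam] the negative ratio forces [lam] to be real and in [lam < 0], [lam > 1],
    [0 < lam < 1] respectively, which matches the branches of [mu_of]. *)
Lemma mu_determined (lam mu : C) : lam <> RtoC 0 -> lam <> RtoC 1 ->
  is_strebel (qf lam mu) (qpoles lam) -> two_double_zeros (qf lam mu) (qpoles lam) ->
  Im lam = 0 /\ mu = RtoC (mu_of (Re lam)).
Proof.
  intros h0 h1 hst h2.
  destruct (quartic_zeros lam mu h0 h1) as [[hc _] | [_ h4]].
  2:{ destruct (not_two_double_and_four_simple _ _ h2 h4). }
  unfold mu_of. destruct hc as [e | [e | e]].
  - destruct (strebel_real_ratio _ _ 0 1 lam hst) as [a1 a2].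
    { apply (proj1 (log_square_qf lam mu 0 1 lam h0 h1 ltac:(tauto))). }
    replace mu with (mu - 2 * (1 + lam) + 2 * (1 + lam))%C by ring. rewrite e.
    destruct lam as [x y]. simpl in *. assert (y = 0) by lra. subst y.
    destruct (Rlt_dec x 0); [| lra]. split; [reflexivity | apply C_ext; simpl; ring].
  - destruct (strebel_real_ratio _ _ 1 0 lam hst) as [a1 a2].
    { apply (proj1 (log_square_qf lam mu 1 0 lam h0 h1 ltac:(tauto))). }
    replace mu with (mu - 2 * (1 + lam) + 2 * (1 + lam))%C by ring. rewrite e.
    destruct lam as [x y]. simpl in *. assert (y = 0) by lra. subst y.
    destruct (Rlt_dec x 0); [lra |]. destruct (Rlt_dec x 1); [lra |].
    split; [reflexivity | apply C_ext; simpl; ring].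
  - destruct (strebel_real_ratio _ _ lam 0 1 hst) as [a1 a2].
    { apply (proj1 (log_square_qf lam mu lam 0 1 h0 h1 ltac:(tauto))). }
    replace mu with (mu - 2 * (1 + lam) + 2 * (1 + lam))%C by ring. rewrite e.
    destruct lam as [x y]. simpl in *. assert (y = 0) by lra. subst y.
    destruct (Rlt_dec x 0); [nra |]. destruct (Rlt_dec x 1); [| nra].
    split; [reflexivity | apply C_ext; simpl; ring].
Qed.

Lemma strebel_double_real (l : R) : l <> 0 -> l <> 1 ->
  is_strebel (qf (RtoC l) (RtoC (mu_of l))) (qpoles (RtoC l)) /\
  two_double_zeros (qf (RtoC l) (RtoC (mu_of l))) (qpoles (RtoC l)).
Proof.
  intros h0 h1. pose proof (RtoC_neq l 0 h0) as c0. pose proof (RtoC_neq l 1 h1) as c1. split.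
  - destruct (log_square_real l h0 h1) as [p [b [c [h [_ [q _]]]]]].
    apply (strebel_of_real_log_square _ _ p b c h); [apply NoDup_qpoles; assumption | exact q].
  - destruct (quartic_zeros (RtoC l) (RtoC (mu_of l)) c0 c1) as [[_ h] | [h _]]; [exact h | exfalso; apply h].
    unfold mu_of. destruct (Rlt_dec l 0); [left | destruct (Rlt_dec l 1); [right; right | right; left]];
      apply C_ext; simpl; ring.
Qed.

(** The two critical values cut the circle [|w| = c - b] into complementary parts. Consequently
    neighbouring edges have total length [1] and meet at right angles. *)
Lemma arc_angle_opp (p b c eps : R) : b < p < c -> arc_angle p b c (- eps) = PI - arc_angle p b c eps.
Proof.
  intros h. unfold arc_angle. rewrite <- acos_opp. f_equal. field. lra.
Qed.

(** Edges with [eps = 1] start at the lower zero [z1], those with [eps = -1] end there. As the two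
    values of [arc_angle] are supplementary, the directions at [z1] are [kap] times [-i], [1], [i],
    [-1], and the sign [eps], hence the length, alternates. *)
Lemma critical_graph_shape f ps (p b c : R) : b < p < c -> log_square f ps p b c ->
  two_vertex_four_edges f ps (arc_angle p b c (-1) / PI) (arc_angle p b c 1 / PI)
    (arc_angle p b c (-1) / PI) (arc_angle p b c 1 / PI).
Proof.
  intros h hq. pose proof PI_RGT_0 as hpi.
  assert (s1 : is_sign 1) by (left; reflexivity). assert (s2 : is_sign (-1)) by (right; reflexivity).
  set (z1 := arc_start p b c 1). set (z2 := arc_start p b c (-1)).
  assert (e1 : Cconj z1 = z2) by (unfold z1, z2; rewrite arc_start_conj; f_equal; ring).
  assert (e2 : Cconj z2 = z1) by (rewrite <- e1; apply Cconj_conj).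
  assert (n12 : z1 <> z2).
  { unfold z1, z2, arc_start. pose proof (half_gap_pos p b c h). intros k; injection k; lra. }
  set (kap := cis (- (arc_angle p b c 1 / 2))).
  assert (k0 : kap <> RtoC 0) by apply cis_neq_0.
  assert (d1 : arc_dir p b c 1 1 = kap) by (unfold arc_dir; fold kap; ring).
  assert (d2 : arc_dir p b c 1 (-1) = (- kap)%C) by (unfold arc_dir; fold kap; ring).
  assert (d3 : forall sg, Cconj (arc_dir p b c (-1) sg) = (RtoC sg * (Ci * kap))%C).
  { intros sg. unfold arc_dir. rewrite Cmult_conj, <- cis_opp_conj.
    replace (arc_angle p b c (-1)) with (PI - arc_angle p b c 1).
    2:{ rewrite <- arc_angle_opp by exact h. f_equal. }
    replace (- - ((PI - arc_angle p b c 1) / 2)) with (- (arc_angle p b c 1 / 2) + PI / 2) by field.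
    rewrite cis_half_PI. fold kap. f_equal. apply C_ext; simpl; ring. }
  assert (d4 : forall sg, arc_dir p b c (-1) sg = Cconj (RtoC sg * (Ci * kap))%C).
  { intros sg. rewrite <- d3, Cconj_conj. reflexivity. }
  set (u1 := (- (Ci * kap))%C). set (u2 := kap). set (u3 := (Ci * kap)%C). set (u4 := (- kap)%C).
  assert (hA : forall eps sg, is_sign eps -> is_sign sg -> _) by
    (intros eps sg he hs; exact (arc_hedges f ps p b c eps sg h he hs hq)).
  assert (E : forall eps sg, is_sign eps -> is_sign sg ->
     edge_len f ps (arcset p b c eps sg) (arc_angle p b c eps / PI)) by (intros; apply arc_length; auto).
  assert (H1 : hedge_of f ps z1 u1 (arcset p b c (-1) (-1)) /\ hedge_of f ps z2 (Cconj u1) (arcset p b c (-1) (-1))).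
  { destruct (hA (-1) (-1) s2 s2) as [a1 a2]. fold z2 in a1, a2. rewrite e2, d3 in a2. rewrite d4 in a1.
    replace u1 with (RtoC (-1) * (Ci * kap))%C by (unfold u1; ring). auto. }
  assert (H2 : hedge_of f ps z1 u2 (arcset p b c 1 1) /\ hedge_of f ps z2 (Cconj u2) (arcset p b c 1 1)).
  { destruct (hA 1 1 s1 s1) as [a1 a2]. fold z1 in a1, a2. rewrite e1, d1 in a2. rewrite d1 in a1. auto. }
  assert (H3 : hedge_of f ps z1 u3 (arcset p b c (-1) 1) /\ hedge_of f ps z2 (Cconj u3) (arcset p b c (-1) 1)).
  { destruct (hA (-1) 1 s2 s1) as [a1 a2]. fold z2 in a1, a2. rewrite e2, d3 in a2. rewrite d4 in a1.
    replace u3 with (RtoC 1 * (Ci * kap))%C by (unfold u3; ring). auto. }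
  assert (H4 : hedge_of f ps z1 u4 (arcset p b c 1 (-1)) /\ hedge_of f ps z2 (Cconj u4) (arcset p b c 1 (-1))).
  { destruct (hA 1 (-1) s1 s2) as [a1 a2]. fold z1 in a1, a2. rewrite e1, d2 in a2. rewrite d2 in a1. auto. }
  exists z1, z2. split; [exact n12 | split; [intros z; apply is_zero_log_square; assumption |]].
  exists u1, u2, u3, u4, (Cconj u1), (Cconj u2), (Cconj u3), (Cconj u4).
  assert (hdist : forall a a' : C, a <> a' -> Cconj (a * kap) <> Cconj (a' * kap)).
  { intros a a' hne k. apply (f_equal Cconj) in k. rewrite !Cconj_conj in k. apply hne, Cminus_eq_zero.
    destruct (Cmult_integral (a - a') kap) as [q | q]; [| exact q | contradiction].
    transitivity (a * kap - a' * kap)%C; [ring | rewrite k; ring]. }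
  assert (w1 : u1 = (- Ci * kap)%C) by (unfold u1; ring). assert (w2 : u2 = (1 * kap)%C) by (unfold u2; ring).
  assert (w3 : u3 = (Ci * kap)%C) by reflexivity. assert (w4 : u4 = (- (1) * kap)%C) by (unfold u4; ring).
  split; [| split; [| split; [| split; [| split; [| split; [| split]]]]]];
    try (rewrite ?w1, ?w2, ?w3, ?w4; apply hdist; intros k; injection k; simpl; intros; lra).
  { intros [z u]. split.
    - intros hh. destruct (hedge_classification f ps p b c z u h hq hh) as [eps [sg [he [hs hcase]]]].
      destruct he; subst eps; fold z1 z2 in hcase; rewrite ?e1, ?e2 in hcase.
      + destruct hs; subst sg; rewrite ?d1, ?d2 in hcase; fold u2 u4 in hcase;
          destruct hcase as [[-> ->] | [-> ->]]; auto 10.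
      + rewrite d3, d4 in hcase.
        destruct hs; subst sg; [replace (RtoC 1 * (Ci * kap))%C with u3 in hcase by (unfold u3; ring)
                               | replace (RtoC (-1) * (Ci * kap))%C with u1 in hcase by (unfold u1; ring)];
          destruct hcase as [[-> ->] | [-> ->]]; auto 10.
    - destruct H1, H2, H3, H4.
      intros [k | [k | [k | [k | [k | [k | [k | k]]]]]]]; rewrite k; eexists; simpl; eassumption. }
  assert (hopp : forall u S, hedge_of f ps z1 u S /\ hedge_of f ps z2 (Cconj u) S -> Defs.opp f ps (z1, u) (z2, Cconj u)).
  { intros u S hS. split; [intros k; apply n12; exact (f_equal fst k) |]. exists S. exact hS. }
  split; [apply (hopp _ _ H1) | split; [apply (hopp _ _ H2) | split; [apply (hopp _ _ H3) | split; [apply (hopp _ _ H4) |]]]].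
  split.
  - exists (PI / 2), PI, (PI / 2 + PI). split; [lra | split; [lra |]].
    assert (c1 : cis (PI / 2) = Ci) by (unfold cis; rewrite cos_PI2, sin_PI2; reflexivity).
    assert (ci2 : (Ci * Ci)%C = (- (1))%C) by (apply C_ext; simpl; ring).
    rewrite cis_PI, c1. assert (cpi : cis PI = (- (1))%C) by (unfold cis; rewrite cos_PI, sin_PI; apply C_ext; simpl; ring).
    rewrite cpi. unfold u1, u2, u3, u4. repeat split.
    + transitivity (- (Ci * Ci) * kap)%C; [rewrite ci2; ring | ring].
    + ring.
    + transitivity (Ci * Ci * kap)%C; [rewrite ci2; ring | ring].
  - split; [| split; [| split]].
    + exists (arcset p b c (-1) (-1)). split; [apply H1 | apply E; assumption].
    + exists (arcset p b c 1 1). split; [apply H2 | apply E; assumption].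
    + exists (arcset p b c (-1) 1). split; [apply H3 | apply E; assumption].
    + exists (arcset p b c 1 (-1)). split; [apply H4 | apply E; assumption].
Qed.

Theorem theorem1p1 :
  (forall lam mu : C, lam <> RtoC 0 -> lam <> RtoC 1 ->
     is_strebel (qf lam mu) (qpoles lam) ->
     two_double_zeros (qf lam mu) (qpoles lam) \/
     four_simple_zeros (qf lam mu) (qpoles lam)) /\
  (forall lam mu : C, lam <> RtoC 0 -> lam <> RtoC 1 ->
     (is_strebel (qf lam mu) (qpoles lam) /\
      two_double_zeros (qf lam mu) (qpoles lam)) <->
     (Im lam = 0 /\ mu = RtoC (mu_of (Re lam)))) /\
  (forall l : R, l <> 0 -> l <> 1 ->
     exists l0 : R, (1 / 2 <= l0 < 1)%R /\
       ribbon_iso (qf (RtoC l) (RtoC (mu_of l))) (qpoles (RtoC l))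
                  (qf (RtoC l0) (RtoC (mu_of l0))) (qpoles (RtoC l0))) /\
  (forall l0 : R, (1 / 2 <= l0 < 1)%R ->
     let s := (asin (2 * l0 - 1) / PI)%R in
     two_vertex_four_edges (qf (RtoC l0) (RtoC (mu_of l0))) (qpoles (RtoC l0))
       (1 / 2 + s) (1 / 2 - s) (1 / 2 + s) (1 / 2 - s))%R.
Proof.
  split; [| split; [| split]].
  - intros lam mu h0 h1 _. destruct (quartic_zeros lam mu h0 h1) as [[_ h] | [_ h]]; auto.
  - intros lam mu h0 h1. split.
    + intros [hs hd]. apply mu_determined; assumption.
    + intros [him ->]. assert (e : lam = RtoC (Re lam)) by (apply C_ext; [reflexivity | exact him]).
      rewrite e. simpl Re. apply strebel_double_real; intros k; rewrite k in e; contradiction.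
  - exact ribbon_iso_standard.
  - intros l0 hl s.
    destruct (log_square_real l0) as [p [b [c [h [e [hq _]]]]]]; try lra.
    destruct e as [-> [-> ->]]; [lra |].
    pose proof (critical_graph_shape _ _ l0 0 1 h hq) as hg.
    (* Here [(b - p) + (c - p) = 1 - 2 l0] and [c - b = 1], so the angle is [acos (2 l0 - 1) = PI /
       2 - asin (2 l0 - 1)]. *)
    assert (a1 : arc_angle l0 0 1 1 / PI = 1 / 2 - s).
    { unfold arc_angle, s. replace (- (1) * (0 - l0 + (1 - l0)) / (1 - 0)) with (2 * l0 - 1) by field.
      rewrite acos_asin by lra. field. apply PI_neq0. }
    assert (a2 : arc_angle l0 0 1 (-1) / PI = 1 / 2 + s).
    { replace (-1) with (- (1)) by ring. rewrite arc_angle_opp by exact h.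
      unfold Rdiv in *. rewrite Rmult_minus_distr_r, a1, Rinv_r by apply PI_neq0. field. }
    rewrite a1, a2 in hg. exact hg.
Qed.
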